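(* Let $i\geq 0$ and $n\geq 0$ be integers. The mapping $\Phi_i$ is a bijection between Kreweras walks of size $n$ (length $3n+2i$) ending at $(i,0)$ and non-separable $(i+2)$-near-cubic maps of size $n$ (with $3n+2i+1$ edges) marked on the root-edge and equipped with a depth tree that contains the edge following the root in counterclockwise order around the root-vertex.
   Context: A Kreweras walk ending at $(i,0)$ is a word $w$ on $\{a,b,c\}$ (steps $a=(-1,0)$, $b=(0,-1)$, $c=(1,1)$) whose walk from the origin stays in the quadrant $x,y\geq 0$ and ends at $(i,0)$; i.e. every prefix $w'$ satisfies $|w'|_a\leq |w'|_c$, $|w'|_b\leq|w'|_c$, and $|w|_a+i=|w|_b=|w|_c$ ($|w|_\alpha$ = number of occurrences of $\alpha$). Such a walk of length $3n+2i$ has size $n$. Maps: a planar map is a connected planar graph (loops, multiple edges allowed) embedded in the sphere up to orientation-preserving homeomorphism; edges consist of two half-edges. A rooted map has a distinguished half-edge (root); its edge is the root-edge, its endpoint the root-vertex. A map is $k$-near-cubic if the root-vertex has degree $k$ and all other vertices degree $3$; it has size $n$ if it has $3n+2k-3$ edges. A map is non-separable if its edge set cannot be partitioned into two non-empty parts such that only one vertex is incident to edges of both parts. For a spanning tree $T$, edges not in $T$ are external; $u$ is an ancestor of $v$ if $u$ lies on the $T$-path from root-vertex to $v$; comparable = one is an ancestor of the other. A depth tree is a spanning tree such that every external edge joins comparable vertices and the root-edge is external. Growing maps: a rooted map with some legs (half-edges not in a complete edge), one of them the head, all legs in one face (head-face); the head-vertex is the endpoint of the head; the root may be a leg. A tree-growing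 map has a distinguished spanning tree. The tour of the head-face follows its border counterclockwise (face on the left) from the head, ordering the other legs and defining the first and last legs; when the root is a leg, legs met before the root in this tour are called left legs. Construction: $M^i_\bullet$ is the tree-growing map with a single vertex carrying a root leg, a head, and $i$ further legs which are all left legs; tree = that vertex. $\varphi_a(M_T)$ (resp. $\varphi_b$) replaces the head by a complete edge $e$ from the head-vertex to a new vertex $v$ carrying the new head and one further leg immediately at the left (resp. right) of the new head; tree becomes $T\cup\{e,v\}$. $\varphi_c(M_T)$ is defined when first and last legs exist with distinct comparable endpoints; naming them $s,t$ with endpoint of $s$ an ancestor of that of $t$, glue the head with $s$ into an edge, make $t$ the new head, $T$ unchanged. $\varphi_{a_1\cdots a_m}=\varphi_{a_1}\circ\cdots\circ\varphi_{a_m}$. For a Kreweras walk $w$ ending at $(i,0)$, $\Phi_i(w)$ is the map with spanning tree obtained from $\varphi_w(M^i_\bullet)$ by gluing the head and the unique remaining leg into a marked edge.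
   Formalization: When the edge following the root is the root-edge itself (only i=n=0, a single loop) it need not lie in the depth tree; and the tour of the head-face meets half-edges counterclockwise around each vertex (face on the right), since with the face on the left the claim fails for i=1, n=0, w=cb. *)

(* Defs.v *)
From HB Require Import structures.
From mathcomp Require Import all_boot.
From mathcomp Require Import boolp.

Set Implicit Arguments.
Unset Strict Implicit.
Unset Printing Implicit Defensive.

(** * Kreweras walks *)

Inductive letter := La | Lb | Lc.

Definition is_a (x : letter) := if x is La then true else false.
Definition is_b (x : letter) := if x is Lb then true else false.
Definition is_c (x : letter) := if x is Lc then true else false.

Definition kreweras (i : nat) (w : seq letter) : Prop :=
  [/\ (forall w1 w2, w = w1 ++ w2 ->
         count is_a w1 <= count is_c w1 /\ count is_b w1 <= count is_c w1),
      count is_a w + i = count is_c w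
    & count is_b w = count is_c w].

(** * Rooted maps, possibly with legs *)

(* A map is encoded by its half-edges ("darts"): [sigma] sends a dart to the
   next one counterclockwise around their common vertex, [alpha] exchanges the
   two halves of a complete edge and fixes the legs.  The record is raw data;
   the axioms are in [planar_map] below. *)
Record rmap := RMap {
  dart :> finType;
  sigma : dart -> dart;
  alpha : dart -> dart;
  root : dart
}.

Arguments sigma {r} _.
Arguments alpha {r} _.
Arguments root {_}.

Section RootedMaps.
Variable M : rmap.
Implicit Types (d e : M) (T : {set M}) (s : seq M).

Definition is_leg d := alpha d == d.

Definition vertex d : {set M} := [set e | fconnect sigma d e].
Definition edge d : {set M} := [set d; alpha d].

(* Keeping the face always on the same side, one leaves a vertex along [d],
   arrives at [alpha d] (or turns back at once if [d] is a leg) and goes on with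
   the adjacent dart of the vertex reached.  [face_next] meets the darts of a
   vertex in counterclockwise order.  This sense is forced on the tour of the
   head-face: [phi_a] must create a leg met before the root, i.e. a left leg,
   when it puts one at the left of the head, and the head of [initial_map] must
   be the dart that follows the root counterclockwise.  The number of faces
   does not depend on the choice. *)
Definition face_next d : M := sigma (alpha d).
Definition face d : {set M} := [set e | fconnect face_next d e].

Definition vertices : {set {set M}} := [set vertex d | d : M].
Definition edges : {set {set M}} := [set edge d | d : M & ~~ is_leg d].
Definition faces : {set {set M}} := [set face d | d : M].

Definition connected_map : Prop :=
  forall d e, connect (fun x y => (y == sigma x) || (y == alpha x)) d e.

(* Embedding in the sphere is Euler's formula. *)
Definition planar_map : Prop :=
  [/\ injective (@sigma M), involutive (@alpha M), (forall d, ~~ is_leg d),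
      connected_map
    & #|vertices| + #|faces| = #|edges| + 2].

Definition degree d := #|vertex d|.

Definition near_cubic k : Prop :=
  degree root = k /\ forall d, vertex d != vertex root -> degree d = 3.

(* [3 n + 2 k - 3] edges, written without truncated subtraction. *)
Definition near_cubic_size k n : Prop := #|edges| + 3 = 3 * n + 2 * k.

(* A set of edges is encoded by the set of all its darts. *)
Definition edge_set T : Prop :=
  forall d, d \in T -> ~~ is_leg d /\ alpha d \in T.

Definition nonseparable : Prop :=
  forall A B : {set M}, edge_set A -> edge_set B ->
    A != set0 -> B != set0 -> [disjoint A & B] ->
    A :|: B = [set d | ~~ is_leg d] ->
    #|[set v in vertices | (v :&: A != set0) && (v :&: B != set0)]| != 1.

(* [T_walk T d s e]: [s] is a walk along edges of [T] from the vertex of [d] to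
   the vertex of [e], each edge being given by the dart through which it
   leaves. *)
Fixpoint T_walk T d s e : bool :=
  if s is x :: s' then
    [&& x \in T, vertex x == vertex d & T_walk T (alpha x) s' e]
  else vertex d == vertex e.

Definition visited d s : seq {set M} :=
  vertex d :: [seq vertex (alpha x) | x <- s].

Definition T_path T d s e : bool := T_walk T d s e && uniq (visited d s).

Definition acyclic T : Prop :=
  forall d s, T_walk T d s d ->
    uniq [seq vertex x | x <- s] -> uniq [seq edge x | x <- s] -> s = [::].

Definition spanning_tree T : Prop :=
  [/\ edge_set T, (forall d e, exists s, T_walk T d s e) & acyclic T].

Definition ancestor T d e : Prop :=
  exists2 s, T_path T root s e & vertex d \in visited root s.

Definition comparable_vertices T d e : Prop := ancestor T d e \/ ancestor T e d.

Definition depth_tree T : Prop :=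
  [/\ spanning_tree T,
      (forall d, ~~ is_leg d -> d \notin T -> comparable_vertices T d (alpha d))
    & root \notin T].

(* The edge of [sigma root] is the one following the root.  In the map reduced
   to a single loop it is the root-edge itself, which is external to every
   depth tree; the condition is void in that degenerate case. *)
Definition contains_next_edge T : Prop :=
  edge (sigma (root : M)) != edge root -> sigma (root : M) \in T.

End RootedMaps.

Arguments face_next {M} _.

(** * Tree-growing maps *)

Record growing := Growing {
  gmap :> rmap;
  head : gmap;
  gtree : {set gmap}
}.

Arguments head _ : clear implicits.
Arguments gtree _ : clear implicits.

(* The legs other than the head, in the order of the tour of the head-face. *)
Definition tour_legs (M : growing) : seq M :=
  [seq d <- behead (orbit face_next (head M)) | is_leg d].

(* The darts of the initial vertex are, counterclockwise: the head [0], the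
   left legs [1, ..., i] and the root leg [i + 1].  The tour that starts from
   the head thus meets the [i] left legs, then the root. *)
Definition initial_map (i : nat) : growing :=
  @Growing (@RMap 'I_i.+2 (@ordS i.+2) id ord_max) ord0 set0.

(** The maps [phi_a] and [phi_b] *)

Section Grow.
(* [left] tells whether the new leg is at the left of the new head, looking from
   the new vertex towards the head: it is then the dart that follows the head
   counterclockwise. *)
Variables (left : bool) (M : growing).

Definition grow_dart : finType := option (M + bool).
Definition old_dart (d : M) : grow_dart := Some (inl d).
Definition back_dart : grow_dart := None. (* second half of the new edge *)
Definition new_head : grow_dart := Some (inr true).
Definition new_leg : grow_dart := Some (inr false).

Definition grow_sigma (x : grow_dart) : grow_dart :=
  match x with
  | Some (inl d) => old_dart (sigma d)
  | None => if left then new_head else new_leg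
  | Some (inr true) => if left then new_leg else back_dart
  | Some (inr false) => if left then back_dart else new_head
  end.

Definition grow_alpha (x : grow_dart) : grow_dart :=
  match x with
  | Some (inl d) => if d == head M then back_dart else old_dart (alpha d)
  | None => old_dart (head M)
  | Some (inr _) => x
  end.

Definition grow : growing :=
  @Growing (@RMap grow_dart grow_sigma grow_alpha (old_dart root)) new_head
    ([set old_dart d | d in gtree M] :|: [set old_dart (head M); back_dart]).

End Grow.

Definition phi_a : growing -> growing := grow true.
Definition phi_b : growing -> growing := grow false.

(** The partial map [phi_c] *)

Definition glue_alpha (M : rmap) (h s : M) (x : M) : M :=
  if x == h then s else if x == s then h else alpha x.

Definition glue (M : rmap) (h s : M) : rmap :=
  @RMap M sigma (glue_alpha h s) root.

Definition glue_head (M : growing) (s t : M) : growing :=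
  @Growing (glue (head M) s) t (gtree M).

Definition phi_c (M : growing) : option growing :=
  if tour_legs M is f :: ls then
    let l := last f ls in
    if vertex f == vertex l then None
    else if `[< ancestor (gtree M) f l >] then Some (glue_head f l)
    else if `[< ancestor (gtree M) l f >] then Some (glue_head l f)
    else None
  else None.

Definition phi (x : letter) (M : growing) : option growing :=
  match x with
  | La => Some (phi_a M)
  | Lb => Some (phi_b M)
  | Lc => phi_c M
  end.

(* Composition of mappings: the last letter of the word acts first. *)
Definition phi_word (w : seq letter) (M : growing) : option growing :=
  foldr (fun x => obind (phi x)) (Some M) w.

(** * Maps with a marked edge and a distinguished tree *)

Record marked_map := MarkedMap {
  mmap :> rmap;
  medge : {set mmap};
  mtree : {set mmap}
}.

Arguments medge _ : clear implicits.
Arguments mtree _ : clear implicits.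

(* Defined when exactly one leg remains besides the head. *)
Definition close (M : growing) : option marked_map :=
  if enum [pred d : M | is_leg d & d != head M] is [:: l] then
    Some (@MarkedMap (glue (head M) l) [set head M; l] (gtree M))
  else None.

Definition Phi (i : nat) (w : seq letter) : option marked_map :=
  obind close (phi_word w (initial_map i)).

(* Equality of maps up to orientation-preserving homeomorphism respecting the
   root, the marked edge and the tree. *)
Definition iso (M N : marked_map) : Prop :=
  exists f : M -> N,
    [/\ bijective f,
        (forall d, f (sigma d) = sigma (f d)),
        (forall d, f (alpha d) = alpha (f d)),
        f root = root
      & [set f d | d in medge M] = medge N /\
        [set f d | d in mtree M] = mtree N].

Definition near_cubic_depth_map (i n : nat) (M : marked_map) : Prop :=
  [/\ planar_map M, nonseparable M,
      near_cubic M (i + 2) /\ near_cubic_size M (i + 2) n,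
      medge M = edge root
    & depth_tree (mtree M) /\ contains_next_edge (mtree M)].

(* Main.v *)
Require Import Defs.
From mathcomp Require Import all_boot.
From mathcomp Require Import fingroup perm zify boolp.
Import Defs.

(** The spanning tree is handled through its ancestor relation.  During the
construction the left legs and the right legs form two stacks of ancestors of
the head-vertex, the deepest ones being met first when one leaves the head in
either direction.  The letters a and b push a leg of a new vertex; the letter c
pops both tops, glues the head to the shallower one and makes the deeper one the
new head.  Hence a word acts as long as the stacks do not run empty, which is
the Kreweras condition read backwards, and every external edge joins comparable
vertices.

Injectivity: the last letter is read off the darts next to the head; after a
letter c the glued edge is the first (or last) edge through which the tour of
the head-face leaves the subtree of the head-vertex.

Surjectivity: a map of the target, opened along its root-edge, satisfies
invariants that persist when a step is undone.  By non-separability every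
subtree hanging off the branch of the head is attached to a strict ancestor, so
that, by Euler's inequality, no edge at the head-vertex except the parent one
has the same face on both sides.  Therefore the tour leaves the subtree of the
head-vertex through an external edge, and this is the edge to cut. *)

Set Implicit Arguments.
Unset Strict Implicit.
Unset Printing Implicit Defensive.

(** * Counting the orbits of a permutation *)

(** The ancestor relation is kept as data because cutting or gluing an external edge leaves it
    unchanged; [ancestorE] returns to the paths of the statement and shows that the tree determines
    the relation, so that isomorphisms respect it. The invariants are divided according to the
    direction in which they travel. Those of [explored] hold after a step and after its undoing, and
    do not speak of the stacks. Those of [ordered], which do, are only propagated forwards: for
    surjectivity an undone map is compared with a map built from a word, where the stacks are known,
    so the order of the legs never has to be reconstructed. Undoing a step must remove an edge
    without disconnecting the map or changing the genus. Both are controlled by counting orbits,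
    since the equality for the map and the inequality for the cut map leave a single possibility for
    the faces. The clauses of [explored] on the root-vertex express that non-separability leaves it
    at most one tree edge, which the target set forces to follow the root. *)

Definition norb (T : finType) (f : T -> T) :=
  #|[set [set y | fconnect f x y] | x : T]|.

Lemma eq_norb (T : finType) (f g : T -> T) : f =1 g -> norb f = norb g.
Proof.
move=> fg; rewrite /norb; congr #|pred_of_set _|; apply: eq_imset => x.
by apply/setP=> y; rewrite !inE (eq_fconnect fg).
Qed.

(** A transposition splits the orbit that contains both points and otherwise merges their two
    orbits, so the count changes by one; the doubled boolean covers both cases without
    subtraction. *)
Lemma norb_tperm (T : finType) (f : T -> T) (x y : T) :
  injective f -> x != y ->
  norb (f \o tperm x y) + (~~ fconnect f y x).*2 = norb f + 1.
Proof.
move=> injf xy; have fE := permE injf.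
have norbE (s : {perm T}) : norb s = #|porbits s|.
  rewrite /norb /porbits; congr #|pred_of_set _|; apply: eq_imset => z.
  apply/setP=> u; rewrite inE; apply/idP/porbitP=> [/iter_findex <-|[k ->]].
    by exists (findex s z u); rewrite permX.
  by rewrite permX fconnect_iter.
rewrite (eq_norb (g := (tperm x y * perm injf)%g)); last first.
  by move=> z; rewrite permM fE.
rewrite -(eq_norb fE) !norbE -(eq_fconnect fE).
have := porbits_mul_tperm (perm injf) x y; rewrite xy => <-.
congr (_ + (~~ _).*2); apply/idP/porbitP=> [/iter_findex <-|[k ->]].
  by exists (findex (perm injf) y x); rewrite permX.
by rewrite permX fconnect_iter.
Qed.

Lemma fconnect_morph (T U : finType) (f : T -> T) (g : U -> U) (h : T -> U) :
  injective h -> (forall x, h (f x) = g (h x)) ->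
  forall x y, fconnect g (h x) (h y) = fconnect f x y.
Proof.
move=> injh hfg x y; have iterE k : iter k g (h x) = h (iter k f x).
  by elim: k => //= k ->; rewrite hfg.
apply/idP/idP=> /iter_findex; last by move<-; rewrite -iterE fconnect_iter.
by rewrite iterE => /injh <-; rewrite fconnect_iter.
Qed.

Lemma fconnect_morphP (T U : finType) (f : T -> T) (g : U -> U) (h : T -> U) :
  (forall x, h (f x) = g (h x)) ->
  forall x u, fconnect g (h x) u -> exists2 y, u = h y & fconnect f x y.
Proof.
move=> hfg x u /iter_findex <-; exists (iter (findex g (h x) u) f x).
  by elim: findex => //= k ->; rewrite hfg.
exact: fconnect_iter.
Qed.

Lemma orbit_set_morph (T U : finType) (f : T -> T) (g : U -> U) (h : T -> U) :
  injective h -> (forall x, h (f x) = g (h x)) ->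
  forall x, [set u | fconnect g (h x) u] = h @: [set y | fconnect f x y].
Proof.
move=> injh hfg x; apply/setP=> u; rewrite inE; apply/idP/imsetP.
  by case/(fconnect_morphP hfg) => y -> fxy; exists y; rewrite ?inE.
by case=> y; rewrite inE => fxy ->; rewrite (fconnect_morph injh hfg).
Qed.

Lemma norb_iso (T U : finType) (f : T -> T) (g : U -> U) (h : T -> U) :
  bijective h -> (forall x, h (f x) = g (h x)) -> norb f = norb g.
Proof.
move=> bijh hfg; have injh := bij_inj bijh.
rewrite /norb -(card_imset _ (imset_inj injh)) -imset_comp.
congr #|pred_of_set _|; apply/setP=> A; apply/imsetP/imsetP => -[x _ ->].
  by exists (h x); rewrite ?inE //= -(orbit_set_morph injh hfg).
case: bijh => k hk kh; exists (k x) => //=.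
by rewrite -(orbit_set_morph injh hfg) kh.
Qed.

(** Used when a vertex is added: its darts are those outside the image of [h], and they make up one
    new orbit. *)
Lemma norb_extend (T U : finType) (f : T -> T) (g : U -> U) (h : T -> U) u0 :
    injective g -> injective h -> (forall x, h (f x) = g (h x)) ->
    (forall u, fconnect g u0 u = (u \notin codom h)) ->
  norb g = (norb f).+1.
Proof.
move=> injg injh hfg newE; pose orb0 := [set u | fconnect g u0 u].
pose orbs := [set [set y | fconnect f x y] | x : T].
have -> : norb g = #|orb0 |: imset (fun A : {set T} => h @: A) (mem orbs)|.
  congr #|pred_of_set _|; apply/setP=> A; rewrite -imset_comp !inE.
  apply/imsetP/orP => [[u _ ->]|[/eqP->|/imsetP[x _ ->]]]; last 2 first.
  - by exists u0.
  - by exists (h x); rewrite ?inE //= -(orbit_set_morph injh hfg).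
  have [/codomP[x ->]|uN] := boolP (u \in codom h).
    right; apply/imsetP; exists x => //=; exact: orbit_set_morph.
  left; apply/eqP/setP=> v; rewrite !inE.
  by rewrite -newE in uN; rewrite (same_connect (fconnect_sym injg) uN).
rewrite cardsU1 (card_imset _ (imset_inj injh)) [orb0 \in _](_ : _ = false) //.
apply/negP => /imsetP[A /imsetP[x _ ->]] orb0E.
have : h x \in orb0 by rewrite orb0E imset_f ?inE.
by rewrite inE newE codom_f.
Qed.

Lemma card_classes (T : finType) (e : rel T) :
  connect_sym e -> #|[set [set y | connect e x y] | x : T]| = n_comp e T.
Proof.
move=> sym_e; pose C x := [set y | connect e x y].
have -> : [set C x | x : T] = [set C x | x in fingraph.roots e].
  apply/setP=> A; apply/imsetP/imsetP => -[x xr ->]; last by exists x.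
  exists (fingraph.root e x); first exact: roots_root.
  by apply/setP=> y; rewrite !inE (same_connect sym_e (connect_root e x)).
rewrite card_in_imset; first by apply: eq_card => x; rewrite !inE andbT.
move=> x y /eqP xr /eqP yr /setP/(_ y); rewrite !inE connect0 => /rootP.
by rewrite xr yr; apply.
Qed.

Definition link (T : finType) (s a : T -> T) : rel T :=
  fun x y => (y == s x) || (y == a x).

Lemma link_sym (T : finType) (s a : T -> T) :
  injective s -> injective a -> connect_sym (link s a).
Proof.
move=> injs inja x y.
have linkE : link s a =2 relU (coerced_frel s) (coerced_frel a).
  by move=> u v; rewrite /link /= ![v == _]eq_sym.
rewrite !(eq_connect linkE) relU_sym //; exact: fconnect_sym.
Qed.

Lemma link_s (T : finType) (s a : T -> T) x : link s a x (s x).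
Proof. by rewrite /link eqxx. Qed.

Lemma link_a (T : finType) (s a : T -> T) x : link s a x (a x).
Proof. by rewrite /link eqxx orbT. Qed.

(** Severing the edge of [x]: both halves become legs, so the set of darts, hence [sigma], can stay
    the same. *)
Definition cut_fun (T : finType) (a : T -> T) x y :=
  if (y == x) || (y == a x) then y else a y.

Lemma cut_funK (T : finType) (a : T -> T) x :
  involutive a -> involutive (cut_fun a x).
Proof.
move=> inva y; rewrite {2}/cut_fun; case: ifP => [yx|]; first by rewrite /cut_fun yx.
rewrite /cut_fun (inv_eq inva) [a y == a x](inj_eq (inv_inj inva)) orbC.
by move->; rewrite inva.
Qed.

Lemma cut_fun_tperm (T : finType) (a : T -> T) x :
  involutive a -> cut_fun a x =1 a \o tperm x (a x).
Proof.
move=> inva y; rewrite /cut_fun /=; case: tpermP => [->|->|/eqP yx /eqP yax].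
- by rewrite eqxx inva.
- by rewrite eqxx orbT.
by rewrite (negPf yx) (negPf yax).
Qed.

(** Only the component of [x] can change. It becomes the closure of the two halves under the
    remaining links, which consists of one or two components; everything outside keeps its links. *)
Lemma n_comp_cut (T : finType) (s a : T -> T) x :
  injective s -> involutive a ->
  n_comp (link s (cut_fun a x)) T =
  n_comp (link s a) T + ~~ connect (link s (cut_fun a x)) x (a x).
Proof.
move=> injs inva; set e' := link s _; set e := link s a.
have sym_e : connect_sym e := link_sym injs (inv_inj inva).
have sym_e' : connect_sym e' := link_sym injs (inv_inj (cut_funK x inva)).
have e'E u v : u != x -> u != a x -> e' u v = e u v.
  by move=> ux uax; rewrite /e' /e /link /cut_fun (negPf ux) (negPf uax).
have sub_e' : subrel e' (connect e).
  move=> u v /orP[/eqP->|]; first exact: connect1 (link_s _ _ _).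
  by rewrite /cut_fun; case: ifP => _ /eqP->; rewrite ?connect0 ?(connect1 (link_a _ _ _)).
pose C := connect e x.
have C_closed : closed e C := connect_closed sym_e x.
have C_closed' : closed e' C.
  by move=> u v /sub_e' /(closed_connect C_closed).
have memCl : {subset pred2 x (a x) <= closure e' (pred2 x (a x))} .
  by move=> u uP; apply: mem_closure.
have Cl_closed' := closure_closed sym_e' (pred2 x (a x)).
(* The only links lost join [x] and [a x], both in the closure; hence the closure is also stable
   under the old links. *)
have Cl_closed : closed e (closure e' (pred2 x (a x))).
  apply: (intro_closed sym_e) => u v /orP[/eqP-> | /eqP->] uCl.
    by rewrite -(Cl_closed' u) //; apply: link_s.
  have [uxy|uxy] := boolP ((u == x) || (u == a x)).
    apply: memCl; rewrite inE; case/orP: uxy => /eqP->; rewrite ?inva eqxx ?orbT //.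
  by rewrite -(Cl_closed' u) // /e' /link /cut_fun (negPf uxy) eqxx orbT.
have CE : C =i closure e' (pred2 x (a x)).
  move=> u; apply/idP/idP => [xu|/existsP[v /andP[/= uv]]]; last first.
    rewrite -(closed_connect C_closed' (x := v)); last by rewrite sym_e'.
    by case/pred2P=> ->; [apply: connect0 | apply: connect1 (link_a _ _ _)].
  by rewrite -(closed_connect Cl_closed xu) memCl // inE eqxx.
rewrite (n_compC C e') (n_compC C e) (eq_n_comp_r CE) (n_comp_closure2 sym_e').
rewrite (n_comp_connect sym_e) add1n addSn addSn addnC; congr (_ + _).+1.
apply: eq_card => u; rewrite !inE /=; have [uC|uC] := boolP (C u); rewrite ?andbF //.
rewrite !andbT /fingraph.roots /fingraph.root (eq_pick (Q := connect e u)) //.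
move=> v; apply/idP/idP; first exact: connect_sub.
case/connectP=> p ep ->{v}; elim: p u uC ep => //= v p IHp u uC /andP[uv vp].
have vC : ~~ C v by rewrite -[C v](C_closed _ _ uv).
apply: connect_trans (IHp _ vC vp); apply: connect1; rewrite e'E //.
  by apply: contraNneq uC => ->; apply: connect0.
by apply: contraNneq uC => ->; apply: connect1 (link_a _ _ _).
Qed.

Lemma norb_comp_tperm (T : finType) (s a : T -> T) x :
    injective s -> involutive a -> a x != x ->
  norb (s \o cut_fun a x) + (~~ fconnect (s \o a) x (a x)).*2 = norb (s \o a) + 1.
Proof.
move=> injs inva ax; have injsa : injective (s \o a) := inj_comp injs (inv_inj inva).
rewrite (eq_norb (g := (s \o a) \o tperm x (a x))) => [|y /=]; last first.
  by rewrite cut_fun_tperm.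
by rewrite fconnect_sym // norb_tperm // eq_sym.
Qed.

Lemma card_cut_fun (T : finType) (a : T -> T) x :
    involutive a -> a x != x ->
  #|[pred y | a y != y]| = #|[pred y | cut_fun a x y != y]| + 2.
Proof.
move=> inva ax; rewrite -(cardID (pred2 x (a x))) addnC; congr (_ + _).
  by apply: eq_card => y; rewrite !inE /cut_fun; case: ifP; rewrite ?eqxx.
have <- : #|pred2 x (a x)| = 2 by rewrite card2 eq_sym ax.
apply: eq_card => y; rewrite !inE.
have [/orP[]/eqP->|_] := boolP ((y == x) || (y == a x)); rewrite ?andbF //.
  by rewrite ax.
by rewrite inva eq_sym ax.
Qed.

(* Induction on the number of edges: cutting an edge creates an orbit of
   [s \o a] when both halves lie in the same one, and otherwise merges two
   orbits; in a disconnecting cut the former must happen. *)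
Lemma euler_inequality (T : finType) (s a : T -> T) :
  injective s -> involutive a ->
  (norb s).*2 + (norb (s \o a)).*2 <= #|[pred x | a x != x]| + 4 * n_comp (link s a) T.
Proof.
move=> injs; move En : #|_| => n; elim/ltn_ind: n => n IHn in a En * => inva.
have [x /= ax|a1] := pickP [pred x | a x != x]; last first.
  have aE x : a x = x by apply/eqP; have /negbFE := a1 x.
  rewrite (eq_norb (f := s \o a) (g := s)) => [|x]; last by rewrite /= aE.
  have -> : norb s = n_comp (link s a) T.
    rewrite -card_classes; last exact: link_sym (inv_inj inva).
    congr #|pred_of_set _|; apply: eq_imset => x; apply/setP=> y; rewrite !inE.
    apply/idP/idP; apply: connect_sub => u v; last first.
      by case/orP=> /eqP->; rewrite ?aE ?connect0 ?fconnect1.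
    by move/eqP<-; rewrite connect1 ?link_s.
  lia.
have := norb_comp_tperm injs inva ax; have := n_comp_cut x injs inva.
have := card_cut_fun inva ax; rewrite En => nE.
have ltn : #|[pred y | cut_fun a x y != y]| < n by lia.
have := IHn _ ltn _ erefl (cut_funK x inva).
case cxx : (connect (link s (cut_fun a x)) x (a x)) => /=.
  rewrite nE; move: (norb _) (norb _) (norb _) (n_comp _ _) (n_comp _ _) #|_|.
  by case: (fconnect _ _ _) => /= *; lia.
have injf' : injective (s \o cut_fun a x).
  exact: inj_comp injs (inv_inj (cut_funK x inva)).
have := norb_tperm injf' (x := x) (y := a x); rewrite eq_sym ax => /(_ isT).
rewrite (eq_norb (g := s \o a)) => [|y /=]; last first.
  by rewrite cut_fun_tperm //= tpermK.
(* An orbit of the permutation stays in one component, so a disconnecting cut puts the two halves in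
   distinct orbits. *)
suff -> : fconnect (s \o cut_fun a x) (a x) x = false.
  rewrite nE; move: (norb _) (norb _) (norb _) (n_comp _ _) (n_comp _ _) #|_|.
  by case: (fconnect _ _ _) => /= *; lia.
apply: contraFF cxx; rewrite fconnect_sym //; apply: connect_sub => u v /eqP <- /=.
by apply: connect_trans (connect1 (link_s _ _ _)); rewrite connect1 ?link_a.
Qed.

(** * Euler's formula *)

Definition nonlegs (M : rmap) := #|[pred x : M | ~~ is_leg x]|.

Lemma mem_edge_eq (M : rmap) (x y : M) :
  involutive (@alpha M) -> y \in edge x -> edge y = edge x.
Proof. by move=> inva /set2P[->//|->]; rewrite /edge inva setUC. Qed.

Lemma card_edges (M : rmap) :
  involutive (@alpha M) -> #|edges M| * 2 = nonlegs M.
Proof.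
move=> inva; pose D := [set x : M | ~~ is_leg x].
have edgeD (x y : M) : y \in edge x -> (y \in D) = (x \in D).
  by move=> /set2P[] -> //; rewrite !inE /is_leg inva eq_sym.
have -> : nonlegs M = #|D| by apply: eq_card => x; rewrite !inE.
apply/esym/card_uniform_partition => [_ /imsetP[x xD ->]|].
  by rewrite inE in xD; rewrite cards2 eq_sym xD.
apply/and3P; split.
- apply/eqP/setP=> x; apply/bigcupP/idP => [[_ /imsetP[y yD ->]]|xD].
    by move=> /edgeD ->; rewrite inE in yD *.
  exists (edge x); last exact: set21.
  by apply: imset_f; move: xD; rewrite !inE.
- apply/trivIsetP=> _ _ /imsetP[x _ ->] /imsetP[y _ ->].
  apply: contraNT => /pred0Pn[z /andP[/= zx zy]].
  by rewrite -(mem_edge_eq inva zx) (mem_edge_eq inva zy).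
- by apply/imsetP=> -[x _ /setP/(_ x)]; rewrite !inE eqxx.
Qed.

(** Twice the formula of [planar_map], with [nonlegs] standing for twice the number of edges, so
    that it also applies to maps with legs. *)
Definition euler (M : rmap) : Prop :=
  (norb (@sigma M)).*2 + (norb (@face_next M)).*2 = nonlegs M + 4.

Lemma eulerP (M : rmap) : involutive (@alpha M) ->
  euler M <-> #|vertices M| + #|faces M| = #|edges M| + 2.
Proof.
move=> inva; rewrite /euler -card_edges //.
have -> : #|vertices M| = norb (@sigma M) by [].
have -> : #|faces M| = norb (@face_next M) by [].
by split; lia.
Qed.

Definition joined (M : rmap) : rel M := link (@sigma M) (@alpha M).

Lemma euler_le (M : rmap) :
    injective (@sigma M) -> involutive (@alpha M) -> n_comp (@joined M) M = 1 ->
  (norb (@sigma M)).*2 + (norb (@face_next M)).*2 <= nonlegs M + 4.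
Proof.
move=> injs inva connM; have := euler_inequality injs inva.
by rewrite -/(@joined M) connM muln1.
Qed.

Definition cut (M : rmap) (x : M) : rmap :=
  @RMap M sigma (cut_fun alpha x) root.

(** Cutting removes two darts from [nonlegs] and changes the number of faces by one. When the cut
    map is connected, Euler's inequality excludes an increase, so two distinct faces are merged. *)
Lemma euler_cut (M : rmap) (x : M) :
    injective (@sigma M) -> involutive (@alpha M) -> ~~ is_leg x ->
    euler M -> n_comp (@joined (cut x)) M = 1 ->
  [/\ euler (cut x), ~~ fconnect (@face_next M) x (alpha x)
    & fconnect (@face_next (cut x)) x (alpha x)].
Proof.
move=> injs inva xN eM connx.
have invC := cut_funK x inva.
have leM := @euler_le (cut x) injs invC connx.
have normE : norb (@face_next (cut x)) + (~~ fconnect (@face_next M) x (alpha x)).*2 =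
  norb (@face_next M) + 1 := norb_comp_tperm injs inva xN.
have normE' : norb (@face_next M) + (~~ fconnect (@face_next (cut x)) x (alpha x)).*2 =
    norb (@face_next (cut x)) + 1.
  have injC : injective (@face_next (cut x)) := inj_comp injs (inv_inj invC).
  rewrite fconnect_sym // -(norb_tperm (x := x) (y := alpha x) injC); last by rewrite eq_sym.
  congr (_ + _); apply: eq_norb => y.
  by rewrite /face_next /= cut_fun_tperm //= tpermK.
have nE : nonlegs M = nonlegs (cut x) + 2 := card_cut_fun inva xN.
have sE : norb (@sigma (cut x)) = norb (@sigma M) by [].
move: eM leM normE normE' nE; rewrite /euler sE.
move: (norb _) (norb _) (norb _) (nonlegs _) (nonlegs _).
by case: (fconnect _ _ _); case: (fconnect _ _ _) => /= *; split=> //; lia.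
Qed.

(** * Rooted trees through their ancestor relation *)

(* [A x y] says that the vertex of [x] is a weak ancestor of that of [y]. *)
Record rooted_tree (M : rmap) (T : {set M}) (A : rel M) : Prop := RootedTree {
  rt_vertex : forall x y, fconnect sigma x y = A x y && A y x;
  rt_trans : transitive A;
  rt_root : forall x, A root x;
  rt_edge : edge_set T;
  rt_mono : forall x, x \in T -> A x (alpha x) (+) A (alpha x) x;
  rt_parent : forall x, ~~ A x root -> exists p,
    [/\ p \in T, A x p /\ A p x, A (alpha p) p
      & forall z, A z x -> A x z || A z (alpha p)];
  rt_uniq : forall p q, p \in T -> q \in T -> A p q -> A q p ->
    A (alpha p) p -> A (alpha q) q -> p = q
}.

Section RootedTree.
Variables (M : rmap) (T : {set M}) (A : rel M).
Hypotheses (inva : involutive (@alpha M)) (rtA : rooted_tree T A).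
Implicit Types x y z p q : M.

Let trA := rt_trans rtA.

Lemma rt_refl x : A x x.
Proof. by have := rt_vertex rtA x x; rewrite connect0 => /esym/andP[]. Qed.
Hint Resolve rt_refl : core.

Lemma rt_vertex_eq x y : (vertex x == vertex y) = A x y && A y x.
Proof.
rewrite -(rt_vertex rtA); apply/eqP/idP => [xy|].
  have: y \in vertex x by rewrite xy inE connect0.
  by rewrite inE.
rewrite (rt_vertex rtA) => /andP[xy yx]; apply/setP=> z; rewrite !inE !(rt_vertex rtA).
by apply/andP/andP => -[h1 h2]; split;
  [apply: trA yx h1 | apply: trA h2 xy | apply: trA xy h1 | apply: trA h2 yx].
Qed.

Lemma rt_sigmar x y : A x (sigma y) = A x y.
Proof.
have : fconnect sigma y (sigma y) by exact: fconnect1.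
rewrite (rt_vertex rtA) => /andP[ys sy].
by apply/idP/idP => h; apply: trA h _.
Qed.

Lemma rt_sigmal x y : A (sigma x) y = A x y.
Proof.
have : fconnect sigma x (sigma x) by exact: fconnect1.
rewrite (rt_vertex rtA) => /andP[xs sx].
by apply/idP/idP; apply: trA.
Qed.

(** The measure is the number of darts at ancestors of [x]. It drops from [x] to the upper end of
    its parent edge, because [p] itself is lost. *)
Lemma rt_ind (Q : M -> Prop) :
    (forall x, A x root -> Q x) ->
    (forall x p, ~~ A x root -> p \in T -> A x p -> A p x -> A (alpha p) p ->
       ~~ A p (alpha p) -> (forall z, A z x -> A x z || A z (alpha p)) ->
       Q (alpha p) -> Q x) ->
  forall x, Q x.
Proof.
move=> Q0 QS x; move En : #|[pred z | A z x]| => n.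
elim/ltn_ind: n => n IHn in x En *.
have [|xN] := boolP (A x root); first exact: Q0.
have [p [pT [xp px] app pP]] := rt_parent rtA xN.
have pap : ~~ A p (alpha p) by have := rt_mono rtA pT; rewrite app addbT.
apply: (QS x p) => //; apply: IHn erefl; rewrite -En; apply: proper_card.
apply/properP; split; last first.
  by exists x; rewrite !inE //; apply: contra pap; apply: trA.
by apply/subsetP=> z; rewrite !inE => /trA; apply; apply: trA px.
Qed.

Lemma rt_chain x y z : A x z -> A y z -> A x y || A y x.
Proof.
elim/rt_ind: z => [z zr|z p zN pT zp pz app pap pP IH] xz yz.
  by rewrite (trA (trA xz zr) (rt_root rtA y)).
have /orP[zx|xap] := pP _ xz; first by rewrite (trA yz zx) orbT.
have /orP[zy|yap] := pP _ yz; first by rewrite (trA xz zy).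
exact: IH.
Qed.

Lemma rt_T_neq x : x \in T -> ~~ (A x (alpha x) && A (alpha x) x).
Proof. by move/(rt_mono rtA); case: (A _ _) => //= /negPf->. Qed.

(** A tree edge joins a vertex to its parent, so it can leave a subtree only from the top vertex and
    upwards. *)
Lemma rt_exit x y : y \in T -> A x y -> ~~ A x (alpha y) -> A y x && A (alpha y) y.
Proof.
move=> yT xy xay; have := rt_mono rtA yT.
have [yay|yay] /= := boolP (A y (alpha y)); first by rewrite (trA xy yay) in xay.
move=> ayy; rewrite ayy andbT.
have yN : ~~ A y root.
  by apply: contra yay => yr; apply: trA yr (rt_root rtA _).
have [p [pT [yp py] app pP]] := rt_parent rtA yN.
have pE : p = y by apply: (rt_uniq rtA).
by have := pP _ xy; rewrite pE (negPf xay) orbF.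
Qed.

Lemma rt_parentE x p : p \in T -> A (alpha p) p -> A p x -> A x p ->
  forall z, A z x -> A x z || A z (alpha p).
Proof.
move=> pT app px xp z zx; have [zap|zap] := boolP (A z (alpha p)); first by rewrite orbT.
by rewrite orbF; have /andP[pz _] := rt_exit pT (trA zx xp) zap; apply: trA pz.
Qed.

Lemma rt_parent_nonroot p : p \in T -> A (alpha p) p -> ~~ A p root.
Proof.
move=> pT app; apply: contra (rt_T_neq pT) => pr.
by rewrite app (trA pr (rt_root rtA _)).
Qed.

Lemma edge_alpha x : edge (alpha x) = edge x.
Proof. by rewrite /edge inva setUC. Qed.

Lemma T_walk_eqv d1 d2 s e :
  vertex d1 = vertex d2 -> T_walk T d1 s e = T_walk T d2 s e.
Proof. by case: s => [|x s] /= ->. Qed.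

Lemma T_walk_cat d s1 e s2 f :
  T_walk T d s1 e -> T_walk T e s2 f -> T_walk T d (s1 ++ s2) f.
Proof.
elim: s1 d => [|x s1 IH] d /=; first by move=> /eqP/T_walk_eqv ->.
by case/and3P=> -> -> /IH h /h ->.
Qed.

Lemma T_walk_rev d s e : edge_set T -> T_walk T d s e -> T_walk T e (rev (map alpha s)) d.
Proof.
move=> eT; elim: s d => [|x s IH] d /=; first by rewrite eq_sym.
case/and3P=> xT /eqP xd /IH h; rewrite rev_cons -cats1; apply: T_walk_cat h _ => /=.
by rewrite inva xd !eqxx !andbT; have [] := eT _ xT.
Qed.

Lemma visited_rcons d s x : visited d (rcons s x) = rcons (visited d s) (vertex (alpha x)).
Proof. by rewrite /visited map_rcons. Qed.

(* A walk that does not turn back never climbs after its first descent. *)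
Lemma T_walk_down y d s e :
    T_walk T d s e -> y \in T -> A y (alpha y) -> vertex (alpha y) = vertex d ->
    uniq (edge y :: map (@edge M) s) ->
  A (alpha y) e.
Proof.
elim: s y d => [|x s IH] y d /= + yT yay yd.
  by move=> /eqP de _; have := rt_vertex_eq (alpha y) e; rewrite yd de eqxx => /esym/andP[].
case/and3P=> xT /eqP xd xse /andP[]; rewrite inE negb_or => /andP[yx ys] us.
have /andP[xay ayx] : A x (alpha y) && A (alpha y) x by rewrite -rt_vertex_eq xd yd.
have ayT : alpha y \in T by have [] := rt_edge rtA yT.
have xax : A x (alpha x).
  have := rt_mono rtA xT; have [//|_] /= := boolP (A x _) => axx.
  have xE : x = alpha y by apply: (rt_uniq rtA) => //; rewrite inva.
  by case/eqP: yx; rewrite xE edge_alpha.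
exact: trA (trA ayx xax) (IH x _ xse xT xax erefl us).
Qed.

(** If the first step climbed, the second would descend by induction and the walk would stay below
    it. Then [e] would lie below two distinct children of the same vertex, unless the second edge
    were the first one reversed. *)
Lemma T_walk_first d x s e :
  T_walk T d (x :: s) e -> uniq (map (@edge M) (x :: s)) -> A d e -> A x (alpha x).
Proof.
elim: s d x => [|z s IH] d x /=.
  case/and3P=> xT /eqP xd /eqP axe _ de.
  have /andP[xd' dx] : A x d && A d x by rewrite -rt_vertex_eq xd.
  have /andP[axe' eax] : A (alpha x) e && A e (alpha x) by rewrite -rt_vertex_eq axe.
  exact: trA (trA xd' de) eax.
case/and5P=> xT /eqP xd zT /eqP zax zse uxzs de.
have /andP[xd' dx] : A x d && A d x by rewrite -rt_vertex_eq xd.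
have /andP[zx xz] : A z (alpha x) && A (alpha x) z by rewrite -rt_vertex_eq zax.
have := rt_mono rtA xT; have [//|_] /= := boolP (A x _) => axx.
have zaz : A z (alpha z).
  apply: (IH (alpha x)) => /=; first by rewrite zT zax eqxx.
    by case/andP: uxzs.
  exact: trA axx (trA xd' de).
case/and3P: uxzs; rewrite inE negb_or => /andP[xz' _] zs us.
have aze : A (alpha z) e.
  by apply: (T_walk_down zse) => //=; rewrite zs.
have azT : alpha z \in T by have [] := rt_edge rtA zT.
have /orP[azx|xaz] := rt_chain aze (trA xd' de).
  have := rt_parentE xT axx (rt_refl x) (rt_refl x) azx.
  case/orP=> [xaz|azax]; last first.
    by have := rt_T_neq zT; rewrite zaz (trA azax xz).
  have xE : x = alpha z by apply: (rt_uniq rtA) => //; rewrite inva.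
  by case/eqP: xz'; rewrite xE edge_alpha.
have := rt_parentE azT _ (rt_refl _) (rt_refl _) xaz; rewrite inva => /(_ zaz).
case/orP=> [azx|xz2].
  have xE : x = alpha z by apply: (rt_uniq rtA) => //; rewrite inva.
  by case/eqP: xz'; rewrite xE edge_alpha.
by have := rt_T_neq xT; rewrite axx (trA xz2 zx).
Qed.

(** A closed walk descends at its first step and never climbs back to its origin. *)
Lemma rt_acyclic : acyclic T.
Proof.
move=> d [//|x s] w _ us; have xax := T_walk_first w us (rt_refl d).
case/and3P: w => xT /eqP xd w.
have /andP[xd' dx] : A x d && A d x by rewrite -rt_vertex_eq xd.
have := T_walk_down w xT xax erefl us => axd.
by have := rt_T_neq xT; rewrite xax (trA axd dx).
Qed.

(** The condition on the parent of the origin passes along the path: after a descent that parent is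
    the vertex just left, which a path may not revisit. So every step descends. *)
Lemma T_path_down d s e :
    T_walk T d s e -> uniq (visited d s) ->
    (forall p, p \in T -> A p d -> A d p -> A (alpha p) p ->
       vertex (alpha p) \notin visited d s) ->
  forall z, vertex z \in visited d s -> A d z && A z e.
Proof.
elim: s d => [|x s IH] d /=.
  move=> de _ _ z; rewrite inE rt_vertex_eq => /andP[zd ->].
  by rewrite rt_vertex_eq in de; case/andP: de => de _; apply: trA zd de.
case/and3P=> xT; rewrite rt_vertex_eq => /andP[xd dx] w.
case/andP=> dN us pN.
have xax : A x (alpha x).
  have := rt_mono rtA xT; have [//|_] /= := boolP (A x _) => axx.
  by have := pN x xT xd dx axx; rewrite /visited /= !inE eqxx orbT.
have {}IH := IH _ w us.
have {}IH z : vertex z \in visited (alpha x) s -> A (alpha x) z && A z e.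
  apply: IH => p pT pax axp app; have -> : p = alpha x.
    have [_ axT] := rt_edge rtA xT.
    by apply: (rt_uniq rtA) => //; rewrite inva.
  have -> : vertex (alpha (alpha x)) = vertex d.
    by apply/eqP; rewrite inva rt_vertex_eq xd.
  exact: dN.
move=> z; rewrite inE rt_vertex_eq => /orP[/andP[zd dz]|/IH/andP[axz ze]].
  rewrite dz; apply: trA (trA zd (trA dx xax)) _.
  by have /andP[] := IH (alpha x) (mem_head _ _).
by rewrite ze (trA (trA dx xax) axz).
Qed.

Lemma rt_path e : exists2 s, T_path T root s e &
  forall z, (vertex z \in visited root s) = A z e.
Proof.
elim/rt_ind: e => [e er|e p eN pT ep pe app pap pP [s /andP[w us] sE]].
  exists [::]; first by rewrite /T_path /= rt_vertex_eq (rt_root rtA) er.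
  move=> z; rewrite inE rt_vertex_eq (rt_root rtA) andbT.
  by apply/idP/idP => zr; apply: trA zr _; rewrite ?(rt_root rtA).
have [_ apT] := rt_edge rtA pT.
exists (rcons s (alpha p)).
  rewrite /T_path visited_rcons rcons_uniq us andbT inva sE pap andbT -cats1.
  by apply: T_walk_cat w _; rewrite /= inva apT eqxx rt_vertex_eq ep pe.
move=> z; rewrite visited_rcons mem_rcons inE inva rt_vertex_eq sE.
apply/idP/idP => [/orP[/andP[zp _]|zap]|ze].
- exact: trA zp pe.
- exact: trA zap (trA app pe).
case/orP: (pP _ ze) => [ez|->]; last by rewrite orbT.
by rewrite (trA ze ep) (trA pe ez).
Qed.

(** The root-vertex has no parent edge, so [T_path_down] applies to every path that starts there. In
    particular the tree determines [A]. *)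
Lemma ancestorE d e : ancestor T d e <-> A d e.
Proof.
split=> [[s /andP[w us] dv]|de].
  suff /andP[] : A root d && A d e by [].
  apply: (T_path_down w us) => // p pT pr _ app.
  by case/negP: (rt_parent_nonroot pT app).
by have [s ps sE] := rt_path e; exists s; rewrite ?sE.
Qed.

Lemma rt_spanning : spanning_tree T.
Proof.
split; [exact: rt_edge rtA | move=> d e | exact: rt_acyclic].
have [s1 /andP[w1 _] _] := rt_path d; have [s2 /andP[w2 _] _] := rt_path e.
by exists (rev (map alpha s1) ++ s2); apply: T_walk_cat (T_walk_rev (rt_edge rtA) w1) w2.
Qed.

End RootedTree.

(** * From spanning trees to ancestor relations *)

Section SpanningTree.
Variables (M : rmap) (T : {set M}).
Hypotheses (injs : injective (@sigma M)) (inva : involutive (@alpha M)).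
Hypothesis spT : spanning_tree T.
Implicit Types u v x y z p q : M.

Lemma vertexP x y : reflect (vertex x = vertex y) (fconnect sigma x y).
Proof.
apply: (iffP idP) => [xy|xy].
  by apply/setP=> z; rewrite !inE (same_connect (fconnect_sym injs) xy).
have: y \in vertex x by rewrite xy inE connect0.
by rewrite inE.
Qed.

Let eT : edge_set T. Proof. by case: spT. Qed.
Let alphaT x : x \in T -> alpha x \in T. Proof. by case/eT. Qed.

Lemma visited_walk d s e : T_walk T d s e ->
  visited d s = rcons [seq vertex x | x <- s] (vertex e).
Proof.
rewrite /visited; elim: s d => [|x s IH] d /=; first by move/eqP->.
by case/and3P=> _ /eqP -> /IH <-.
Qed.

Lemma mem_visited d s e z : T_walk T d s e -> z \in s ->
  (vertex z \in visited d s) && (vertex (alpha z) \in visited d s).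
Proof.
move=> w zs; rewrite {1}(visited_walk w) mem_rcons inE (map_f _ zs) orbT /=.
by rewrite inE (map_f (fun x => vertex (alpha x)) zs) orbT.
Qed.

Lemma uniq_visited_edges d s e : T_walk T d s e -> uniq (visited d s) ->
  uniq (map (@edge M) s).
Proof.
elim: s d => //= x s IH d /and3P[xT /eqP xd w] /andP[dN us].
rewrite (IH _ w us) andbT; apply: contra dN => /mapP[z zs xz].
have /andP[vz vaz] := mem_visited w zs.
have: z \in edge x by rewrite xz set21.
by case/set2P=> zE; rewrite -xd; [rewrite zE in vz | rewrite zE inva in vaz].
Qed.

(** A walk avoiding the edge could be made simple and closed up by [y] into a cycle of the tree. *)
Lemma T_bridge y s : y \in T -> T_walk T (alpha y) s y -> has (mem (edge y)) s.
Proof.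
move=> yT w; apply: contraT => /hasPn ys.
(* Links between vertices rather than darts, so that [shortenP] yields distinct vertices. *)
pose r := [rel V W : {set M} | [exists x, [&& x \in T, x \notin edge y,
   vertex x == V & vertex (alpha x) == W]]].
have: connect r (vertex (alpha y)) (vertex y).
  elim: s (alpha y) w ys => [|x s IH] d /=; first by move/eqP->; rewrite connect0.
  case/and3P=> xT /eqP xd w ys; apply: connect_trans (IH _ w _).
    apply/connect1/existsP; exists x; rewrite xT xd !eqxx /= andbT.
    exact: ys (mem_head _ _).
  by move=> z zs; apply: ys; rewrite inE zs orbT.
case/connectP=> p /shortenP[q rq uq _] lq.
have [t tq [tw ty]] : exists2 t, [seq vertex (alpha x) | x <- t] = q &
    T_walk T (alpha y) t y /\ {in t, forall x, x \notin edge y}.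
  move: {w p uq} rq lq; elim: q (alpha y) => [|W q IH] d /=.
    by move=> _ yd; exists [::] => //=; rewrite yd eqxx.
  case/andP=> /existsP[x /and4P[xT xy /eqP xd /eqP xW]] rq lq.
  rewrite -xW in rq lq; have [t tq [tw ty]] := IH _ rq lq.
  exists (x :: t); rewrite /= ?tq ?xW ?xT ?xd ?eqxx //; split=> // z.
  by rewrite inE => /predU1P[->|/ty].
have uvt : uniq (visited (alpha y) t) by rewrite /visited tq.
case: spT => _ _ /(_ y (y :: t)) /=; rewrite yT eqxx tw /= => /(_ isT).
move: (uvt); rewrite (visited_walk tw) rcons_uniq => /= -> /(_ isT).
rewrite (uniq_visited_edges tw uvt) andbT => acyc.
have yNt : edge y \notin map (@edge M) t.
  by apply/mapP=> -[x xt yx]; case/negP: (ty _ xt); rewrite yx set21.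
by have := acyc yNt.
Qed.

(** The depth of a vertex is the least length of a tree walk from the root. Parent edges decrease
    it, and iterating [up] from [z] gives the ancestors of [z]. *)
Let wlen x k := `[< exists2 s, T_walk T root s x & size s = k >].

Let ex_wlen x : exists k, wlen x k.
Proof.
case: spT => _ /(_ root x) [s w] _; exists (size s).
by apply/asboolP; exists s.
Qed.

Let depth x := ex_minn (ex_wlen x).

Let eq_depth x y : vertex x = vertex y -> depth x = depth y.
Proof.
move=> xy; rewrite /depth; case: ex_minnP => m xm minm.
case: ex_minnP => k yk mink; apply/eqP; rewrite eqn_leq.
have wE j : wlen x j = wlen y j.
  rewrite /wlen; apply/asboolP/asboolP => -[s w sj]; exists s => //.
    by elim: s (root : M) w {sj} => [|z s IH] d /=; rewrite ?xy // => /and3P[-> -> /IH].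
  by elim: s (root : M) w {sj} => [|z s IH] d /=; rewrite ?xy // => /and3P[-> -> /IH].
by rewrite minm ?wE // mink -?wE.
Qed.

Let isroot x := vertex x == vertex (root : M).

Let par_pred x p := [&& p \in T, vertex p == vertex x & depth (alpha p) < depth x].
(** Off the root-vertex the search succeeds, by [parP]. The result of [pick] depends on the
    predicate alone, which makes the parent edge common to all darts of a vertex. *)
Let par x := odflt x [pick p | par_pred x p].

Let parP x : ~~ isroot x -> par_pred x (par x).
Proof.
move=> xr; rewrite /par; case: pickP => //= /(_ _) noP; exfalso.
rewrite /par_pred /depth in noP; case: (ex_minnP (ex_wlen x)) noP => m /asboolP[s w <-] minm noP.
case/lastP: s w minm noP => [|s z] w minm noP.
  by case/negP: xr; rewrite /isroot eq_sym.
have [zT zx w'] : [/\ z \in T, vertex (alpha z) = vertex x & T_walk T root s z].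
  move: w; elim: s (root : M) {minm noP} => [|u s IH] d /=.
    by case/and3P=> -> /eqP -> /eqP ->; rewrite eqxx.
  by case/and3P=> -> -> /IH [-> -> ->].
have := noP (alpha z); rewrite alphaT // zx eqxx inva /=.
case: ex_minnP => k _ mink; rewrite size_rcons ltnS mink //.
by apply/asboolP; exists s.
Qed.

Let eq_par x y : vertex x = vertex y -> ~~ isroot x -> par x = par y.
Proof.
move=> xy xr; have := parP xr; rewrite /par.
rewrite (eq_pick (Q := par_pred y)) => [|p]; last first.
  by rewrite /par_pred xy (eq_depth xy).
case: pickP => //= noP; have := parP (x := y).
by rewrite /isroot -xy => /(_ xr); rewrite noP.
Qed.

Let up x := if isroot x then x else alpha (par x).

Let depth_up x : ~~ isroot x -> depth (up x) < depth x.
Proof. by move=> xr; have /and3P[_ _] := parP xr; rewrite /up (negPf xr). Qed.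

Let depth_iter k x : vertex (iter k up x) = vertex x \/ depth (iter k up x) < depth x.
Proof.
elim: k => [|k IH] /=; first by left.
have [kr|kr] := boolP (isroot (iter k up x)); first by rewrite /up kr.
right; case: IH => [/eq_depth <-|]; first exact: depth_up.
by apply: ltn_trans; apply: depth_up.
Qed.

Let eq_iter_up k x y : vertex x = vertex y -> vertex (iter k up x) = vertex (iter k up y).
Proof.
elim: k => //= k IH /IH; move: (iter _ _ _) (iter _ _ _) => u v uv.
have -> : up v = if isroot u then v else alpha (par v) by rewrite /up /isroot uv.
by rewrite /up; case: ifPn => // ur; rewrite (eq_par (esym uv) ur).
Qed.

Let anc x z := `[< exists k, vertex (iter k up z) = vertex x >].

Let anc_depth x y : anc x y -> vertex x = vertex y \/ depth x < depth y.
Proof. by move=> /asboolP[k kE]; rewrite -(eq_depth kE) -kE; exact: depth_iter. Qed.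

Let anc_vertex x y : vertex x = vertex y -> anc x y.
Proof. by move=> xy; apply/asboolP; exists 0. Qed.

Let anc_trans : transitive anc.
Proof.
move=> y x z /asboolP[k kE] /asboolP[j jE]; apply/asboolP; exists (k + j).
by rewrite iterD -kE; apply: eq_iter_up.
Qed.

Let anc_par x : ~~ isroot x -> anc (alpha (par x)) x.
Proof. by move=> xr; apply/asboolP; exists 1; rewrite /= /up (negPf xr). Qed.

Let anc_anti x y : anc x y -> anc y x -> vertex x = vertex y.
Proof.
by move=> /anc_depth[//|xy] /anc_depth[//|yx]; have := ltn_trans xy yx; rewrite ltnn.
Qed.

Let par_walk u : exists2 s, T_walk T u s root &
  {in s, forall x, ~~ isroot x && (par x == x)}.
Proof.
move En : (depth u) => n; elim/ltn_ind: n => n IHn in u En *.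
have [ur|ur] := boolP (isroot u); first by exists [::].
have /and3P[pT /eqP pu pd] := parP ur; rewrite En in pd.
have [s w sP] := IHn _ pd _ erefl.
exists (par u :: s); first by rewrite /= pT pu eqxx.
move=> x; rewrite inE => /predU1P[->|/sP//].
by rewrite {1}/isroot pu -/(isroot u) ur -(eq_par (esym pu) ur) /=.
Qed.

(** Both ends reach the root through parent edges. If the edge of [y] were not among them, these two
    walks would join its ends without using it, against [T_bridge]. *)
Let T_par y : y \in T ->
  (~~ isroot y && (par y == y)) || (~~ isroot (alpha y) && (par (alpha y) == alpha y)).
Proof.
move=> yT; apply: contraT; rewrite negb_or => /andP[yN ayN].
have [s1 w1 s1P] := par_walk y; have [s2 w2 s2P] := par_walk (alpha y).
have w1r := T_walk_rev inva eT w1.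
have := T_bridge yT (T_walk_cat w2 w1r); rewrite has_cat has_rev has_map.
have not_edge x : ~~ isroot x && (par x == x) -> x \notin edge y.
  by move=> xP; apply/set2P=> -[xE|xE]; rewrite xE in xP;
     rewrite xP in yN ayN.
case/orP=> /hasP[x] => [/s2P/not_edge/negP //|/s1P/not_edge/negP xy /= axy].
by case: xy; move: axy; rewrite !inE (inv_eq inva) (inj_eq (inv_inj inva)) orbC.
Qed.

Lemma spanning_rooted : exists A : rel M, rooted_tree T A.
Proof.
have mono y : ~~ isroot y && (par y == y) -> ~~ anc y (alpha y) && anc (alpha y) y.
  case/andP=> yr /eqP yp; have := anc_par yr; rewrite yp => ->; rewrite andbT.
  have /and3P[_ _] := parP yr; rewrite yp => lt.
  apply/negP => /anc_depth[/eq_depth eqd|lt2]; first by rewrite eqd ltnn in lt.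
  by have := ltn_trans lt lt2; rewrite ltnn.
exists anc; split=> //.
- move=> x y; apply/vertexP/andP => [xy|[]]; last exact: anc_anti.
  by split; apply: anc_vertex.
- move=> x; move En : (depth x) => n; elim/ltn_ind: n => n IHn in x En *.
  have [/eqP xr|xr] := boolP (isroot x); first exact: anc_vertex.
  apply: anc_trans (anc_par xr); apply: IHn erefl.
  by have := depth_up xr; rewrite /up (negPf xr) En.
- move=> x /T_par/orP[/mono/andP[/negPf-> ->] //|/mono].
  by rewrite inva => /andP[/negPf-> ->].
- move=> x xr; have {}xr : ~~ isroot x.
    by apply: contra xr => /eqP; apply: anc_vertex.
  have /and3P[pT /eqP px _] := parP xr; exists (par x); split=> //.
  + by split; apply: anc_vertex.
  + exact: anc_trans (anc_par xr) (anc_vertex (esym px)).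
  + move=> z /asboolP[[|k] kE]; first by rewrite anc_vertex.
    apply/orP; right; apply/asboolP; exists k; rewrite -kE iterSr.
    by rewrite /up (negPf xr).
- move=> p q pT qT pq qp app aqq.
  have parE z : z \in T -> anc (alpha z) z -> ~~ isroot z /\ par z = z.
    move=> /T_par/orP[/andP[-> /eqP->]//|/mono]; rewrite inva => /andP[/negPf h _].
    by rewrite h.
  have [pr <-] := parE p pT app; have [_ <-] := parE q qT aqq.
  exact: eq_par (anc_anti pq qp) pr.
Qed.

End SpanningTree.

(** * Partially explored maps *)

(** [ex_mono] says that every edge, external or not, joins strictly comparable vertices. [ex_back]
    concerns a child subtree off the branch of the head: some edge [e] goes from it to a strict
    ancestor of its parent, the vertex of [alpha p]. Above the root-vertex there is no such
    ancestor; there [ex_root_tree] bounds the tree edges instead, and the last two clauses locate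
    the dart following the root. *)
Record explored (i : nat) (P : growing) (A : rel P) : Prop := Explored {
  ex_sigma : injective (@sigma P);
  ex_alpha : involutive (@alpha P);
  ex_euler : euler P;
  ex_cubic : near_cubic P (i + 2);
  ex_tree : rooted_tree (gtree P) A;
  ex_mono : forall x, ~~ is_leg x -> A x (alpha x) (+) A (alpha x) x;
  ex_legs : [/\ is_leg (root : P), is_leg (head P) & head P != root];
  ex_face : forall x, is_leg x -> fconnect face_next (head P) x /\ A x (head P);
  ex_back : forall p, p \in gtree P -> A (alpha p) p ->
    ~~ A (alpha p) root -> ~~ A p (head P) ->
    exists e, [/\ ~~ is_leg e, A p e, A (alpha e) (alpha p)
                & ~~ A (alpha p) (alpha e)];
  ex_root_tree : forall x, x \in gtree P -> A x root -> x = sigma root;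
  ex_next : head P = sigma root \/ sigma (root : P) \in gtree P;
  ex_head_root : A (head P) root -> head P = sigma root
}.

Definition tour (P : growing) (s1 s2 : seq P) : Prop :=
  orbit face_next (head P) = head P :: s1 ++ root :: s2.

(* The left legs lie in [s1] and the right ones in [s2]; moving away from the
   root along the tour, one stays in the subtree of every leg already met. *)
Record ordered (P : growing) (A : rel P) (s1 s2 : seq P) : Prop := Ordered {
  or_tour : tour s1 s2;
  or_left : pairwise (fun x y => is_leg y ==> A y x) (head P :: s1);
  or_right : pairwise (fun x y => is_leg x ==> A x y) (rcons s2 (head P));
  or_nonroot : forall x, x \in s2 -> is_leg x -> ~~ A x root;
  or_single : forall x y : P, is_leg x -> is_leg y -> x != head P -> y != head P ->
    A x y -> A y x -> ~~ A x root -> x = y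
}.

Lemma orbit_cycle (T : finType) (f : T -> T) x s :
  fcycle f (x :: s) -> uniq (x :: s) -> orbit f x = x :: s.
Proof.
by move=> fs us; rewrite (orbitE fs us (mem_head _ _)) /= eqxx rot0.
Qed.

(** Only the start is free: [u] need not be the image of [x], provided it has the right successor.
    This is how a tour is rerouted around a changed edge. *)
Lemma fpath_transport (T U : eqType) (f : T -> T) (g : U -> U) (h : T -> U) x u s z :
    fpath f x (rcons s z) -> g u = h (f x) -> {in s, forall y, g (h y) = h (f y)} ->
  fpath g u (rcons (map h s) (h z)).
Proof.
elim: s x u => [|y s IH] x u /=.
  by rewrite !andbT => /eqP-> ->.
move=> /andP[/eqP-> pth] -> gh; rewrite eqxx /=.
by apply: IH pth _ _ => [|w ws]; apply: gh; rewrite inE ?eqxx ?ws ?orbT.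
Qed.

Lemma grow_sigma_head (b : bool) (P : growing) :
  @sigma (grow b P) (new_head P) = if b then new_leg P else back_dart P.
Proof. by []. Qed.

Lemma grow_sigma_leg (b : bool) (P : growing) :
  @sigma (grow b P) (new_leg P) = if b then back_dart P else new_head P.
Proof. by []. Qed.

Lemma grow_sigma_back (b : bool) (P : growing) :
  @sigma (grow b P) (back_dart P) = if b then new_head P else new_leg P.
Proof. by []. Qed.

(** * Effect of the steps a and b *)

Section Grow.
Variables (left : bool) (P : growing).
Hypotheses (injs : injective (@sigma P)) (inva : involutive (@alpha P)).
Hypothesis (leg_head : is_leg (head P)).
Let G := grow left P.
Let old : P -> G := @old_dart P.
Let back : G := back_dart P.
Let nhead : G := new_head P.
Let nleg : G := new_leg P.

Lemma old_inj : injective old. Proof. by move=> x y []. Qed.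

Lemma grow_sigma_inj : injective (@sigma G).
Proof. by move=> [[x|[]]|] [[y|[]]|] //=; case: left => // -[] /injs ->. Qed.

Lemma grow_alphaK : involutive (@alpha G).
Proof.
have aE d : (alpha d == head P) = (d == head P).
  by rewrite (inv_eq inva) (eqP leg_head).
move=> [[x|[]]|] //=; last by rewrite eqxx.
by case: ifP => [/eqP->|xh] //=; rewrite aE xh inva.
Qed.

Lemma grow_leg_old x : is_leg (old x) = is_leg x && (x != head P).
Proof.
rewrite /is_leg /old /=; have [->|_] /= := eqVneq x (head P); first by rewrite andbF.
by rewrite andbT; apply/eqP/eqP => [[]|->].
Qed.

Lemma grow_new_vertex u : fconnect (@sigma G) back u = (u \notin codom old).
Proof.
have cyc : fcycle (@sigma G) [:: back; if left then nhead else nleg; if left then nleg else nhead].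
  by rewrite /back /=; case: left.
rewrite (fconnect_cycle cyc) ?mem_head //.
case: u => [[x|b]|]; rewrite !inE /=.
- rewrite (_ : Some (inl x) = old x) // codom_f /=; by case: left.
- have -> : Some (inr b) \in codom old = false by apply/negP => /codomP[].
  by case: left b => [] [].
by have -> : None \in codom old = false by apply/negP => /codomP[].
Qed.

Lemma grow_vertex_old x : vertex (old x) = old @: vertex x.
Proof. exact: (orbit_set_morph old_inj). Qed.

Lemma grow_degree_old x : degree (old x) = degree x.
Proof. by rewrite /degree grow_vertex_old card_imset //; apply: old_inj. Qed.

Lemma grow_degree_new x : x \notin codom old -> degree x = 3.
Proof.
move=> xN; have bx : fconnect (@sigma G) back x by rewrite grow_new_vertex.
have -> : degree x = #|[:: back; nhead; nleg]|.
  apply: eq_card => y; rewrite inE -(same_connect (fconnect_sym grow_sigma_inj) bx).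
  rewrite grow_new_vertex; case: y => [[y|b]|]; rewrite !inE /=.
  - by rewrite (_ : Some (inl y) = old y) // codom_f.
  - have -> : Some (inr b) \in codom old = false by apply/negP => /codomP[].
    by case: b.
  by have -> : None \in codom old = false by apply/negP => /codomP[].
by apply/card_uniqP.
Qed.

Lemma grow_nonlegs : nonlegs G = nonlegs P + 2.
Proof.
have -> : nonlegs G = #|old @: [set x | ~~ is_leg x] :|: [set old (head P); back]|.
  apply: eq_card => x; rewrite !inE; apply/idP/idP => [|/orP[/imsetP[y yN ->]|]].
  - case: x => [[x|[]]|]; rewrite ?eqxx ?orbT //.
    rewrite (grow_leg_old x) negb_and negbK => /orP[xN|/eqP->].
      by rewrite (_ : Some _ = old x) // imset_f ?inE.
    by rewrite eqxx orbT.
  - by rewrite grow_leg_old; rewrite inE in yN; rewrite (negPf yN).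
  - by case/orP=> /eqP->; rewrite ?grow_leg_old ?eqxx ?andbF.
rewrite cardsU (_ : _ :&: _ = set0).
  rewrite cards0 subn0 (card_imset _ old_inj) cards2 //=.
  by congr (_ + _); apply: eq_card => x; rewrite !inE.
apply/setP=> x; rewrite !inE; apply/negP => /andP[/imsetP[y yN ->]].
rewrite inE in yN; rewrite (inj_eq old_inj) orbF => /eqP yh.
by rewrite yh leg_head in yN.
Qed.

Lemma grow_norb_sigma : norb (@sigma G) = (norb (@sigma P)).+1.
Proof.
by apply: (norb_extend (h := old) (u0 := back) grow_sigma_inj old_inj) => //;
  apply: grow_new_vertex.
Qed.

(* The new vertex is first added with three legs, as a separate component; the
   new edge then merges its face with the head-face. *)
Lemma grow_norb_face : norb (@face_next G) = norb (@face_next P).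
Proof.
pose alpha0 (x : G) : G := if x is Some (inl d) then old (alpha d) else x.
pose f x := sigma (alpha0 x).
have injf : injective f.
  apply: (inj_comp grow_sigma_inj) => -[[x|b]|] [[y|b']|] //= [].
  by move/(inv_inj inva) ->.
have newE u : fconnect f back u = (u \notin codom old).
  rewrite -grow_new_vertex.
  suff fE k : iter k f back = iter k (@sigma G) back.
    apply/idP/idP => /iter_findex <-; first by rewrite fE fconnect_iter.
    by rewrite -fE fconnect_iter.
  elim: k => // k IH; rewrite !iterS IH /f; congr (sigma _).
  have : iter k (@sigma G) back \notin codom old.
    by rewrite -grow_new_vertex fconnect_iter.
  by case: (iter _ _ _) => [[x|b]|] //; rewrite (_ : Some (inl x) = old x) // codom_f.
have fE : norb (T := G) f = (norb (@face_next P)).+1.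
  exact: norb_extend injf old_inj (fun=> erefl) newE.
suff : norb (@face_next G) + 1.*2 = norb (T := G) f + 1 by lia.
have hb : old (head P) != back by [].
have := norb_tperm injf hb; rewrite newE codom_f => <-; congr (_ + _).
apply: eq_norb => x; rewrite /face_next /comp /f; congr (sigma _); rewrite /alpha0.
case: tpermP => [->|->|/eqP xh /eqP xb] /=; first by rewrite eqxx.
  by rewrite (eqP leg_head).
by case: x xh xb => [[x|b]|] //=; rewrite (inj_eq old_inj) => /negPf->.
Qed.

(** One vertex and one edge are added and the number of faces is unchanged. The direction from left
    to right serves to undo the step. *)
Lemma grow_euler : euler G <-> euler P.
Proof.
by rewrite /euler grow_norb_sigma grow_norb_face grow_nonlegs; split; lia.
Qed.

Lemma grow_face_old x : x != head P -> face_next (old x) = old (face_next x).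
Proof. by move=> xh; rewrite /face_next /= (negPf xh). Qed.

Lemma grow_near_cubic k : near_cubic G k <-> near_cubic P k.
Proof.
split=> -[kr k3]; split.
- by rewrite -kr -(grow_degree_old root).
- move=> d dr; rewrite -grow_degree_old; apply: k3.
  rewrite (grow_vertex_old d) (grow_vertex_old root).
  by rewrite (inj_eq (imset_inj old_inj)).
- by rewrite -[RHS]kr -(grow_degree_old root).
- move=> d; have [/codomP[x ->]|dN _] := boolP (d \in codom old); last exact: grow_degree_new.
  rewrite (grow_vertex_old x) (grow_vertex_old root) (inj_eq (imset_inj old_inj)).
  by rewrite grow_degree_old; apply: k3.
Qed.

Lemma fpath_face_old s : fpath face_next (head P) (rcons s (head P)) ->
  uniq (head P :: s) ->
  fpath (@face_next G) back (rcons (map old s) (old (head P))).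
Proof.
move=> pth /andP[hs _]; apply: (fpath_transport (h := old) pth).
  by rewrite /face_next /= (eqP leg_head).
by move=> y ys; rewrite grow_face_old //; apply: contraNneq hs => <-.
Qed.

(** The new leg is met first if it is a left one and last otherwise. The old head, now half of a
    complete edge, ends the old part of the tour: through it one comes back to the new vertex. *)
Definition grow_tour (s : seq P) : seq G :=
  nhead :: if left then [:: nleg, back & rcons (map old s) (old (head P))]
           else back :: rcons (rcons (map old s) (old (head P))) nleg.

Lemma orbit_grow s : orbit face_next (head P) = head P :: s ->
  orbit face_next (head G) = grow_tour s.
Proof.
move=> orbE; have injf : injective (@face_next P) := inj_comp injs (inv_inj inva).
have := cycle_orbit injf (head P); have := orbit_uniq (@face_next P) (head P).
rewrite orbE => us /= cyc; have cyc' := fpath_face_old cyc us.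
have us' : uniq (rcons (map old s) (old (head P))).
  rewrite rcons_uniq (mem_map old_inj) (map_inj_uniq old_inj).
  by rewrite -cons_uniq.
have oldN x : (forall d, x != old d) -> x \notin rcons (map old s) (old (head P)).
  by move=> xN; rewrite mem_rcons inE negb_or xN; apply/mapP=> -[d _ /eqP]; rewrite (negPf (xN d)).
have headE : face_next (old (head P)) = sigma back by rewrite /face_next /= eqxx.
have nextH : face_next nhead = if left then nleg else back by [].
have nextL : face_next nleg = if left then back else nhead by [].
have nextB : face_next (old (head P)) = if left then nhead else nleg by rewrite headE.
have newN : [/\ nhead \notin rcons (map old s) (old (head P)),
  nleg \notin rcons (map old s) (old (head P))
  & back \notin rcons (map old s) (old (head P))] by rewrite !oldN.
have := last_rcons back (map old s) (old (head P)).
rewrite /grow_tour; move: (rcons (map old s) _) cyc' us' newN.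
move=> q cyc' us' [hN lN bN] lastq.
have consE x y p : fpath (@face_next G) x (y :: p) =
  (face_next x == y) && fpath (@face_next G) y p by [].
set tl := (X in _ = _ :: X).
have [leftE|leftE] : left = true \/ left = false by case: (left); auto.
  have -> : tl = [:: nleg, back & q] by rewrite /tl leftE.
  rewrite leftE in nextH nextL nextB; apply: orbit_cycle.
  - suff h : fpath (@face_next G) nhead (rcons [:: nleg, back & q] nhead) by exact: h.
    rewrite !rcons_cons !consE nextH nextL !eqxx rcons_path cyc' lastq.
    exact/eqP.
  - by rewrite /= us' !inE !negb_or hN lN bN.
have -> : tl = back :: rcons q nleg by rewrite /tl leftE.
rewrite leftE in nextH nextL nextB; apply: orbit_cycle.
- suff h : fpath (@face_next G) nhead (rcons (back :: rcons q nleg) nhead) by exact: h.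
  rewrite rcons_cons consE nextH eqxx !rcons_path cyc' lastq last_rcons.
  by apply/and3P; split=> //; apply/eqP.
- by rewrite /= rcons_uniq us' !(inE, mem_rcons) !negb_or hN lN bN.
Qed.

End Grow.

Definition grow_anc (left : bool) (P : growing) (A : rel P) : rel (grow left P) :=
  fun x y => match x, y with
  | Some (inl d), Some (inl e) => A d e
  | Some (inl d), _ => A d (head P)
  | _, Some (inl _) => false
  | _, _ => true
  end.

Section ExploredGrow.
Variables (left : bool) (i : nat) (P : growing) (A : rel P).
Hypothesis exP : explored i A.
Let G := grow left P.
Let old : P -> G := @old_dart P.
Let back : G := back_dart P.
Let nhead : G := new_head P.
Let nleg : G := new_leg P.
Let A' : rel G := grow_anc A.

Let injs := ex_sigma exP.
Let inva := ex_alpha exP.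
Let leg_head : is_leg (head P). Proof. by case: (ex_legs exP). Qed.
Let rtA := ex_tree exP.
Let headNT : head P \notin gtree P.
Proof. by apply/negP => /(rt_edge rtA)[]; rewrite leg_head. Qed.

Lemma grow_tree_old x : (old x \in gtree G) = (x \in gtree P) || (x == head P).
Proof.
by rewrite !inE /= orbF (mem_imset _ _ (@old_inj left P)) (inj_eq (@old_inj left P)).
Qed.

Lemma grow_tree_back : back \in gtree G.
Proof. by rewrite !inE eqxx !orbT. Qed.

Lemma grow_tree_new b : (Some (inr b) : G) \in gtree G = false.
Proof. by rewrite !inE /= !orbF; apply/imsetP => -[]. Qed.

Lemma grow_rooted_tree : rooted_tree (gtree G) A'.
Proof.
have oldN x u : u \notin codom old -> fconnect (@sigma G) (old x) u = false.
  move=> uN; apply/negP => /(fconnect_morphP (h := old) (f := @sigma P)) [|y uE _] //.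
  by rewrite uE codom_f in uN.
have symG := fconnect_sym (@grow_sigma_inj left P injs).
have new_vertex := @grow_new_vertex left P.
have newN b : (Some (inr b) : G) \notin codom old by apply/negP => /codomP[].
have backN : (None : G) \notin codom old by apply/negP => /codomP[].
have newE u v : u \notin codom old -> v \notin codom old -> fconnect (@sigma G) u v.
  rewrite -!new_vertex => bu bv; rewrite symG in bu; exact: connect_trans bu bv.
split.
- move=> [[x|b]|] [[y|b']|]; try exact: newE; try by rewrite /= ?andbF oldN.
  + rewrite /= -(rt_vertex rtA).
    by rewrite -(fconnect_morph (@old_inj left P) (g := @sigma G)).
  + by rewrite symG oldN.
  + by rewrite symG oldN.
- by move=> [[y|b]|] [[x|b']|] [[z|b'']|] //=; apply: (rt_trans rtA).
- by move=> [[x|b]|] /=; rewrite (rt_root rtA).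
- move=> [[x|b]|]; rewrite ?grow_tree_new //; last first.
    by move=> _; split; rewrite // -[alpha _]/(old (head P)) grow_tree_old eqxx orbT.
  rewrite (grow_tree_old x) => /orP[xT|/eqP->]; last first.
    by rewrite /is_leg /= eqxx grow_tree_back.
  have xh : x != head P by apply: contraNneq headNT => <-.
  have [xN axT] := rt_edge rtA xT; rewrite (grow_leg_old _ x) /= (negPf xh) negb_and xN.
  by rewrite (grow_tree_old (alpha x)) axT.
- move=> [[x|b]|]; rewrite ?grow_tree_new //; last first.
    by move=> _ /=; rewrite (rt_refl rtA).
  rewrite (grow_tree_old x) => /orP[xT|/eqP->]; last by rewrite /= eqxx /= (rt_refl rtA).
  have xh : x != head P by apply: contraNneq headNT => <-.
  by rewrite /= (negPf xh); apply: (rt_mono rtA).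
(* The new vertex is a leaf below the head-vertex, and [back] starts its parent edge. *)
- have newP u : u \notin codom old -> exists p, [/\ p \in gtree G, A' u p /\ A' p u,
      A' (alpha p) p & forall z, A' z u -> A' u z || A' z (alpha p)].
    move=> uN; exists back; split; rewrite ?grow_tree_back //=; last first.
    + by move=> [[z|b]|]; case: u uN => [[y|b']|] //=;
        rewrite (_ : Some (inl y) = old y) // codom_f.
    + exact: rt_refl rtA _.
    + by case: u uN => [[y|b']|] //=; rewrite (_ : Some (inl y) = old y) // codom_f.
  move=> [[x|b]|]; try by move=> _; apply: newP.
  rewrite /= => xN; have [p [pT [xp px] app pP]] := rt_parent rtA xN.
  have ph : p != head P by apply: contraNneq headNT => <-.
  exists (old p); rewrite grow_tree_old pT /= (negPf ph); split=> //.
  by move=> [[z|b]|] //=; apply: pP.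
- move=> [[p|b]|] [[q|b']|]; rewrite ?grow_tree_new // (grow_tree_old p) (grow_tree_old q).
  have parT x : (x \in gtree P) || (x == head P) -> A' (alpha (old x)) (old x) ->
      x \in gtree P /\ A (alpha x) x.
    by rewrite /=; have [->|xh] := eqVneq x (head P); rewrite ?orbF.
  move=> pT qT pq qp /(parT _ pT)[{}pT app] /(parT _ qT)[{}qT aqq].
  by congr (Some (inl _)); apply: (rt_uniq rtA).
Qed.

Lemma explored_grow : explored i A'.
Proof.
have [leg_root _ hr] := ex_legs exP; have new_vertex := @grow_new_vertex left P.
split.
- exact: grow_sigma_inj.
- exact: grow_alphaK.
- exact/grow_euler/(ex_euler exP).
- exact/grow_near_cubic/(ex_cubic exP).
- exact: grow_rooted_tree.
- move=> [[x|b]|].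
  + rewrite (grow_leg_old _ x) negb_and negbK /=.
    case: eqVneq => [->|xh] /=; first by rewrite (rt_refl rtA).
    by rewrite orbF; apply: (ex_mono exP).
  + by rewrite /is_leg /= eqxx.
  + by rewrite /= (rt_refl rtA).
- split; rewrite ?/(is_leg (head _)) //.
  by rewrite -[root]/(old root) grow_leg_old leg_root eq_sym.
- move=> x xL; split; last first.
    case: x xL => [[x|b]|] //; rewrite (grow_leg_old _ x) => /andP[xL _].
    by have [] := ex_face exP xL.
  case orbE: (orbit face_next (head P)) => [|h s].
    by have := in_orbit (@face_next P) (head P); rewrite orbE.
  have hE : h = head P by move: orbE; rewrite /orbit -orderSpred => -[].
  rewrite hE in orbE; rewrite fconnect_orbit (orbit_grow left injs inva leg_head orbE) /grow_tour.
  case: x xL => [[x|b]|] //.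
    rewrite (grow_leg_old _ x) => /andP[/(ex_face exP)[]].
    rewrite fconnect_orbit orbE inE => /predU1P[->|xs _ _]; first by rewrite eqxx.
    have : old x \in map old s by apply: map_f.
    by case: left => xs'; rewrite !(inE, mem_rcons) xs' !orbT.
  by case: left; case: b => _; rewrite !(inE, mem_rcons) eqxx ?orbT.
(* The new edge brings no new instance: its upper half is not directed upwards, and its lower half
   lies at the new head. *)
- move=> [[p|b]|]; rewrite ?grow_tree_new // (grow_tree_old p) /=.
  have [->|ph] := eqVneq p (head P); first by [].
  rewrite orbF => pT app apr phN.
  have [e [eN pe eap ape]] := ex_back exP pT app apr phN.
  have eh : e != head P by apply: contraNneq eN => ->.
  exists (old e); rewrite grow_leg_old (negPf eN) /= (negPf eh); split=> //.
(* The only tree dart added at an old vertex is the old head; at the root-vertex it follows the root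
   by [ex_head_root]. *)
- move=> [[p|b]|]; rewrite ?grow_tree_new // (grow_tree_old p) /=.
  by case/orP=> [pT pr|/eqP-> /(ex_head_root exP) {1}->]; rewrite // (ex_root_tree exP pT pr).
- right; rewrite -[sigma _]/(old (sigma root)) grow_tree_old.
  by case: (ex_next exP) => [->|->]; rewrite ?eqxx ?orbT.
- by [].
Qed.

End ExploredGrow.

Section OrderedGrow.
Variables (left : bool) (i : nat) (P : growing) (A : rel P) (s1 s2 : seq P).
Hypotheses (exP : explored i A) (ordP : ordered A s1 s2).
Let G := grow left P.
Let old : P -> G := @old_dart P.
Let back : G := back_dart P.
Let nleg : G := new_leg P.

Definition grow_left : seq G :=
  if left then [:: nleg, back & map old s1] else back :: map old s1.

Definition grow_right : seq G :=
  if left then map old (rcons s2 (head P)) else rcons (map old (rcons s2 (head P))) nleg.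

(** Every old leg is at an ancestor of the head-vertex, hence of the new vertex, so the new darts
    may be put at either end of the tour. *)
Lemma ordered_grow : ordered (grow_anc A : rel G) grow_left grow_right.
Proof.
have leg_head : is_leg (head P) by case: (ex_legs exP).
have old_leg x : is_leg (old x) -> is_leg x && (x != head P) by rewrite grow_leg_old.
have legA x : is_leg (old x) -> A x (head P).
  by case/old_leg/andP=> /(ex_face exP)[].
have sub1 : pairwise (fun x y : G => is_leg y ==> grow_anc A y x) (map old s1).
  rewrite pairwise_map; have /= /andP[_] := or_left ordP; apply: sub_pairwise => x y /=.
  by move=> /implyP h; apply/implyP => /old_leg/andP[/h].
have sub2 : pairwise (fun x y : G => is_leg x ==> grow_anc A x y) (map old (rcons s2 (head P))).
  rewrite pairwise_map; apply: sub_pairwise (or_right ordP) => x y /=.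
  by move=> /implyP h; apply/implyP => /old_leg/andP[/h].
have all1 (u : G) : u \notin codom old ->
    all (fun y : G => is_leg y ==> grow_anc A y u) (map old s1).
  move=> uN; apply/allP => _ /mapP[y _ ->]; apply/implyP => /legA.
  by case: u uN => [[x|b]|] //=; rewrite (_ : Some (inl x) = old x) // codom_f.
have all2 (u : G) : u \notin codom old ->
    all (fun y : G => is_leg y ==> grow_anc A y u) (map old (rcons s2 (head P))).
  move=> uN; apply/allP => _ /mapP[y _ ->]; apply/implyP => /legA.
  by case: u uN => [[x|b]|] //=; rewrite (_ : Some (inl x) = old x) // codom_f.
have newN b : (Some (inr b) : G) \notin codom old by apply/negP => /codomP[].
have backN : (None : G) \notin codom old by apply/negP => /codomP[].
have leftE : left = true \/ left = false by case: (left); auto.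
split.
- rewrite /tour (orbit_grow left (ex_sigma exP) (ex_alpha exP) leg_head (or_tour ordP)).
  rewrite /grow_tour /grow_left /grow_right.
  rewrite map_cat rcons_cat map_rcons /=.
  by case: leftE => ->; rewrite //= rcons_cat.
- have R1 u : u \notin codom old -> all (fun y : G => is_leg y ==> grow_anc A y u)
      [:: nleg, back & map old s1].
    move=> uN; rewrite /= !all1 // andbT.
    by case: u uN => [[x|b]|] //=; rewrite (_ : Some (inl x) = old x) // codom_f.
  have /andP[H1 H2] := R1 _ (newN true); have /andP[_ L] := R1 _ (newN false).
  have /and3P[_ _ B] := R1 _ backN.
  rewrite /grow_left; case: leftE => ->; rewrite !pairwise_cons sub1 andbT.
    by apply/and3P; split=> //; apply/andP.
  by apply/andP.
- rewrite /grow_right; case: leftE => ->.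
    by rewrite pairwise_rcons sub2 andbT; apply: all2 (newN true).
  rewrite !pairwise_rcons sub2 andbT all_rcons; apply/andP; split.
    by apply/andP; split=> //; apply: all2 (newN true).
  exact: all2 (newN false).
- have nonroot x : x \in map old (rcons s2 (head P)) -> is_leg x -> ~~ grow_anc A x (root : G).
    case/mapP=> y; rewrite mem_rcons inE => ys -> /old_leg/andP[yL yh].
    by rewrite (negPf yh) in ys; apply: (or_nonroot ordP).
  rewrite /grow_right; case: leftE => -> x; first exact: nonroot.
  by rewrite mem_rcons inE => /predU1P[->//|/nonroot].
- move=> [[x|[]]|] [[y|[]]|] // xL yL; rewrite ?eqxx //.
  move: xL yL => /old_leg/andP[xL xh] /old_leg/andP[yL yh] _ _ xy yx xr.
  by congr (Some (inl _)); apply: (or_single ordP).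
Qed.

Lemma count_grow_left : count (@is_leg G) grow_left = left + count (@is_leg P) s1.
Proof.
have s1h : head P \notin s1.
  have := orbit_uniq (@face_next P) (head P).
  by rewrite (or_tour ordP) /= mem_cat negb_or => /andP[/andP[]].
have -> : count (@is_leg P) s1 = count (@is_leg G) (map old s1).
  rewrite count_map; apply: eq_in_count => x xs /=; rewrite grow_leg_old.
  by rewrite (_ : x != head P) ?andbT //; apply: contraNneq s1h => <-.
have leftE : left = true \/ left = false by case: (left); auto.
by rewrite /grow_left; case: leftE => ->.
Qed.

Lemma count_grow_right : count (@is_leg G) grow_right = ~~ left + count (@is_leg P) s2.
Proof.
have s2h : head P \notin s2.
  have := orbit_uniq (@face_next P) (head P).
  by rewrite (or_tour ordP) /= mem_cat inE !negb_or => /andP[/and3P[]].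
have -> : count (@is_leg P) s2 = count (@is_leg G) (map old (rcons s2 (head P))).
  rewrite count_map -cats1 count_cat /= grow_leg_old eqxx andbF !addn0.
  apply: eq_in_count => x xs /=; rewrite grow_leg_old.
  by rewrite (_ : x != head P) ?andbT //; apply: contraNneq s2h => <-.
have leftE : left = true \/ left = false by case: (left); auto.
rewrite /grow_right; case: leftE => ->; first by rewrite add0n.
by rewrite -cats1 count_cat /= addnC.
Qed.

End OrderedGrow.

(** * The initial map *)

Section Initial.
Variable i : nat.
Let I : growing := initial_map i.
Let A : rel I := fun _ _ => true.

Lemma iter_ordS n k : k <= n -> iter k (@ordS n.+1) ord0 = k :> nat.
Proof. by elim: k => //= k IH kn; rewrite IH ?modn_small // ltnW. Qed.

Lemma fconnect_ordS n (x y : 'I_n.+1) : fconnect (@ordS n.+1) x y.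
Proof.
have to0 z : fconnect (@ordS n.+1) ord0 z.
  have -> : z = iter z (@ordS n.+1) ord0.
    by apply: val_inj; rewrite /= iter_ordS // -ltnS.
  exact: fconnect_iter.
by apply: connect_trans (to0 y); rewrite fconnect_sym //; apply: ordS_inj.
Qed.

Lemma explored_initial : explored i A.
Proof.
have legI (x : I) : is_leg x by rewrite /is_leg /= eqxx.
have norb1 : norb (@ordS i.+2) = 1.
  apply/eqP/cards1P; exists setT; apply/setP=> B; rewrite inE.
  apply/imsetP/eqP => [[x _ ->]|->]; last exists ord0 => //.
    by apply/setP=> y; rewrite !inE fconnect_ordS.
  by apply/setP=> y; rewrite !inE fconnect_ordS.
have vertexI (x : I) : vertex x = setT.
  by apply/setP=> y; rewrite !inE; apply: fconnect_ordS.
split=> //.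
- exact: ordS_inj.
- have e1 : norb (@sigma I) = 1 := norb1.
  rewrite /euler e1.
  by rewrite /nonlegs eq_card0 // => x; rewrite inE /= legI.
- split; first by rewrite /degree vertexI cardsT card_ord addn2.
  by move=> d; rewrite !vertexI eqxx.
- split=> //; first by move=> x y; apply: fconnect_ordS.
  + by move=> x; rewrite inE.
  + by move=> x; rewrite inE.
  + by move=> p q; rewrite inE.
- by move=> x; rewrite legI.
- by move=> x _; split=> //; apply: fconnect_ordS.
- by move=> x; rewrite inE.
- by left; apply: val_inj; rewrite /= modnn.
- by move=> _; apply: val_inj; rewrite /= modnn.
Qed.

Lemma ordered_initial : exists s1 : seq I,
  ordered A s1 [::] /\ count (@is_leg I) s1 = i.
Proof.
have legI (x : I) : is_leg x by rewrite /is_leg /= eqxx.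
(* These are the darts [1] to [i]; one more iteration reaches the root. *)
exists (traject (@ordS i.+2) (ordS ord0) i); split.
  split=> //.
  - rewrite /tour /orbit.
    have -> : fingraph.order (@face_next I) (head I) = i.+2.
      rewrite /fingraph.order -[RHS]card_ord; apply: eq_card => x.
      by rewrite !inE; apply: fconnect_ordS.
    rewrite -[traject _ _ _]/(ord0 :: traject (@ordS i.+2) (ordS ord0) i.+1) trajectSr.
    congr (_ :: _); rewrite -cats1; congr (_ ++ [:: _]); apply: val_inj => /=.
    by rewrite -iterSr iter_ordS.
  - elim: (_ :: _) => //= x s ->; rewrite andbT; apply/allP => y _.
    by rewrite implybT.
by rewrite (eq_count (a2 := xpredT)) ?count_predT ?size_traject // => x; rewrite legI.
Qed.

End Initial.

(** * Gluing two legs *)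

Section Glue.
Variables (M : rmap) (h s : M).
Hypotheses (injs : injective (@sigma M)) (inva : involutive (@alpha M)).
Hypotheses (leg_h : is_leg h) (leg_s : is_leg s) (hs : h != s).
Let G := glue h s.

Lemma glue_alphaE x : @alpha G x = alpha (tperm h s x).
Proof.
rewrite /= /glue_alpha; case: tpermP => [->|->|/eqP xh /eqP xs].
- by rewrite eqxx (eqP leg_s).
- by rewrite eq_sym (negPf hs) eqxx (eqP leg_h).
by rewrite (negPf xh) (negPf xs).
Qed.

Lemma glue_alpha_other x : x != h -> x != s -> @alpha G x = alpha x.
Proof. by move=> xh xs; rewrite /= /glue_alpha (negPf xh) (negPf xs). Qed.

Lemma glue_alpha_h : @alpha G h = s. Proof. by rewrite /= /glue_alpha eqxx. Qed.

Lemma glue_alpha_s : @alpha G s = h.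
Proof. by rewrite /= /glue_alpha eq_sym (negPf hs) eqxx. Qed.

Lemma glue_leg x : @is_leg G x = [&& @is_leg M x, x != h & x != s].
Proof.
rewrite /is_leg; have [->|xh] := eqVneq x h.
  by rewrite glue_alpha_h eq_sym (negPf hs) andbF.
have [->|xs] := eqVneq x s; first by rewrite glue_alpha_s (negPf hs) andbF.
by rewrite glue_alpha_other // !andbT.
Qed.

Lemma glue_alpha_nonleg x : ~~ @is_leg M x -> @alpha G x = alpha x.
Proof.
by move=> xN; apply: glue_alpha_other; apply: contraNneq xN => ->.
Qed.

Lemma glue_alphaK : involutive (@alpha G).
Proof.
move=> x; have [->|xh] := eqVneq x h; first by rewrite glue_alpha_h glue_alpha_s.
have [->|xs] := eqVneq x s; first by rewrite glue_alpha_s glue_alpha_h.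
rewrite (glue_alpha_other xh xs) glue_alpha_other ?inva //.
  by rewrite (inv_eq inva) (eqP leg_h).
by rewrite (inv_eq inva) (eqP leg_s).
Qed.

Lemma glue_nonlegs : nonlegs G = nonlegs M + 2.
Proof.
rewrite /nonlegs -[X in _ = _ + X](_ : #|pred2 h s| = 2); last by rewrite card2 hs.
rewrite -(cardID (pred2 h s)) addnC; congr (_ + _); apply: eq_card => x.
  rewrite !inE glue_leg; case: eqVneq => [->|_]; first by rewrite leg_h.
  by case: eqVneq => [->|_]; rewrite ?leg_s ?andbT.
rewrite !inE glue_leg.
have [->|xh] := eqVneq x h; first by rewrite andbF.
by have [->|xs] := eqVneq x s; rewrite !andbF.
Qed.

Lemma norb_glue : norb (@face_next G) + (~~ fconnect (@face_next M) h s).*2 =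
  norb (@face_next M) + 1.
Proof.
have injf : injective (@face_next M) := inj_comp injs (inv_inj inva).
rewrite fconnect_sym // -(norb_tperm injf hs); congr (_ + _).
by apply: eq_norb => x; rewrite /face_next /= -glue_alphaE.
Qed.

(** Two legs of the same face: gluing them splits it in two, and this compensates for the new
    edge. *)
Lemma euler_glue : fconnect (@face_next M) h s -> euler G <-> euler M.
Proof.
move=> fhs; have := norb_glue; rewrite fhs addn0 => faceE.
have sE : norb (@sigma G) = norb (@sigma M) by [].
by rewrite /euler glue_nonlegs faceE sE; split; lia.
Qed.

(** At [h] the tour now continues as it did after [s], and conversely. The two arcs between the legs
    thus become two faces. *)
Lemma fcycle_glue s1 s2 : fcycle (@face_next M) (h :: s1 ++ s :: s2) ->
    uniq (h :: s1 ++ s :: s2) ->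
  fcycle (@face_next G) (h :: s2) /\ fcycle (@face_next G) (s :: s1).
Proof.
move=> cyc us.
have {cyc} : fpath (@face_next M) h (rcons s1 s ++ rcons s2 h).
  by rewrite cat_rcons -rcons_cons -rcons_cat.
rewrite cat_path last_rcons => /andP[p1 p2].
have faceE x : x != h -> x != s -> @face_next G x = @face_next M x.
  by move=> xh xs; rewrite /face_next glue_alpha_other.
have notin x : (x \in s1) || (x \in s2) -> x != h /\ x != s.
  move: us; rewrite /= mem_cat inE !negb_or cat_uniq /= negb_or.
  case/and3P=> /and3P[h1 hs' h2] _ /and3P[/andP[s1' _] s2' _] xs.
  by split; apply: contraTneq xs => ->; rewrite negb_or ?h1 ?s1'.
split.
- have := @fpath_transport M M face_next (@face_next G) id s h s2 h p2.
  rewrite map_id; apply; first by rewrite /face_next glue_alpha_h (eqP leg_s).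
  by move=> y ys /=; have [yh ys'] := notin y (introT orP (or_intror ys)); apply: faceE.
- have := @fpath_transport M M face_next (@face_next G) id h s s1 s p1.
  rewrite map_id; apply; first by rewrite /face_next glue_alpha_s (eqP leg_h).
  by move=> y ys /=; have [yh ys'] := notin y (introT orP (or_introl ys)); apply: faceE.
Qed.

(** Legs are not tree darts, so gluing them changes neither the tree nor the ancestors. *)
Lemma glue_rooted_tree (T : {set M}) (A : rel M) :
  rooted_tree T A -> @rooted_tree G T A.
Proof.
move=> rtA; have alphaE x : x \in T -> @alpha G x = alpha x.
  by case/(rt_edge rtA) => xN _; apply: glue_alpha_nonleg.
split.
- exact: rt_vertex rtA.
- exact: rt_trans rtA.
- exact: rt_root rtA.
- move=> x xT; have [xN axT] := rt_edge rtA xT; split; last by rewrite alphaE.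
  by rewrite glue_leg negb_and xN.
- by move=> x xT; rewrite alphaE //; apply: (rt_mono rtA).
- move=> x /(rt_parent rtA)[p [pT xp app pP]]; exists p; split=> //; rewrite alphaE //.
- by move=> p q pT qT pq qp; rewrite !alphaE //; apply: (rt_uniq rtA).
Qed.

End Glue.

Section ExploredGlue.
Variables (i : nat) (P : growing) (A : rel P) (s t : P).
Hypothesis exP : explored i A.
Let h := head P.
Let Q := glue_head s t.
Hypotheses (leg_s : is_leg s) (leg_t : is_leg t) (sh : s != h) (th : t != h).
Hypotheses (sroot : s != root) (troot : t != root).
Hypotheses (st : A s t) (ts : ~~ A t s).
Hypothesis legsQ : forall x, is_leg x -> x != h -> x != s ->
  fconnect (@face_next Q) t x /\ A x t.

Lemma explored_glue : @explored i Q A.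
Proof.
have [leg_root leg_h hroot] := ex_legs exP; have inva := ex_alpha exP.
have rtA := ex_tree exP; have trA := rt_trans rtA.
have hs : h != s by rewrite eq_sym.
have tsE : t != s by apply: contraNneq ts => ->; apply: (rt_refl rtA).
have legQ x : @is_leg Q x = [&& @is_leg P x, x != h & x != s].
  exact: glue_leg.
have [_ sH] := ex_face exP leg_s; have [_ tH] := ex_face exP leg_t.
have tNroot : ~~ A t root.
  by apply: contra ts => tr; apply: trA tr (rt_root rtA _).
have hNroot : ~~ A h root by apply: contra tNroot; apply: trA tH.
split.
- exact: ex_sigma exP.
- exact: glue_alphaK.
- apply/euler_glue => //; last exact: ex_euler exP.
    exact: ex_sigma exP.
  by have [] := ex_face exP leg_s.
- exact: ex_cubic exP.
- exact: glue_rooted_tree.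
- move=> x; rewrite legQ !negb_and !negbK.
  have [-> _|xh] := eqVneq x h.
    rewrite glue_alpha_h sH (_ : A h s = false) //; apply/negP => hs'.
    by case/negP: ts; apply: trA tH hs'.
  have [-> _|xs] := eqVneq x s.
    rewrite glue_alpha_s // sH (_ : A h s = false) //; apply/negP => hs'.
    by case/negP: ts; apply: trA tH hs'.
  by rewrite !orbF => xN; rewrite glue_alpha_nonleg //; apply: (ex_mono exP).
- by rewrite !legQ leg_root leg_t th tsE eq_sym hroot eq_sym sroot.
- by move=> x; rewrite legQ => /and3P[xL xh xs]; apply: legsQ.
- move=> p pT; have [pN _] := rt_edge rtA pT.
  rewrite glue_alpha_nonleg // => app apr; rewrite -[head Q]/t => pt.
  (* If the subtree under [p] contains the old head, the branch has just left it and the new edge is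
     the required one: it goes from [h] to [s], strictly above [t], itself weakly above [alpha p].
     Otherwise the old edge is kept. *)
  have [ph|ph] := boolP (A p h); last first.
    have [e [eN pe eap ape]] := ex_back exP pT app apr ph.
    by exists e; rewrite legQ negb_and eN glue_alpha_nonleg.
  have tp : A t p by have := rt_chain rtA ph tH; rewrite (negPf pt).
  have tap : A t (@alpha P p).
    have := rt_parentE rtA pT app (rt_refl rtA p) (rt_refl rtA p) tp.
    by rewrite (negPf pt).
  exists h; rewrite legQ eqxx andbF glue_alpha_h ph (trA _ _ _ st tap); split=> //.
  by apply: contra ts; apply: trA tap.
- exact: ex_root_tree exP.
- case: (ex_next exP) => [hE|]; last by right.
  by case/negP: hNroot; rewrite /h hE (rt_sigmal rtA) (rt_refl rtA).
- by move=> tr; case/negP: tNroot.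
Qed.

End ExploredGlue.

Lemma split_first (T : Type) (a : pred T) s : has a s ->
  exists u x v, [/\ s = u ++ x :: v, a x & ~~ has a u].
Proof.
elim: s => //= y s IH; have [ay _|ay /= /IH[u [x [v [-> ax uN]]]]] := boolP (a y).
  by exists [::], y, s.
by exists (y :: u), x, v; rewrite /= (negPf ay).
Qed.

Lemma split_last (T : Type) (a : pred T) s : has a s ->
  exists w x z, [/\ s = w ++ x :: z, a x & ~~ has a z].
Proof.
rewrite -has_rev => /split_first[u [x [v [sE ax uN]]]].
exists (rev v), x, (rev u); rewrite has_rev; split=> //.
by rewrite -[s]revK sE rev_cat rev_cons cat_rcons.
Qed.

Lemma pairwise_mid (T : eqType) (r : rel T) a x b :
  pairwise r (a ++ x :: b) -> {in b, forall y, r x y} /\ {in a, forall y, r y x}.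
Proof.
rewrite pairwise_cat pairwise_cons => /and3P[/allrelP rab _ /andP[/allP rx _]].
by split=> [//|y ya]; apply: rab; rewrite ?mem_head.
Qed.

Lemma pairwise_trivial (T : eqType) (r : rel T) b :
  (forall x y, x \in b -> y \in b -> r x y) -> pairwise r b.
Proof.
elim: b => //= x b IH rb; rewrite IH ?andbT; last first.
  by move=> y z yb zb; apply: rb; rewrite inE ?yb ?zb orbT.
by apply/allP => y yb; apply: rb; rewrite inE ?eqxx ?yb ?orbT.
Qed.

(** * Effect of the step c *)

Section StepC.
Variables (i : nat) (P : growing) (A : rel P) (s1 s2 : seq P).
Hypotheses (exP : explored i A) (ordP : ordered A s1 s2).
Let h := head P.

(* The arguments are the leg [s] glued to the head, the new head [t] and the
   two parts of the new tour.  In [StepForward] the head is glued to the first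
   leg and in [StepBackward] to the last one. *)
Inductive c_step : P -> P -> seq P -> seq P -> Prop :=
| StepForward u v w z s t of s1 = u ++ s :: v & s2 = w ++ t :: z
    & ~~ has (@is_leg P) u & ~~ has (@is_leg P) z :
    c_step s t (z ++ h :: v) w
| StepBackward u v w z s t of s1 = u ++ t :: v & s2 = w ++ s :: z
    & ~~ has (@is_leg P) u & ~~ has (@is_leg P) z :
    c_step s t v (w ++ s :: u).

Let uniq_orb : uniq (h :: s1 ++ root :: s2).
Proof. by rewrite -(or_tour ordP) orbit_uniq. Qed.

Let cyc_orb : fcycle face_next (h :: s1 ++ root :: s2).
Proof.
rewrite -(or_tour ordP) cycle_orbit //.
exact: inj_comp (ex_sigma exP) (inv_inj (ex_alpha exP)).
Qed.

Let leg_mem x : is_leg x -> [|| x == h, x \in s1, x == root | x \in s2].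
Proof.
case/(ex_face exP) => + _; rewrite fconnect_orbit (or_tour ordP).
by rewrite inE mem_cat inE.
Qed.

Lemma tour_mem1 x : x \in s1 -> [/\ x != h, x != root & x \notin s2].
Proof.
move: uniq_orb; rewrite /= mem_cat negb_or cat_uniq /= negb_or.
case/andP=> /andP[hs1 _] /and3P[_ /andP[rs1 /hasPn s2N] _] xs.
split; [by apply: contraNneq hs1 => <- | by apply: contraNneq rs1 => <- |].
by apply/negP => /s2N; rewrite /= xs.
Qed.

Lemma tour_mem2 x : x \in s2 -> [/\ x != h, x != root & x \notin s1].
Proof.
move: uniq_orb; rewrite /= mem_cat inE !negb_or cat_uniq /= negb_or.
case/andP=> /and3P[_ _ hs2] /and3P[_ /andP[rs1 /hasPn s2N] /andP[rs2 _]] xs.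
split; [by apply: contraNneq hs2 => <- | by apply: contraNneq rs2 => <- | exact: s2N].
Qed.

Variables (s t : P) (s1' s2' : seq P).
Hypothesis stepP : c_step s t s1' s2'.
Hypotheses (leg_s : is_leg s) (leg_t : is_leg t) (st : A s t) (ts : ~~ A t s).
Let Q := glue_head s t.

Let leg_h : is_leg h. Proof. by case: (ex_legs exP). Qed.

Let leg_root : is_leg (root : P). Proof. by case: (ex_legs exP). Qed.

Let legA x : is_leg x -> A x h. Proof. by case/(ex_face exP). Qed.

Let trA := rt_trans (ex_tree exP).

Let left_of x u v : s1 = u ++ x :: v ->
  (is_leg x -> {in u, forall y, A x y}) /\ {in v, forall y, is_leg y -> A y x}.
Proof.
move=> s1E; have := or_left ordP; rewrite s1E -cat_cons => /pairwise_mid[xv ux].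
split=> [xL y yu|y yv yL]; last exact: (implyP (xv y yv)).
by apply: (implyP (ux y _)); rewrite // inE yu orbT.
Qed.

Let right_of x w z : s2 = w ++ x :: z ->
  (is_leg x -> {in z, forall y, A x y}) /\ {in w, forall y, is_leg y -> A y x}.
Proof.
move=> s2E; have := or_right ordP; rewrite s2E rcons_cat rcons_cons => /pairwise_mid[xz wx].
split=> [xL y yz|y yw yL]; last exact: (implyP (wx y yw)).
by apply: (implyP (xz y _)); rewrite // mem_rcons inE yz orbT.
Qed.

Let step_mem : [/\ s != h, s != root, t != h & t != root].
Proof.
have mid x (a b : seq P) : x \in a ++ x :: b by rewrite mem_cat inE eqxx orbT.
case: stepP => u v w z x y s1E s2E _ _.
  have [-> -> _] := tour_mem1 (x := x) ltac:(by rewrite s1E mid).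
  by have [-> -> _] := tour_mem2 (x := y) ltac:(by rewrite s2E mid).
have [-> -> _] := tour_mem2 (x := x) ltac:(by rewrite s2E mid).
by have [-> -> _] := tour_mem1 (x := y) ltac:(by rewrite s1E mid).
Qed.

Let legQ (x : P) : @is_leg Q x = [&& @is_leg P x, x != h & x != s].
Proof.
have [sh _ _ _] := step_mem; have hs : h != s by rewrite eq_sym.
exact: glue_leg.
Qed.

Let legQ_leg (x : P) : @is_leg Q x -> @is_leg P x. Proof. by rewrite legQ => /and3P[]. Qed.

(** Gluing splits the tour into two faces, and the tour from [t] is a rotation of one of them: that
    of [h] in [StepForward], that of [s] in [StepBackward]. *)
Let step_cycle : fcycle (@face_next Q) (t :: s1' ++ root :: s2') /\
  uniq (t :: s1' ++ root :: s2').
Proof.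
have [sh _ th _] := step_mem; have hs : h != s by rewrite eq_sym.
have inva := ex_alpha exP.
have sub (a b c : seq P) : subseq (a ++ c) (a ++ b ++ c).
  by apply: cat_subseq (subseq_refl _) (suffix_subseq _ _).
rewrite /Q; move: uniq_orb cyc_orb leg_s sh th.
case: stepP => u v w z x y s1E s2E _ _ us cyc leg_x xh yh.
  have {}us : uniq (h :: u ++ x :: v ++ root :: w ++ y :: z).
    by move: us; rewrite s1E s2E -catA.
  have {}cyc : fcycle face_next (h :: u ++ x :: v ++ root :: w ++ y :: z).
    by move: cyc; rewrite s1E s2E -catA.
  have -> : y :: (z ++ h :: v) ++ root :: w =
      rot (size (h :: v ++ root :: w)) ((h :: v ++ root :: w) ++ y :: z).
    by rewrite rot_size_cat /= -catA.
  rewrite rot_cycle rot_uniq.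
  have -> : (h :: v ++ root :: w) ++ y :: z = h :: v ++ root :: w ++ y :: z.
    by rewrite /= -catA.
  split.
    by have [] := fcycle_glue leg_h leg_x _ cyc us; rewrite 1?eq_sym.
  apply: subseq_uniq us.
  rewrite -[h :: u ++ _](_ : [:: h] ++ (rcons u x) ++ v ++ root :: w ++ y :: z = _).
    exact: (sub [:: h] (rcons u x)).
  by rewrite /= cat_rcons.
have {}us : uniq (h :: (u ++ y :: v ++ root :: w) ++ x :: z).
  by move: us; rewrite s1E s2E -!catA /= -catA.
have {}cyc : fcycle face_next (h :: (u ++ y :: v ++ root :: w) ++ x :: z).
  by move: cyc; rewrite s1E s2E -!catA /= -catA.
have -> : y :: v ++ root :: w ++ x :: u = rot (size (x :: u)) (x :: u ++ y :: v ++ root :: w).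
  by rewrite -[x :: u ++ _]/((x :: u) ++ y :: v ++ root :: w) rot_size_cat /= -catA.
rewrite rot_cycle rot_uniq; split.
  by have [] := fcycle_glue leg_h leg_x _ cyc us; rewrite 1?eq_sym.
move: us; rewrite cons_uniq -cat_rcons cat_uniq rcons_uniq => /and3P[_ + _].
by rewrite -cons_uniq.
Qed.

Let noleg x (u : seq P) : ~~ has (@is_leg P) u -> is_leg x -> x \in u = false.
Proof. by move=> /hasPn uN xL; apply: contraTF xL => /uN. Qed.

(** The face that is cut off carries no leg, because [s] was the first or the last one. A leg met
    beyond [s] is above [s], hence above [t]; on the other side it is above [t] by the order of the
    tour. *)
Let step_legs x : is_leg x -> x != h -> x != s ->
  x \in t :: s1' ++ root :: s2' /\ A x t.
Proof.
move=> xL xh; move: leg_s leg_t st; have := leg_mem xL; rewrite (negPf xh) /=.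
case: stepP => u v w z s0 t0 s1E s2E uN zN + sL tL s0t0 xs.
  have [_ vA] := left_of s1E; have [_ wA] := right_of s2E.
  case/or3P => [|/eqP->|].
  - rewrite s1E mem_cat inE (noleg uN xL) (negPf xs) /= => xv; split.
      by rewrite !(inE, mem_cat) xv !orbT.
    exact: trA (vA _ xv xL) s0t0.
  - by rewrite !(inE, mem_cat) eqxx !orbT (rt_root (ex_tree exP)).
  - rewrite s2E mem_cat inE (noleg zN xL) orbF => /orP[xw|/eqP->]; split.
    + by rewrite !(inE, mem_cat) xw !orbT.
    + exact: wA.
    + by rewrite mem_head.
    + exact: rt_refl (ex_tree exP) _.
have [_ vA] := left_of s1E; have [_ wA] := right_of s2E.
case/or3P => [|/eqP->|].
- rewrite s1E mem_cat inE (noleg uN xL) => /predU1P[->|xv]; split.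
  + by rewrite mem_head.
  + exact: rt_refl (ex_tree exP) _.
  + by rewrite !(inE, mem_cat) xv !orbT.
  + exact: vA.
- by rewrite !(inE, mem_cat) eqxx !orbT (rt_root (ex_tree exP)).
- rewrite s2E mem_cat inE (noleg zN xL) orbF (negPf xs) orbF => xw; split.
    by rewrite !(inE, mem_cat) xw !orbT.
  exact: trA (wA _ xw xL) s0t0.
Qed.

Lemma explored_c_step : @explored i Q A.
Proof.
have [sh sr th tr] := step_mem; apply: explored_glue => // x xL xh xs.
have [xo xt] := step_legs xL xh xs; split=> //.
by have [cyc us] := step_cycle; rewrite (fconnect_cycle cyc) ?mem_head.
Qed.

Let sub_left (b : seq P) : pairwise (fun x y => @is_leg P y ==> A y x) b ->
  pairwise (fun x y => @is_leg Q y ==> A y x) b.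
Proof.
by apply: sub_pairwise => x y /implyP yx; apply/implyP => /legQ_leg.
Qed.

Let sub_right (b : seq P) : pairwise (fun x y => @is_leg P x ==> A x y) b ->
  pairwise (fun x y => @is_leg Q x ==> A x y) b.
Proof.
by apply: sub_pairwise => x y /implyP yx; apply/implyP => /legQ_leg.
Qed.

(** In [StepForward] the stretch formed by [z] and [h] passes to the left. It carries no leg, so it
    only has to lie below the legs of [v]. These are above [s], hence above [t], which is above all
    of [z]; and [h] is below every leg. *)
Let ordered_left : pairwise (fun x y => @is_leg Q y ==> A y x) (t :: s1').
Proof.
have orl := or_left ordP; move: leg_s leg_t st sub_left legQ_leg legQ; rewrite /Q.
case: stepP => u v w z s0 t0 s1E s2E uN zN sL tL s0t0 subl legl legE; last first.
  apply: subl; move: orl; rewrite s1E -cat_cons pairwise_cat => /and3P[_ _] //.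
have [_ vA] := left_of s1E; have [zA wA] := right_of s2E.
have hv : pairwise (fun x y => @is_leg P y ==> A y x) (h :: v).
  move: orl; rewrite s1E /= pairwise_cat all_cat /= => /andP[/and3P[_ _ ->]].
  by case/and4P.
rewrite -cat_cons pairwise_cat (subl _ hv) andbT; apply/andP; split.
  apply/allrelP => x y xz yhv; apply/implyP => yL.
  have yv : y \in v.
    by move: yhv; rewrite inE => /predU1P[yh|//]; move: yL; rewrite legE yh eqxx andbF.
  have yt : A y t0 by apply: trA (vA _ yv (legl _ yL)) s0t0.
  by move: xz; rewrite inE => /predU1P[->//|xz]; apply: trA yt (zA tL _ xz).
have zN' y : y \in z -> @is_leg (glue_head s0 t0) y = false.
  by move=> yz; apply/negP => /legl yL; rewrite (noleg zN yL) in yz.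
rewrite pairwise_cons; apply/andP; split; first by apply/allP => y /zN' ->.
by apply: pairwise_trivial => x y _ /zN' ->.
Qed.

Let ordered_right : pairwise (fun x y => @is_leg Q x ==> A x y) (rcons s2' t).
Proof.
have orr := or_right ordP; move: leg_s leg_t st sub_right legQ_leg legQ; rewrite /Q.
case: stepP => u v w z s0 t0 s1E s2E uN zN sL tL s0t0 subr legl legE.
  apply: subr; move: orr; rewrite s2E rcons_cat rcons_cons -cat_rcons pairwise_cat.
  by case/and3P.
have [uA vA] := left_of s1E; have [zA wA] := right_of s2E.
rewrite rcons_cat rcons_cons pairwise_cat; apply/and3P; split.
- apply/allrelP => x y xw yu; apply/implyP => /legl xL.
  have xs : A x s0 := wA _ xw xL; have xt := trA xs s0t0.
  move: yu; rewrite inE mem_rcons inE => /or3P[/eqP->//|/eqP->//|yu].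
  exact: trA xt (uA tL _ yu).
- apply: subr; move: orr; rewrite s2E rcons_cat pairwise_cat.
  by case/and3P.
- have uN' y : y \in s0 :: u -> @is_leg (glue_head s0 t0) y = false.
    rewrite inE => /predU1P[->|yu]; first by rewrite legE eqxx !andbF.
    by apply/negP => /legl yL; rewrite (noleg uN yL) in yu.
  rewrite -rcons_cons pairwise_rcons; apply/andP; split.
    by apply/allP => y /uN' ->.
  by apply: pairwise_trivial => x y /uN' ->.
Qed.

Lemma ordered_c_step : @ordered Q A s1' s2'.
Proof.
have [cyc us] := step_cycle; split; [exact: orbit_cycle| | | |].
- exact: ordered_left.
- exact: ordered_right.
- move=> x + /legQ_leg xL; move: leg_s st legQ_leg; rewrite /Q.
  case: stepP => u v w z s0 t0 s1E s2E uN zN sL s0t0 legl xs.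
    by apply: (or_nonroot ordP); rewrite // s2E mem_cat xs.
  move: xs; rewrite mem_cat inE => /or3P[xw|/eqP->|xu].
  + by apply: (or_nonroot ordP); rewrite // s2E mem_cat xw.
  + by apply: (or_nonroot ordP); rewrite // s2E mem_cat inE eqxx orbT.
  + by rewrite (noleg uN xL) in xu.
- move=> x y; rewrite !legQ => /and3P[xL xh _] /and3P[yL yh _] _ _.
  exact: (or_single ordP).
Qed.

Lemma count_c_step : count (@is_leg P) s1 = (count (@is_leg Q) s1').+1 /\
  count (@is_leg P) s2 = (count (@is_leg Q) s2').+1.
Proof.
have cntQ (b : seq P) : (forall x, x \in b -> x != h /\ x != s) ->
    count (@is_leg Q) b = count (@is_leg P) b.
  by move=> bN; apply: eq_in_count => x /bN[xh xs]; rewrite legQ xh xs !andbT.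
have cnt0 (b : seq P) : ~~ has (@is_leg P) b -> count (@is_leg P) b = 0.
  by rewrite has_count; case: count.
have cntQ0 (b : seq P) : ~~ has (@is_leg P) b -> count (@is_leg Q) b = 0.
  move=> bN; apply/eqP; rewrite -leqn0 -(cnt0 b bN); apply: sub_count.
  exact: legQ_leg.
have Qh : @is_leg Q h = false by rewrite legQ eqxx andbF.
have Qs : @is_leg Q s = false by rewrite legQ eqxx !andbF.
have us1 : uniq s1.
  by move: uniq_orb => /=; rewrite cat_uniq => /and3P[_ ->].
move: leg_s leg_t cntQ cntQ0 Qh Qs; rewrite /Q.
case: stepP => u v w z s0 t0 s1E s2E uN zN sL tL cQ cQ0 Qh Qs;
  rewrite s1E s2E !count_cat /= ?Qh ?Qs (cnt0 _ uN) (cnt0 _ zN) sL tL ?(cQ0 _ zN) ?(cQ0 _ uN).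
  rewrite !cQ => [||x xv]; first by split; rewrite ?addn0 ?addn1.
  - move=> x xw; have [xh _ xs1] := tour_mem2 (x := x) ltac:(by rewrite s2E mem_cat xw).
    by split=> //; apply: contraNneq xs1 => ->; rewrite s1E mem_cat mem_head orbT.
  - have [xh _ _] := tour_mem1 (x := x) ltac:(by rewrite s1E mem_cat inE xv !orbT).
    split=> //; apply: contraTneq us1 => xs; rewrite s1E cat_uniq /= -xs xv.
    by rewrite !andbF.
rewrite !cQ => [||x xv]; first by split; rewrite ?addn0 ?addn1.
- move=> x xw; have [xh _ _] := tour_mem2 (x := x) ltac:(by rewrite s2E mem_cat xw).
  split=> //; move: uniq_orb; rewrite /= cat_uniq s2E /= cat_uniq => /and5P[_ _ _ _].
  by case/and3P=> _ + _; apply: contraNneq => <-; rewrite /= xw.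
- have [xh _ xs2] := tour_mem1 (x := x) ltac:(by rewrite s1E mem_cat inE xv !orbT).
  by split=> //; apply: contraNneq xs2 => ->; rewrite s2E mem_cat mem_head orbT.
Qed.

End StepC.

(** Both legs are at ancestors of the head-vertex, so they are comparable: non-empty stacks are all
    that [phi_c] requires. *)
Lemma phi_c_step (i : nat) (P : growing) (A : rel P) (s1 s2 : seq P) :
    explored i A -> ordered A s1 s2 -> has (@is_leg P) s1 -> has (@is_leg P) s2 ->
  exists s t s1' s2', [/\ phi_c P = Some (glue_head s t),
    c_step s1 s2 s t s1' s2', is_leg s, is_leg t & A s t && ~~ A t s].
Proof.
move=> exP ordP /split_first[u [f [v [s1E fL uN]]]] /split_last[w [l [z [s2E lL zN]]]].
have inva := ex_alpha exP; have rtA := ex_tree exP.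
have noleg b : ~~ has (@is_leg P) b -> filter (@is_leg P) b = [::].
  by rewrite has_filter negbK => /eqP.
have legsE : exists ls, tour_legs P = f :: rcons ls l.
  exists (filter (@is_leg P) (v ++ root :: w)).
  rewrite /tour_legs (or_tour ordP) /= s1E s2E !filter_cat /= !filter_cat /= lL fL.
  have [-> _ _] := ex_legs exP.
  by rewrite (noleg _ uN) (noleg _ zN) /= -cats1 -catA.
have [ls lsE] := legsE; rewrite /phi_c lsE last_rcons.
have [fh _ fs2] := tour_mem1 ordP (x := f) ltac:(by rewrite s1E mem_cat mem_head orbT).
have [lh _ ls1] := tour_mem2 ordP (x := l) ltac:(by rewrite s2E mem_cat mem_head orbT).
have ls2 : l \in s2 by rewrite s2E mem_cat mem_head orbT.
have ancE x y : `[< ancestor (gtree P) x y >] = A x y.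
  by apply/asboolP/idP => /(ancestorE inva rtA).
(* [or_single] applies because [l], a right leg, is not at the root-vertex; [l = f] would then lie
   in both parts of the tour. *)
have neq : ~~ (A l f && A f l).
  apply/negP => /andP[lf fl]; have lf_eq : l = f.
    by apply: (or_single ordP) => //; apply: (or_nonroot ordP).
  by rewrite lf_eq (negPf fs2) in ls2.
rewrite (rt_vertex_eq rtA) andbC (negPf neq) !ancE.
have [_ fH] := ex_face exP fL; have [_ lH] := ex_face exP lL.
have [fl|fl] := boolP (A f l).
  exists f, l, (z ++ head P :: v), w; split=> //; first exact: (StepForward s1E s2E).
  by move: neq; rewrite fl andbT.
have lf : A l f by have := rt_chain rtA fH lH; rewrite (negPf fl).
rewrite lf; exists l, f, v, (w ++ l :: u); split=> //.
  exact: (StepBackward s1E s2E).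
by rewrite lf.
Qed.

(** * Non-separability *)

(** A partition of the edges into two parts meeting only at the vertex of [c] is a two-colouring of
    the darts, constant on every edge and on every other vertex. *)
Lemma nonseparable_colour (M : rmap) :
    injective (@sigma M) -> involutive (@alpha M) -> (forall x : M, ~~ is_leg x) ->
    (forall (col : pred M) (c : M), (forall x, col (alpha x) = col x) ->
       (forall x y, fconnect sigma x y -> ~~ fconnect sigma x c -> col x = col y) ->
       forall x, col x = col root) ->
  nonseparable M.
Proof.
move=> injs inva noleg const B1 B2 eB1 eB2 /set0Pn[x1 x1B] /set0Pn[x2 x2B] dis cov.
apply/negP => /cards1P[V VE].
have B2E x : (x \in B2) = (x \notin B1).
  have /setP/(_ x) := cov; rewrite !inE noleg; case xB1: (x \in B1) => //= _.
  exact: disjointFr dis xB1.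
have [c cE] : exists c, V = vertex c.
  have : V \in [set V] by rewrite inE.
  by rewrite -VE inE => /andP[/imsetP[c _ ->] _]; exists c.
have cst := const (mem B1) c.
have col_a x : (alpha x \in B1) = (x \in B1).
  by apply/idP/idP => [/eB1[_]|/eB1[_ //]]; rewrite inva.
have mono x y : fconnect sigma x y -> ~~ fconnect sigma x c -> (x \in B1) = (y \in B1).
  move=> xy; apply: contraNeq => neq; apply/(vertexP injs); rewrite -cE.
  apply/set1P; rewrite -VE inE imset_f //=.
  have yx : y \in vertex x by rewrite inE.
  have xx : x \in vertex x by rewrite inE connect0.
  case xB: (x \in B1) neq => /=; case yB: (y \in B1) => //= _; apply/andP; split.
  - by apply/set0Pn; exists x; rewrite inE xx xB.
  - by apply/set0Pn; exists y; rewrite inE yx B2E yB.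
  - by apply/set0Pn; exists y; rewrite inE yx yB.
  - by apply/set0Pn; exists x; rewrite inE xx B2E xB.
have colE := const (mem B1) c col_a mono.
have := x2B; rewrite B2E => /negP; apply.
by have := colE x2; have := colE x1; rewrite !inE /= x1B => <- ->.
Qed.

(** Away from [c] the colour propagates along the tree. A cut at [c] would isolate a child subtree
    of [c], but the edge [e] of the hypotheses joins it to a strict ancestor of [c]; and the
    root-vertex has at most one child subtree. *)
Lemma rooted_nonseparable (M : rmap) (T : {set M}) (A : rel M) :
    injective (@sigma M) -> involutive (@alpha M) -> (forall x : M, ~~ is_leg x) ->
    rooted_tree T A -> (forall x : M, A x (alpha x) (+) A (alpha x) x) ->
    (forall p, p \in T -> A (alpha p) p -> ~~ A (alpha p) root ->
       exists e, [/\ A p e, A (alpha e) (alpha p) & ~~ A (alpha p) (alpha e)]) ->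
    (forall x, x \in T -> A x root -> x = sigma root) ->
  nonseparable M.
Proof.
move=> injs inva noleg rtA mono back root_tree; have trA := rt_trans rtA.
apply: nonseparable_colour => // col c col_a col_v.
have col_A x y : A x y -> A y x -> ~~ (A x c && A c x) -> col x = col y.
  by move=> xy yx xc; apply: col_v; rewrite (rt_vertex rtA) ?xy.
have neq x : ~~ (A x (alpha x) && A (alpha x) x) by have := mono x; case: (A x _) => //= /negPf->.
have rr : A root root := rt_root rtA root.
(* With [c] at the root-vertex, all other vertices hang from the edge of [sigma root] and take its
   colour; every dart at the root-vertex shares it too, as no edge is a loop. *)
have [cr|cr] := boolP (A c root).
  have nonroot : forall x, ~~ A x root -> col x = col (sigma root).
    elim/(rt_ind rtA) => [x xr|x p xN pT xp px app pap pP IH _]; first by rewrite xr.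
    rewrite (col_A x p) //; last first.
      by rewrite negb_and; apply/orP; left; apply: contra xN => /trA; apply.
    rewrite -col_a; have [apr|] := boolP (A (alpha p) root); last exact: IH.
    have [_ apT] := rt_edge rtA pT.
    by rewrite (root_tree _ apT apr).
  have all_col : forall x, col x = col (sigma root).
    move=> x; have [xr|] := boolP (A x root); last exact: nonroot.
    rewrite -col_a nonroot //; apply: contra (neq x) => axr.
    by rewrite (trA _ _ _ xr (rt_root rtA _)) (trA _ _ _ axr (rt_root rtA _)).
  by move=> x; rewrite !all_col.
have above : forall x, ~~ A c x -> col x = col root.
  elim/(rt_ind rtA) => [x xr|x p xN pT xp px app pap pP IH] cx.
    by apply: col_A; rewrite ?(rt_root rtA) // (negPf cx) andbF.
  rewrite (col_A x p) // ?(negPf cx) ?andbF // -col_a; apply: IH.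
  by apply: contra cx => cap; apply: trA (trA _ _ _ cap app) px.
have subtree p : ~~ A p c -> forall z, A p z -> col z = col p.
  move=> pc; elim/(rt_ind rtA) => [z zr|z q zN qT zq qz aqq qaq qP IH] pz.
    by case/negP: pc; apply: trA (trA _ _ _ pz zr) (rt_root rtA c).
  have zc : ~~ A z c by apply: contra pc; apply: trA.
  case/orP: (qP _ pz) => [zp|paq]; first by apply: col_A; rewrite ?(negPf zc).
  by rewrite (col_A z q) ?(negPf zc) // -col_a IH.
(* At a child of [c] the induction gives way to the edge [e], which leads from the child subtree to
   a vertex not below [c]. *)
have below : forall x, A c x -> ~~ A x c -> col x = col root.
  elim/(rt_ind rtA) => [x xr|x p xN pT xp px app pap pP IH] cx xc.
    by case/negP: cr; apply: trA xr.
  have cap : A c (alpha p) by have := pP _ cx; rewrite (negPf xc).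
  have [apc|apc] := boolP (A (alpha p) c); last first.
    by rewrite (col_A x p) ?(negPf xc) // -col_a IH.
  have apr : ~~ A (alpha p) root by apply: contra cr; apply: trA cap.
  have [e [pe eap ape]] := back p pT app apr.
  rewrite (col_A x p) ?(negPf xc) //.
  have pc : ~~ A p c by apply: contra xc; apply: trA xp.
  rewrite -(subtree p pc e pe) -col_a above //.
  by apply: contra ape; apply: trA apc.
have notc x : ~~ (A x c && A c x) -> col x = col root.
  by rewrite negb_and; have [cx|cx _] := boolP (A c x); [rewrite orbF => /below -> | apply: above].
(* The darts at [c] have the colour of their other ends, which lie elsewhere since no edge is a
   loop. *)
move=> x; have [/andP[xc cx]|] := boolP (A x c && A c x); last exact: notc.
rewrite -col_a notc //; apply: contra (neq x) => /andP[axc cax].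
by rewrite (trA _ _ _ xc cax) (trA _ _ _ axc cx).
Qed.

Lemma rt_connected (M : rmap) (T : {set M}) (A : rel M) :
  injective (@sigma M) -> involutive (@alpha M) -> rooted_tree T A -> connected_map M.
Proof.
move=> injs inva rtA.
have sym : connect_sym (link (@sigma M) (@alpha M)) := link_sym injs (inv_inj inva).
have vert x y : A x y -> A y x -> connect (link (@sigma M) (@alpha M)) x y.
  move=> xy yx; have : fconnect sigma x y by rewrite (rt_vertex rtA) xy.
  by apply: connect_sub => u v /eqP <-; apply: connect1 (link_s _ _ _).
have toroot x : connect (link (@sigma M) (@alpha M)) x root.
  elim/(rt_ind rtA): x => [x xr|x p xN pT xp px app _ _ IH].
    by apply: vert xr (rt_root rtA x).
  apply: connect_trans (vert _ _ xp px) _.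
  exact: connect_trans (connect1 (link_a _ _ _)) IH.
by move=> d e; apply: connect_trans (toroot d) _; rewrite sym.
Qed.

Lemma connected_n_comp (M : rmap) : injective (@sigma M) -> involutive (@alpha M) ->
  connected_map M -> n_comp (@joined M) M = 1.
Proof.
move=> injs inva conn; have sym := link_sym injs (inv_inj inva).
rewrite -(n_comp_connect sym (root : M)); apply: eq_n_comp_r => x.
by apply/esym; apply: conn.
Qed.

(** * From walks to maps *)

(** The last letter acts first, so the condition bears on suffixes: the stack heights,
    [|.|_a + i - |.|_c] on the left and [|.|_b - |.|_c] on the right, are never negative. Given the
    totals, it amounts to the condition on prefixes. *)
Fixpoint walk_ok (i : nat) (w : seq letter) : bool :=
  if w is _ :: w' then
    [&& walk_ok i w', count is_c w <= count is_a w + i & count is_c w <= count is_b w]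
  else true.

Lemma walk_okP i w : kreweras i w -> walk_ok i w.
Proof.
case=> pre aE bE.
suff H w1 w2 : w = w1 ++ w2 -> walk_ok i w2 by apply: (H [::]).
elim: w2 w1 => // x w2 IH w1 wE; rewrite /walk_ok -/walk_ok.
rewrite (IH (rcons w1 x)) ?cat_rcons //=.
have [/(_ w1 (x :: w2) wE)] := (pre, tt); move: aE bE; rewrite wE !count_cat /=.
by move=> aE bE [a1 b1] _; apply/andP; split; lia.
Qed.

Lemma kreweras_ok i w : walk_ok i w ->
  count is_a w + i = count is_c w -> count is_b w = count is_c w -> kreweras i w.
Proof.
move=> ok aE bE; split=> // w1 w2 wE.
have : count is_c w2 <= count is_a w2 + i /\ count is_c w2 <= count is_b w2.
  move: ok; rewrite wE; elim: w1 {wE} => [|x w1 IH] /=; last by case/and3P=> /IH.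
  by case: w2 => //= x w2 /and3P[_ -> ->].
by move: aE bE; rewrite wE !count_cat => aE bE [h1 h2]; split; lia.
Qed.

Section Reach.
Variable i : nat.

Record reach (w : seq letter) (P : growing) (A : rel P) (s1 s2 : seq P) : Prop := Reach {
  rc_word : phi_word w (initial_map i) = Some P;
  rc_explored : explored i A;
  rc_ordered : ordered A s1 s2;
  rc_left : count (@is_leg P) s1 + count is_c w = count is_a w + i;
  rc_right : count (@is_leg P) s2 + count is_c w = count is_b w;
  rc_edges : nonlegs P = (size w).*2
}.

Lemma reach_nil : exists (s1 : seq (initial_map i)), reach [::] (fun _ _ => true) s1 [::].
Proof.
have [s1 [or1 c1]] := ordered_initial i; exists s1; split=> //.
- exact: explored_initial.
- by rewrite c1 addn0.
- by rewrite /nonlegs eq_card0 // => x; rewrite !inE /is_leg /= eqxx.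
Qed.

Lemma reach_grow (b : bool) w (P : growing) (A : rel P) (s1 s2 : seq P) : reach w A s1 s2 ->
  reach ((if b then La else Lb) :: w) (grow_anc A : rel (grow b P))
    (grow_left b s1) (grow_right b s2).
Proof.
case=> wE exP ordP c1 c2 eE; split.
- by rewrite /= -/(phi_word w _) wE; case: b.
- exact: explored_grow.
- exact: ordered_grow exP ordP.
- by rewrite (count_grow_left b ordP); case: b => /=; lia.
- by rewrite (count_grow_right b ordP); case: b => /=; lia.
- rewrite grow_nonlegs ?eE /= ?doubleS ?addn2 //.
  by case: (ex_legs exP).
Qed.

Lemma reach_c w (P : growing) (A : rel P) (s1 s2 : seq P) s t s1' s2' :
    reach w A s1 s2 -> phi_c P = Some (glue_head s t) -> c_step s1 s2 s t s1' s2' ->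
    is_leg s -> is_leg t -> A s t && ~~ A t s ->
  @reach (Lc :: w) (glue_head s t) A s1' s2'.
Proof.
case=> wE exP ordP c1 c2 eE phiE stepP sL tL /andP[st ts].
have [c1' c2'] := count_c_step ordP stepP sL tL.
split.
- by rewrite /= -/(phi_word w _) wE.
- exact: (explored_c_step exP ordP stepP sL tL st ts).
- exact: (ordered_c_step exP ordP stepP sL tL st).
- by move: c1 c1' => /=; lia.
- by move: c2 c2' => /=; lia.
- rewrite /= doubleS -eE -[nonlegs _]/(nonlegs (glue (head P) s)) glue_nonlegs ?addn2 //.
    by case: (ex_legs exP).
  by apply: contraNneq ts => <-; have [] := ex_face exP tL.
Qed.

Lemma phi_word_reach w : walk_ok i w ->
  exists (P : growing) (A : rel P) (s1 s2 : seq P), reach w A s1 s2.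
Proof.
elim: w => [_|x w IH].
  by have [s1 r] := reach_nil; exists (initial_map i), (fun _ _ => true), s1, [::].
rewrite /walk_ok -/walk_ok => /and3P[/IH[P [A [s1 [s2 r]]]] ca cb].
case: x ca cb => /= ca cb.
- by exists (grow true P), (grow_anc A), (grow_left true s1), (grow_right true s2);
    apply: (reach_grow true r).
- by exists (grow false P), (grow_anc A), (grow_left false s1), (grow_right false s2);
    apply: (reach_grow false r).
have l1 : has (@is_leg P) s1 by rewrite has_count; have := rc_left r; lia.
have l2 : has (@is_leg P) s2 by rewrite has_count; have := rc_right r; lia.
have [s [t [s1' [s2' [phiE stepP sL tL stA]]]]] := phi_c_step (rc_explored r) (rc_ordered r) l1 l2.
exists (glue_head s t), A, s1', s2'; exact: reach_c r phiE stepP sL tL stA.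
Qed.

End Reach.

(** * Closing the map *)

Section Close.
Variables (i : nat) (w : seq letter) (P : growing) (A : rel P) (s1 s2 : seq P).
Hypothesis rP : reach i w A s1 s2.
Hypotheses (aE : count is_a w + i = count is_c w) (bE : count is_b w = count is_c w).

Definition close_map (P : growing) : marked_map :=
  @MarkedMap (glue (head P) root) [set head P; root] (gtree P).

Let exP := rc_explored rP.
Let ordP := rc_ordered rP.
Let rtA := ex_tree exP.
Let inva := ex_alpha exP.
Let leg_root : is_leg (root : P). Proof. by case: (ex_legs exP). Qed.
Let leg_head : is_leg (head P). Proof. by case: (ex_legs exP). Qed.
Let hr : head P != root. Proof. by case: (ex_legs exP). Qed.
Let trA := rt_trans rtA.

(** Both stacks are empty when the totals of the word balance. *)
Lemma close_legs x : @is_leg P x -> (x == head P) || (x == root).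
Proof.
have c1 : count (@is_leg P) s1 = 0 by have := rc_left rP; lia.
have c2 : count (@is_leg P) s2 = 0 by have := rc_right rP; lia.
move=> xL; have [+ _] := ex_face exP xL.
rewrite fconnect_orbit (or_tour ordP) inE mem_cat inE.
case/or4P => [->//|xs|->|xs]; rewrite ?orbT //.
  have: has (@is_leg P) s1 by apply/hasP; exists x.
  by rewrite has_count c1.
have: has (@is_leg P) s2 by apply/hasP; exists x.
by rewrite has_count c2.
Qed.

Lemma closeE : close P = Some (close_map P).
Proof.
rewrite /close (eq_enum (B := pred1 (root : P))) ?enum1 // => x.
rewrite !inE; apply/andP/eqP => [[/close_legs/orP[]/eqP-> // /eqP//]|->].
by rewrite eq_sym.
Qed.

Let M : marked_map := close_map P.

Let noleg (x : M) : ~~ is_leg x.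
Proof.
rewrite (glue_leg hr); apply/negP => /and3P[/close_legs].
by case/orP => /eqP->; rewrite eqxx.
Qed.

Let rtM : @rooted_tree M (gtree P) A. Proof. exact: glue_rooted_tree. Qed.

Let legs_cmp (x : M) : A x (alpha x) || A (alpha x) x.
Proof.
have [->|xh] := eqVneq x (head P).
  by rewrite glue_alpha_h (rt_root rtA) orbT.
have [->|xr] := eqVneq x root.
  by rewrite (glue_alpha_s hr) (rt_root rtA).
have xN : ~~ @is_leg P x.
  by apply/negP => /close_legs; rewrite (negPf xh) (negPf xr).
rewrite (glue_alpha_nonleg leg_head leg_root xN).
by have := ex_mono exP xN; case: (A x _).
Qed.

Let nonsep : nonseparable M.
Proof.
have injs : injective (@sigma M) := ex_sigma exP.
have invM : involutive (@alpha M) by apply: glue_alphaK.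
(* When the head is at the root-vertex the closed map is a single loop; otherwise
   [rooted_nonseparable] applies. *)
have [hroot|hroot] := boolP (A (head P) root); last first.
  apply: (rooted_nonseparable injs invM noleg rtM) => [x|p pT|]; last exact: ex_root_tree exP.
    have [->|xh] := eqVneq x (head P).
      by rewrite glue_alpha_h (rt_root rtA) (negPf hroot).
    have [->|xr] := eqVneq x root.
      by rewrite (glue_alpha_s hr) (rt_root rtA) (negPf hroot).
    have xN : ~~ @is_leg P x.
      by apply/negP => /close_legs; rewrite (negPf xh) (negPf xr).
    by rewrite (glue_alpha_nonleg leg_head leg_root xN); apply: (ex_mono exP).
  have [pN _] := rt_edge rtA pT; rewrite (glue_alpha_nonleg leg_head leg_root pN) => app apr.
  (* The branch of the head is attached to the root-vertex by the marked edge itself. *)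
  have [ph|ph] := boolP (A p (head P)).
    by exists (head P); rewrite glue_alpha_h; split; rewrite ?(rt_root rtA).
  have [e [eN pe eap ape]] := ex_back exP pT app apr ph.
  by exists e; rewrite (glue_alpha_nonleg leg_head leg_root eN).
have hT : head P \notin gtree P.
  by apply/negP => /(rt_edge rtA)[]; rewrite leg_head.
have allroot : forall x, A x root.
  elim/(rt_ind rtA) => // x p xN pT xp px app pap pP IH.
  have [_ apT] := rt_edge rtA pT.
  by case/negP: hT; rewrite (ex_head_root exP hroot) -(ex_root_tree exP apT IH).
have all2 (x : P) : (x == head P) || (x == root).
  apply: close_legs; apply: contraT => xN; have := ex_mono exP xN.
  by rewrite !(trA (allroot _) (rt_root rtA _)).
apply: (nonseparable_colour injs invM noleg) => col c col_a _ x.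
case/orP: (all2 x) => /eqP-> //.
by rewrite -(col_a (root : M)) glue_alpha_s.
Qed.

Lemma close_target n : size w = 3 * n + 2 * i -> near_cubic_depth_map i n M.
Proof.
move=> wn; have injs : injective (@sigma M) := ex_sigma exP.
have invM : involutive (@alpha M) by apply: glue_alphaK.
have nonE : nonlegs M = (size w).*2 + 2.
  by rewrite -(rc_edges rP); apply: glue_nonlegs.
split=> //.
- split=> //.
  + exact: rt_connected injs invM rtM.
  + apply/(eulerP invM); have [fhr _] := ex_face exP leg_root.
    by apply/(euler_glue (ex_sigma exP) inva leg_head leg_root hr fhr)/(ex_euler exP).
- split; first exact: ex_cubic exP.
  rewrite /near_cubic_size; move: (card_edges invM); rewrite nonE wn.
  by rewrite -muln2; lia.
- by rewrite /M /= /edge -[alpha _]/(@alpha M (root : P)) glue_alpha_s // setUC.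
split; last first.
  (* If the head followed the root, the next edge would be the root-edge, which [neq] excludes. *)
  rewrite /contains_next_edge => neq; case: (ex_next exP) => // hE.
  case/eqP: neq; rewrite /edge -[sigma _]/(@sigma P root) -hE.
  by rewrite glue_alpha_h -[root]/(@root P) (glue_alpha_s hr) setUC.
split; first exact: rt_spanning invM rtM.
  move=> d _ _; rewrite /comparable_vertices.
  by case/orP: (legs_cmp d) => /(ancestorE invM rtM) h; [left | right].
by apply/negP => /(rt_edge rtA)[]; rewrite leg_root.
Qed.

End Close.

(** * Injectivity *)

Record giso (P Q : growing) (f : P -> Q) : Prop := GIso {
  gi_bij : bijective f;
  gi_sigma : forall x, f (sigma x) = sigma (f x);
  gi_alpha : forall x, f (alpha x) = alpha (f x);
  gi_root : f root = root;
  gi_head : f (head P) = head Q;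
  gi_tree : forall x, (f x \in gtree Q) = (x \in gtree P)
}.

Lemma orbit_morph (T U : finType) (f : T -> T) (g : U -> U) (h : T -> U) :
  injective h -> (forall x, h (f x) = g (h x)) ->
  forall x, orbit g (h x) = map h (orbit f x).
Proof.
move=> injh hfg x.
have -> : orbit g (h x) = traject g (h x) (fingraph.order f x).
  rewrite /orbit; congr traject.
  have /(congr1 (fun B : {set U} => #|B|)) := orbit_set_morph injh hfg x.
  by rewrite (card_imset _ injh) !cardsE.
rewrite /orbit; move: (fingraph.order f x) => n; elim: n x => //= n IH x.
by rewrite -hfg IH.
Qed.

Section GIso.
Variables (P Q : growing) (f : P -> Q).
Hypothesis isof : giso f.

Lemma gi_inj : injective f. Proof. exact: bij_inj (gi_bij isof). Qed.

Lemma gi_face x : f (face_next x) = face_next (f x).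
Proof. by rewrite /face_next (gi_sigma isof) (gi_alpha isof). Qed.

Lemma gi_leg x : is_leg (f x) = is_leg x.
Proof. by rewrite /is_leg -(gi_alpha isof) (inj_eq gi_inj). Qed.

Lemma gi_orbit x : orbit face_next (f x) = map f (orbit face_next x).
Proof. exact: orbit_morph gi_inj gi_face x. Qed.

Lemma gi_pullback (B : rel Q) : rooted_tree (gtree Q) B ->
  rooted_tree (gtree P) (fun x y => B (f x) (f y)).
Proof.
move=> rtB; have [g fg gf] := gi_bij isof; split.
- by move=> x y; rewrite -(rt_vertex rtB) (fconnect_morph gi_inj (gi_sigma isof)).
- by move=> y x z; apply: (rt_trans rtB).
- by move=> x; rewrite (gi_root isof) (rt_root rtB).
- move=> x; rewrite -(gi_tree isof) => /(rt_edge rtB).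
  by rewrite gi_leg -(gi_alpha isof) (gi_tree isof).
- by move=> x; rewrite -(gi_tree isof) (gi_alpha isof); apply: (rt_mono rtB).
- move=> x; rewrite (gi_root isof) => /(rt_parent rtB)[p [pT xp app pP]].
  exists (g p); rewrite -(gi_tree isof) (gi_alpha isof) gf.
  by split=> // z; apply: pP.
- move=> p q; rewrite -!(gi_tree isof) !(gi_alpha isof) => pT qT pq qp app aqq.
  by apply: gi_inj; apply: (rt_uniq rtB).
Qed.

(** The relation pulled back from [Q] is an ancestor relation for the tree of [P], and a tree has
    only one. *)
Lemma gi_anc (A : rel P) (B : rel Q) :
    involutive (@alpha P) -> rooted_tree (gtree P) A -> rooted_tree (gtree Q) B ->
  forall x y, B (f x) (f y) = A x y.
Proof.
move=> inva rtA /gi_pullback rtB x y; apply/idP/idP.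
  by move/(ancestorE inva rtB)/(ancestorE inva rtA).
by move/(ancestorE inva rtA)/(ancestorE inva rtB).
Qed.

End GIso.

Lemma giso_comp (P Q R : growing) (f : P -> Q) (g : Q -> R) :
  giso f -> giso g -> giso (g \o f).
Proof.
move=> [bf sf af rf hf tf] [bg sg ag rg hg tg]; split=> /=.
- exact: bij_comp.
- by move=> x; rewrite sf sg.
- by move=> x; rewrite af ag.
- by rewrite rf rg.
- by rewrite hf hg.
- by move=> x; rewrite tg tf.
Qed.

Section GIsoGrow.
Variables (left : bool) (P Q : growing).

Lemma giso_grow (f : P -> Q) : giso f -> exists g : grow left P -> grow left Q, giso g.
Proof.
move=> isof; have [k fk kf] := gi_bij isof.
pose ext (P Q : growing) (f : P -> Q) (x : grow left P) : grow left Q :=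
  match x with
  | Some (inl d) => @old_dart Q (f d)
  | Some (inr b) => Some (inr b)
  | None => None
  end.
exists (ext _ _ f); split=> //.
- by exists (ext _ _ k) => -[[x|b]|] //=; rewrite /old_dart ?fk ?kf.
- by move=> [[x|[]]|] //=; case: left => //=; rewrite (gi_sigma isof).
- move=> [[x|b]|] //=; last by rewrite (gi_head isof).
  rewrite -(gi_head isof) (inj_eq (gi_inj isof)).
  by case: ifP => //= _; rewrite (gi_alpha isof).
- by rewrite /= (gi_root isof).
- move=> [[x|b]|]; rewrite ?grow_tree_new ?grow_tree_back //=.
  rewrite (grow_tree_old left (f x)) (grow_tree_old left x) (gi_tree isof).
  by rewrite -(gi_head isof) (inj_eq (gi_inj isof)).
Qed.

Variables (i : nat) (A : rel P) (B : rel Q).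
Hypotheses (exP : explored i A) (exQ : explored i B).

(** The image of the head and the rotation around it determine the images of the three new darts, so
    the isomorphism restricts to the old ones. *)
Lemma giso_ungrow (f : grow left P -> grow left Q) : giso f -> exists g : P -> Q, giso g.
Proof.
move=> isof; have injf := gi_inj isof.
have fh : f (new_head P) = new_head Q := gi_head isof.
have [fl fb] : f (new_leg P) = new_leg Q /\ f (back_dart P) = back_dart Q.
  have e1 := gi_sigma isof (new_head P); have e2 := gi_sigma isof (new_leg P).
  have e3 := gi_sigma isof (back_dart P).
  rewrite grow_sigma_head fh grow_sigma_head in e1.
  rewrite grow_sigma_leg in e2; rewrite grow_sigma_back in e3.
  have [lE|lE] : left = true \/ left = false by case: (left); auto.
    have ite (T : Type) (a b : T) : (if left then a else b) = a by rewrite lE.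
    by rewrite !ite in e1 e2; rewrite e1 grow_sigma_leg ite in e2.
  have ite (T : Type) (a b : T) : (if left then a else b) = b by rewrite lE.
  by rewrite !ite in e1 e3; rewrite e1 grow_sigma_back ite in e3.
have fold d : exists e, f (@old_dart P d) = @old_dart Q e.
  case fE : (f (@old_dart P d)) => [[e|[]]|]; first by exists e.
  - by have := injf (old_dart d) (new_head P); rewrite fE fh => /(_ erefl).
  - by have := injf (old_dart d) (new_leg P); rewrite fE fl => /(_ erefl).
  - by have := injf (old_dart d) (back_dart P); rewrite fE fb => /(_ erefl).
have [g gE] : exists g, forall d, f (@old_dart P d) = @old_dart Q (g d).
  (* By [fold] the image is always an old dart. *)
  exists (fun d => if f (old_dart d) is Some (inl e) then e else root) => d.
  by have [e ->] := fold d.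
have injg : injective g.
  by move=> x y gxy; have [] : old_dart x = old_dart y by apply: injf; rewrite !gE gxy.
have headT (R : growing) (C : rel R) : explored i C -> head R \notin gtree R.
  move=> exR; apply/negP => /(rt_edge (ex_tree exR))[]; have [_ -> _] := ex_legs exR.
  by [].
have gh : g (head P) = head Q.
  have := gi_alpha isof (back_dart P); rewrite fb => aE.
  by have [] : old_dart (g (head P)) = old_dart (head Q) by rewrite -gE; exact: aE.
exists g; split=> //.
- apply: inj_card_bij => //; have := bij_eq_card (gi_bij isof).
  by rewrite !card_option !card_sum !card_bool => -[]; rewrite !addn2 => -[] ->.
- move=> d; have := gi_sigma isof (old_dart d).
  by rewrite gE -[sigma _]/(@old_dart P (sigma d)) gE => -[].
- move=> d; have [->|dh] := eqVneq d (head P).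
    rewrite gh; have [_ /eqP-> _] := ex_legs exP; rewrite gh.
    by have [_ /eqP-> _] := ex_legs exQ.
  have := gi_alpha isof (old_dart d); rewrite gE /= (negPf dh) -gh (inj_eq injg) (negPf dh).
  by rewrite gE => -[].
- by have := gi_root isof; rewrite /= gE => -[].
- move=> d; have := gi_tree isof (old_dart d); rewrite gE.
  rewrite (grow_tree_old left (g d)) (grow_tree_old left d) -gh (inj_eq injg).
  have [->|_] := eqVneq d (head P); last by rewrite !orbF.
  by rewrite gh (negPf (headT _ _ exP)) (negPf (headT _ _ exQ)).
Qed.
End GIsoGrow.

(* The tour of the head-face leaves the subtree of the head-vertex for the first
   time along [tour_exit], and is back in it for good after [tour_entry]. *)
Definition tour_exit (Q : growing) (A : rel Q) : Q :=
  seq.head (head Q) [seq y <- orbit face_next (head Q) | ~~ A (head Q) (alpha y)].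

Definition tour_entry (Q : growing) (A : rel Q) : Q :=
  last (head Q) [seq y <- orbit face_next (head Q) | ~~ A (head Q) y].

Lemma fpath_next (T : eqType) (f : T -> T) x z h b :
  fpath f x (rcons z h) -> b \in z -> f b \in rcons z h.
Proof.
elim: z x => //= c z IH x /andP[_ pz]; rewrite !inE => /predU1P[->|bz].
  by case: z pz {IH} => [|d z] /= /andP[/eqP-> _]; rewrite !inE eqxx ?orbT.
by rewrite (IH c pz bz) orbT.
Qed.

Section Exits.
Variables (i : nat) (Q : growing) (A : rel Q).
Hypothesis exQ : explored i A.
Hypothesis headN : ~~ A (head Q) root.
Let t := head Q.
Let rtA := ex_tree exQ.
Let trA := rt_trans rtA.

Lemma order3 : fingraph.order (@sigma Q) t = 3.
Proof.
have [_ deg3] := ex_cubic exQ; rewrite -(deg3 t); last first.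
  by rewrite (rt_vertex_eq rtA) (negPf headN).
by apply: eq_card => x; rewrite [RHS]inE.
Qed.

Lemma head_orbit3 : orbit sigma t = [:: t; sigma t; sigma (sigma t)] /\
  sigma (sigma (sigma t)) = t.
Proof.
split; first by rewrite /orbit order3.
by have := iter_order (ex_sigma exQ) t; rewrite order3.
Qed.

Lemma head_parent : exists p, [/\ p \in gtree Q, A p t /\ A t p, A (alpha p) p,
  ~~ A t (alpha p) & (p == sigma t) || (p == sigma (sigma t))].
Proof.
have [p [pT [tp pt] app _]] := rt_parent rtA headN; exists p; split=> //.
  apply/negP => tap; have := rt_T_neq rtA pT.
  by rewrite app (trA pt tap).
have : fconnect sigma t p by rewrite (rt_vertex rtA) tp.
rewrite fconnect_orbit (head_orbit3).1 !inE => /or3P[/eqP pE|->|->]; rewrite ?orbT //.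
have [pN _] := rt_edge rtA pT; have [_ tL _] := ex_legs exQ.
by rewrite pE tL in pN.
Qed.

Lemma orbit_headE : exists s, orbit (@face_next Q) t = t :: s.
Proof. by rewrite /orbit -orderSpred; eexists. Qed.

Lemma head_leg_face : face_next t = sigma t.
Proof. by have [_ /eqP tL _] := ex_legs exQ; rewrite /face_next tL. Qed.

(* One of the two neighbours of the head at its vertex is the parent edge. *)
Lemma exit_or_entry_tree : (tour_exit A \in gtree Q) || (tour_entry A \in gtree Q).
Proof.
have inva := ex_alpha exQ; have [_ tL _] := ex_legs exQ.
have injf : injective (@face_next Q) := inj_comp (ex_sigma exQ) (inv_inj inva).
have [p [pT [pt tp] app tap]] := head_parent.
have [_ sig3] := head_orbit3; have [s orbE] := orbit_headE.
have cyc := cycle_orbit injf t; have us := orbit_uniq (@face_next Q) t.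
rewrite orbE in cyc us; rewrite /tour_exit /tour_entry orbE.
have tt : A t t := rt_refl rtA t.
case/orP=> /eqP pE.
  case: s cyc us {orbE} => [|y s] /=.
    rewrite andbT head_leg_face -pE => /eqP pE' _.
    by have [] := rt_edge rtA pT; rewrite pE' tL.
  case/andP=> /eqP; rewrite head_leg_face -pE => <- _ _.
  by rewrite (eqP tL) tt /= tap /= pT.
have [_ apT] := rt_edge rtA pT.
apply/orP; right; case/lastP: s cyc us {orbE} => [|s y].
  rewrite /= andbT head_leg_face => /eqP st _.
  by have [] := rt_edge rtA pT; rewrite pE !st tL.
move=> cyc _; have -> : y = alpha p.
  apply: injf; rewrite {2}/face_next inva pE sig3.
  by move: cyc; rewrite /= rcons_path last_rcons => /andP[_ /eqP].
by rewrite -rcons_cons filter_rcons tap last_rcons.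
Qed.

End Exits.

Section StepIdent.
Variables (i : nat) (P : growing) (A : rel P) (s1 s2 : seq P).
Hypotheses (exP : explored i A) (ordP : ordered A s1 s2).
Variables (s t : P) (s1' s2' : seq P).
Hypothesis stepP : c_step s1 s2 s t s1' s2'.
Hypotheses (leg_s : is_leg s) (leg_t : is_leg t) (st : A s t) (ts : ~~ A t s).
Let Q := glue_head s t.
Let exQ : @explored i Q A. Proof. exact: (explored_c_step exP ordP stepP). Qed.
Let ordQ : @ordered Q A s1' s2'. Proof. exact: (ordered_c_step exP ordP stepP). Qed.
Let rtA := ex_tree exP.

Lemma c_step_root : ~~ A t root.
Proof. by apply: contra ts => tr; apply: (rt_trans rtA) tr (rt_root rtA _). Qed.

Lemma c_step_neq : head P != s.
Proof. by apply: contraNneq ts => <-; have [] := ex_face exP leg_t. Qed.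

(** After [StepForward] the tour runs through [t] and [z], inside the subtree of [t], and leaves it
    by [head P]. After [StepBackward] it ends with [s] and [u], and only [u] is inside. *)
Lemma c_step_exit : @tour_exit Q A = head P \/ @tour_entry Q A = s.
Proof.
have := or_tour ordQ; rewrite /tour /tour_exit /tour_entry.
move: (leg_s) (leg_t) (st) (ts) (exQ) c_step_neq; rewrite /Q.
case: stepP => u v w z x y s1E s2E uN zN sL tL xy yx exQ' hx orbE; rewrite orbE.
  left.
  have [_ /eqP yL _] := ex_legs exQ'.
  (* For [b] in [z], [alpha b] is at the vertex of the dart that follows [b] in the tour of [P];
     this dart is again in [z] or is the head. *)
  have zA b : b \in y :: z -> A y (@alpha (glue_head x y) b).
    rewrite inE => /predU1P[->|bz]; first by rewrite yL (rt_refl rtA).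
    have bL : ~~ is_leg b by apply: (hasPn zN).
    rewrite glue_alpha_nonleg //; last by case: (ex_legs exP).
    have injf : injective (@face_next P) := inj_comp (ex_sigma exP) (inv_inj (ex_alpha exP)).
    have := cycle_orbit injf (head P); rewrite (or_tour ordP) s2E => cyc.
    have : fpath face_next y (rcons z (head P)).
      have : fpath face_next (head P) (rcons (s1 ++ root :: w ++ y :: z) (head P)) by [].
      by rewrite rcons_cat rcons_cons rcons_cat rcons_cons -cat_cons catA cat_path => /and3P[].
    move/fpath_next/(_ bz); rewrite /face_next => nz.
    have := or_right ordP; rewrite s2E rcons_cat rcons_cons => /pairwise_mid[/(_ _ nz)].
    by rewrite tL (rt_sigmar rtA).
  rewrite -cat_cons -cat_cons filter_cat filter_cat.
  rewrite (_ : filter _ (y :: z) = [::]); last first.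
    apply/eqP; rewrite -[_ == _]negbK -has_filter; apply/hasPn => b /zA.
    by rewrite negbK.
  by rewrite /= /glue_alpha eqxx yx.
right.
have uA b : b \in u -> A y b.
  have := or_left ordP; rewrite s1E -cat_cons => /pairwise_mid[_ /(_ b)] + bu.
  by rewrite inE bu orbT tL => /(_ isT).
have E : y :: v ++ root :: w ++ x :: u = rcons (y :: v ++ root :: w) x ++ u.
  by rewrite cat_rcons /= -catA.
rewrite E filter_cat (_ : filter _ u = [::]); last first.
  apply/eqP; rewrite -[_ == _]negbK -has_filter; apply/hasPn => b /uA.
  by rewrite negbK.
by rewrite cats0 filter_rcons yx last_rcons.
Qed.

End StepIdent.

Lemma gi_exit (P Q : growing) (f : P -> Q) (A : rel P) (B : rel Q) :
    giso f -> (forall x y, B (f x) (f y) = A x y) ->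
  f (tour_exit A) = tour_exit B /\ f (tour_entry A) = tour_entry B.
Proof.
move=> isof fA; rewrite /tour_exit /tour_entry -(gi_head isof) (gi_orbit isof).
rewrite !filter_map (eq_filter (a2 := fun y => ~~ A (head P) (alpha y))) => [|y /=]; last first.
  by rewrite -(gi_alpha isof) fA.
rewrite (eq_filter (a1 := preim f _) (a2 := fun y => ~~ A (head P) y)) => [|y /=]; last first.
  by rewrite fA.
by rewrite last_map; split=> //; case: (filter _ _).
Qed.

(** Of exit and entry at least one is a tree dart, and the glued edge supplies one that is not. An
    isomorphism preserves which of the two is external, and therefore maps one glued edge to the
    other, respecting its halves. *)
Lemma c_step_inj (i : nat) (P1 P2 : growing) (A1 : rel P1) (A2 : rel P2)
    (s1 s2 s1' s2' : seq P1) (r1 r2 r1' r2' : seq P2) (s t : P1) (x y : P2)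
    (f : glue_head s t -> glue_head x y) :
    explored i A1 -> ordered A1 s1 s2 -> c_step s1 s2 s t s1' s2' ->
    is_leg s -> is_leg t -> A1 s t -> ~~ A1 t s ->
    explored i A2 -> ordered A2 r1 r2 -> c_step r1 r2 x y r1' r2' ->
    is_leg x -> is_leg y -> A2 x y -> ~~ A2 y x ->
    giso f ->
  @giso P1 P2 f.
Proof.
move=> ex1 or1 st1 sL tL st ts ex2 or2 st2 xL yL xy yx isof.
have exQ1 := explored_c_step ex1 or1 st1 sL tL st ts.
have exQ2 := explored_c_step ex2 or2 st2 xL yL xy yx.
have hs1 := c_step_neq ex1 tL ts; have hs2 := c_step_neq ex2 yL yx.
have leg1 : is_leg (head P1) by case: (ex_legs ex1).
have leg2 : is_leg (head P2) by case: (ex_legs ex2).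
have fA := gi_anc isof (ex_alpha exQ1) (ex_tree exQ1) (ex_tree exQ2).
have [exitE entryE] := gi_exit isof fA.
have a1 : f (@alpha (glue_head s t) (head P1)) = alpha (f (head P1)) := gi_alpha isof _.
have a2 : f (@alpha (glue_head s t) s) = alpha (f s) := gi_alpha isof _.
rewrite glue_alpha_h in a1; rewrite (glue_alpha_s hs1) in a2.
have legT (P : growing) (A : rel P) (z : P) : explored i A -> is_leg z -> z \notin gtree P.
  by move=> exP zL; apply/negP => /(rt_edge (ex_tree exP))[]; rewrite zL.
have [fh fs] : f (head P1) = head P2 /\ f s = x.
  have := exit_or_entry_tree exQ1 (c_step_root ex1 ts).
  have := exit_or_entry_tree exQ2 (c_step_root ex2 yx).
  case: (c_step_exit ex1 or1 st1 sL tL st ts) => E1;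
    case: (c_step_exit ex2 or2 st2 xL yL xy yx) => E2 T2 T1.
  - have fh : f (head P1) = head P2 by rewrite -E1 exitE E2.
    by split=> //; rewrite a1 fh glue_alpha_h.
  - case/orP: T1 => [|eT].
      by rewrite E1 => hT; case/negP: (legT _ _ _ ex1 leg1).
    by case/negP: (legT _ _ _ ex2 xL); rewrite -E2 -entryE (gi_tree isof).
  - case/orP: T1 => [eT|].
      by case/negP: (legT _ _ _ ex2 leg2); rewrite -E2 -exitE (gi_tree isof).
    by rewrite E1 => hT; case/negP: (legT _ _ _ ex1 sL).
  - have fs : f s = x by rewrite -E1 entryE E2.
    by split=> //; rewrite a2 fs (glue_alpha_s hs2).
have injf := gi_inj isof; split=> //.
- exact: gi_bij isof.
- exact: gi_sigma isof.
- move=> z; have [->|zh] := eqVneq z (head P1); first by rewrite (eqP leg1) fh (eqP leg2).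
  have [->|zs] := eqVneq z s; first by rewrite (eqP sL) fs (eqP xL).
  have := gi_alpha isof z; rewrite !glue_alpha_other //.
    by rewrite -fh (inj_eq injf).
  by rewrite -fs (inj_eq injf).
- exact: gi_root isof.
- exact: gi_tree isof.
Qed.

Definition last_step (x : letter) (P : growing) (A : rel P) (s1 s2 : seq P) (Q : growing) : Prop :=
  match x with
  | La => Q = grow true P
  | Lb => Q = grow false P
  | Lc => exists s t s1' s2', [/\ Q = glue_head s t, c_step s1 s2 s t s1' s2',
            is_leg s, is_leg t & A s t && ~~ A t s]
  end.

Lemma reach_cons (i : nat) x w Q : walk_ok i (x :: w) ->
    phi_word (x :: w) (initial_map i) = Some Q ->
  exists (P : growing) (A : rel P) (s1 s2 : seq P), reach i w A s1 s2 /\ last_step x A s1 s2 Q.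
Proof.
rewrite /walk_ok -/walk_ok => /and3P[/phi_word_reach[P [A [s1 [s2 r]]]] ca cb].
rewrite /= -/(phi_word w _) (rc_word r) /= => phiE; exists P, A, s1, s2; split=> //.
case: x ca cb phiE => /= ca cb; [by case | by case |].
have l1 : has (@is_leg P) s1 by rewrite has_count; have := rc_left r; lia.
have l2 : has (@is_leg P) s2 by rewrite has_count; have := rc_right r; lia.
have [s [t [s1' [s2' [phiE stepP sL tL stA]]]]] := phi_c_step (rc_explored r) (rc_ordered r) l1 l2.
by rewrite phiE => -[<-]; exists s, t, s1', s2'.
Qed.

(* The last letter is read off the legs next to the head. *)
Definition head_pattern (Q : growing) : bool * bool :=
  (is_leg (sigma (head Q)), is_leg (sigma (sigma (head Q)))).

Lemma head_pattern_grow (b : bool) (P : growing) :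
  head_pattern (grow b P) = (b, ~~ b).
Proof. by case: b; rewrite /head_pattern /is_leg /= ?eqxx. Qed.

(** The vertex of [t] is not the root-vertex, so [t] was its only leg apart possibly from the old
    head, which gluing makes half of an edge. *)
Lemma head_pattern_c (i : nat) (P : growing) (A : rel P) (s1 s2 : seq P) s t s1' s2' :
    explored i A -> ordered A s1 s2 -> c_step s1 s2 s t s1' s2' ->
    is_leg s -> is_leg t -> A s t -> ~~ A t s ->
  head_pattern (glue_head s t) = (false, false).
Proof.
move=> exP ordP stepP sL tL st ts.
have exQ := explored_c_step exP ordP stepP sL tL st ts.
have tr := c_step_root exP ts; have hs := c_step_neq exP tL ts.
have [orbE _] := head_orbit3 exQ tr.
have := orbit_uniq (@sigma (glue_head s t)) t; rewrite orbE /= !inE negb_or.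
case/and3P=> /andP[t1 t2] _ _.
have rtA := ex_tree exP.
have noleg (x : P) : x != t -> fconnect (@sigma P) t x -> @is_leg (glue_head s t) x = false.
  rewrite (rt_vertex rtA) => xt /andP[tx xt']; apply/negP.
  rewrite (glue_leg hs) => /and3P[xL xh _]; case/eqP: xt.
  apply: (or_single ordP) => //.
    have [_ tQ _] := ex_legs exQ.
    have /and3P[_ th _] : [&& @is_leg P t, t != head P & t != s] by rewrite -(glue_leg hs).
    by rewrite th.
  by apply: contra tr; apply: (rt_trans rtA).
rewrite /head_pattern !noleg // 1?eq_sym //.
  by apply: connect_trans (fconnect1 _ _) (fconnect1 _ _).
exact: fconnect1.
Qed.

Lemma giso_pattern (P Q : growing) (f : P -> Q) : giso f -> head_pattern P = head_pattern Q.
Proof.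
move=> isof; rewrite /head_pattern -(gi_head isof).
by rewrite -!(gi_sigma isof) !(gi_leg isof).
Qed.

Lemma last_step_pattern (i : nat) x w (P : growing) (A : rel P) s1 s2 Q :
  reach i w A s1 s2 -> last_step x A s1 s2 Q -> head_pattern Q = (is_a x, is_b x).
Proof.
move=> r; case: x => /=; [by move->; apply: head_pattern_grow.. |].
case=> s [t [s1' [s2' [-> stepP sL tL /andP[st ts]]]]].
exact: head_pattern_c (rc_explored r) (rc_ordered r) stepP sL tL st ts.
Qed.

Lemma phi_word_inj (i : nat) w1 w2 (P1 P2 : growing) (f : P1 -> P2) :
    walk_ok i w1 -> walk_ok i w2 -> size w1 = size w2 ->
    phi_word w1 (initial_map i) = Some P1 -> phi_word w2 (initial_map i) = Some P2 ->
  giso f -> w1 = w2.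
Proof.
elim: w1 w2 P1 P2 f => [|x w1 IH] [|y w2] // Q1 Q2 f ok1 ok2 [sz] Q1E Q2E isof.
have [P1 [A1 [s1 [s2 [r1 l1]]]]] := reach_cons ok1 Q1E.
have [P2 [A2 [t1 [t2 [r2 l2]]]]] := reach_cons ok2 Q2E.
have xy : x = y.
  have := giso_pattern isof; rewrite (last_step_pattern r1 l1) (last_step_pattern r2 l2).
  by case: (x) (y) => -[].
suff [g isog] : exists g : P1 -> P2, giso g.
  rewrite xy (IH w2 P1 P2 g) //; [| |exact: rc_word r1 |exact: rc_word r2].
    by move: ok1; rewrite /walk_ok -/walk_ok => /and3P[].
  by move: ok2; rewrite /walk_ok -/walk_ok => /and3P[].
have ex1 := rc_explored r1; have ex2 := rc_explored r2.
rewrite -xy in l2; case: x l1 l2 {xy Q1E Q2E ok1 ok2} => /=.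
- by move=> E1 E2; subst Q1 Q2; apply: giso_ungrow ex1 ex2 _ isof.
- by move=> E1 E2; subst Q1 Q2; apply: giso_ungrow ex1 ex2 _ isof.
case=> s [t [s1' [s2' [E1 st1 sL tL /andP[st ts]]]]].
case=> u [v [t1' [t2' [E2 st2 uL vL /andP[uv vu]]]]]; subst Q1 Q2; exists f.
exact: (c_step_inj ex1 (rc_ordered r1) st1 sL tL st ts ex2 (rc_ordered r2) st2 uL vL uv vu isof).
Qed.

(** The root is preserved, hence so is the other half of its edge, which was the head. *)
Lemma iso_close (i : nat) (P1 P2 : growing) (A1 : rel P1) (A2 : rel P2) :
    explored i A1 -> explored i A2 -> iso (close_map P1) (close_map P2) ->
  exists f : P1 -> P2, giso f.
Proof.
move=> ex1 ex2 [f [bijf fs fa fr [_ fT]]]; exists f.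
have [rL1 hL1 hr1] := ex_legs ex1; have [rL2 hL2 hr2] := ex_legs ex2.
have injf := bij_inj bijf.
have fh : f (head P1) = head P2.
  have := fa (root : P1); rewrite (glue_alpha_s hr1) => ->.
  by rewrite fr (glue_alpha_s hr2).
split=> // [x|x].
  have [->|xh] := eqVneq x (head P1); first by rewrite (eqP hL1) fh (eqP hL2).
  have [->|xr] := eqVneq x root; first by rewrite (eqP rL1) fr (eqP rL2).
  have := fa x; rewrite !glue_alpha_other //.
    by rewrite -fh (inj_eq injf).
  by rewrite -[root]fr (inj_eq injf).
by rewrite -[gtree P2]fT (mem_imset _ _ injf).
Qed.

Lemma Phi_defined (i n : nat) w : kreweras i w -> size w = 3 * n + 2 * i ->
  exists (P : growing) (A : rel P),
    [/\ phi_word w (initial_map i) = Some P, Phi i w = Some (close_map P), explored i A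
      & near_cubic_depth_map i n (close_map P)].
Proof.
move=> kw wn; have [_ aE bE] := kw.
have [P [A [s1 [s2 r]]]] := phi_word_reach (walk_okP kw).
exists P, A; split; [exact: rc_word r | | exact: rc_explored r | exact: close_target r aE bE _ wn].
by rewrite /Phi (rc_word r) /= (closeE r aE bE).
Qed.

Lemma Phi_inj (i n : nat) w1 w2 M1 M2 :
    kreweras i w1 -> size w1 = 3 * n + 2 * i -> kreweras i w2 -> size w2 = 3 * n + 2 * i ->
  Phi i w1 = Some M1 -> Phi i w2 = Some M2 -> iso M1 M2 -> w1 = w2.
Proof.
move=> k1 n1 k2 n2; have [P1 [A1 [w1E -> ex1 _]]] := Phi_defined k1 n1.
have [P2 [A2 [w2E -> ex2 _]]] := Phi_defined k2 n2.
move=> [<-] [<-] /(iso_close ex1 ex2)[f isof].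
by apply: phi_word_inj (walk_okP k1) (walk_okP k2) _ w1E w2E isof; rewrite n1 n2.
Qed.

(** * Surjectivity *)

Lemma orbit_rot (T : finType) (f : T -> T) x y a b : injective f ->
  orbit f x = x :: a ++ y :: b -> orbit f y = y :: b ++ x :: a.
Proof.
move=> injf xE; have E : rot (size (x :: a)) (x :: a ++ y :: b) = y :: b ++ x :: a.
  by rewrite -cat_cons rot_size_cat.
by apply: orbit_cycle; rewrite -E ?rot_cycle ?rot_uniq -xE ?orbit_uniq ?cycle_orbit.
Qed.

Lemma orbit_cons (T : finType) (f : T -> T) x : exists s, orbit f x = x :: s.
Proof. by rewrite /orbit -orderSpred; eexists. Qed.

(** * Cutting an edge *)

Section Cut.
Variables (i : nat) (Q : growing) (A : rel Q).
Hypothesis exQ : explored i A.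
Hypothesis headN : ~~ A (head Q) root.
Let t := head Q.
Let rtA := ex_tree exQ.
Let trA := rt_trans rtA.
Let inva := ex_alpha exQ.
Let injs := ex_sigma exQ.
Let injf : injective (@face_next Q). Proof. exact: inj_comp injs (inv_inj inva). Qed.

Lemma cut_rooted_tree (M : rmap) (T : {set M}) (B : rel M) (h : M) :
  involutive (@alpha M) -> rooted_tree T B -> h \notin T -> @rooted_tree (cut h) T B.
Proof.
move=> invM rtB hT; have alphaE x : x \in T -> @alpha (cut h) x = alpha x.
  move=> xT; rewrite /= /cut_fun; case: ifP => // /orP[]/eqP xh; first by rewrite -xh xT in hT.
  have [_] := rt_edge rtB xT; rewrite xh invM => hT'.
  by rewrite hT' in hT.
split.
- exact: rt_vertex rtB.
- exact: rt_trans rtB.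
- exact: rt_root rtB.
- move=> x xT; have [xN axT] := rt_edge rtB xT.
  by rewrite /is_leg alphaE.
- by move=> x xT; rewrite alphaE //; apply: (rt_mono rtB).
- by move=> x /(rt_parent rtB)[p [pT xp app pP]]; exists p; split=> //; rewrite alphaE.
- by move=> p q pT qT pq qp; rewrite !alphaE //; apply: (rt_uniq rtB).
Qed.

(* Cutting an edge at the head-vertex, other than the parent edge, does not
   disconnect the map: if it is a tree edge, its lower side remains attached
   through the back edge given by [ex_back]. *)
Lemma head_edge_two_faces d : ~~ is_leg d -> A d t -> A t d ->
    ~~ ((d \in gtree Q) && A (alpha d) d) ->
  ~~ fconnect face_next d (alpha d).
Proof.
move=> dN dt td dP; have invC := cut_funK d inva.
suff conn : n_comp (@joined (cut d)) (cut d) = 1.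
  by have [] := euler_cut injs inva dN (ex_euler exQ) conn.
apply: connected_n_comp => //.
have [dT|dT] := boolP (d \in gtree Q); last first.
  exact: (@rt_connected (cut d) _ _ injs invC (cut_rooted_tree inva rtA dT)).
rewrite dT /= in dP; have dx : A d (alpha d).
  by have := rt_mono rtA dT; rewrite (negPf dP) addbF.
set x := alpha d in dP dx; have ax : alpha x = d by rewrite /x inva.
have [_ xT] := rt_edge rtA dT; rewrite -/x in xT.
have [e [eN xe aed dae]] : exists e, [/\ ~~ is_leg e, A x e, A (alpha e) d & ~~ A d (alpha e)].
  have := ex_back exQ xT; rewrite ax; apply=> //.
    by apply: contra headN; apply: trA td.
  by apply: contra dP => xt; apply: trA xt td.
have alphaC y : y != d -> y != x -> @alpha (cut d) y = alpha y.
  by move=> yd yx; rewrite /= /cut_fun (negPf yd) (negPf yx).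
pose R := link (@sigma (cut d)) (@alpha (cut d)).
have symR : connect_sym R := link_sym injs (inv_inj invC).
have vert y z : A y z -> A z y -> connect R y z.
  move=> yz zy; have : fconnect (@sigma Q) y z by rewrite (rt_vertex rtA) yz.
  by apply: connect_sub => u v /eqP <-; apply: connect1 (link_s _ _ _).
have step y : y != d -> y != x -> connect R y (alpha y).
  by move=> yd yx; rewrite -alphaC //; apply: connect1 (link_a _ _ _).
have upper : forall y, ~~ A x y -> connect R y root.
  elim/(rt_ind rtA) => [y yr|y p yN pT yp py app pap pP IH] xy.
    by apply: vert; rewrite ?(rt_root rtA).
  apply: connect_trans (vert _ _ yp py) _; apply: connect_trans (step p _ _) _.
  - by apply: contraNneq dP => pd; move: app; rewrite pd.
  - by apply: contraNneq xy => <-.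
  - by apply: IH; apply: contra xy => xap; apply: trA (trA xap app) py.
have lower : forall y, A x y -> connect R y x.
  elim/(rt_ind rtA) => [y yr|y p yN pT yp py app pap pP IH] xy.
    by apply: vert => //; apply: trA yr (rt_root rtA x).
  have [yx|yx] := boolP (A y x); first exact: vert.
  have xap : A x (alpha p) by have := pP _ xy; rewrite (negPf yx).
  apply: connect_trans (vert _ _ yp py) _; apply: connect_trans (step p _ _) (IH xap).
  - by apply: contraNneq dP => pd; apply: trA xy _; rewrite -pd.
  - by apply: contraNneq yx => <-.
have xroot : connect R x root.
  apply: (connect_trans (y := e)); first by rewrite symR lower.
  apply: connect_trans (step e _ _) (upper _ _).
  - by apply: contraNneq dP => <-.
  - by apply: contraNneq dae => ->; rewrite ax (rt_refl rtA).
  - by apply: contra dae; apply: trA dx.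
have toroot y : connect R y root.
  have [/lower yx|/upper//] := boolP (A x y); exact: connect_trans yx xroot.
by move=> y z; apply: connect_trans (toroot y) _; rewrite symR.
Qed.

Section CutEdge.
Variable h : Q.
Let s := alpha h.
Hypotheses (hN : ~~ is_leg h) (hT : h \notin gtree Q).
Hypotheses (th : A t h) (st : A s t) (ts : ~~ A t s).

Definition uncut : growing := @Growing (cut h) h (gtree Q).

Let hs : h != s. Proof. by rewrite eq_sym. Qed.

Let alphaU x : x != h -> x != s -> @alpha uncut x = alpha x.
Proof. by move=> xh xs; rewrite /= /cut_fun (negPf xh) (negPf xs). Qed.

Let alphaUh : @alpha uncut h = h.
Proof. by rewrite /= /cut_fun eqxx. Qed.

Let alphaUs : @alpha uncut s = s.
Proof. by rewrite /= /cut_fun eqxx orbT. Qed.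

Lemma uncut_leg x : @is_leg uncut x = [|| @is_leg Q x, x == h | x == s].
Proof.
rewrite /is_leg; have [->|xh] := eqVneq x h; first by rewrite alphaUh eqxx orbT.
have [->|xs] := eqVneq x s; first by rewrite alphaUs eqxx !orbT.
by rewrite alphaU // !orbF.
Qed.

Lemma glue_uncut : giso (id : @Growing (glue (h : uncut) s) t (gtree Q) -> Q).
Proof.
split=> //; first by exists id.
move=> x; rewrite /= /glue_alpha.
have [->//|xh] := eqVneq x h.
have [->|xs] := eqVneq x s; first by rewrite /s inva.
exact: alphaU.
Qed.

Let rtU : @rooted_tree uncut (gtree Q) A.
Proof. exact: cut_rooted_tree. Qed.

Let eulerU : euler uncut /\ fconnect (@face_next uncut) h s.
Proof.
have invC := cut_funK h inva.
have conn : n_comp (@joined (cut h)) (cut h) = 1.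
  by apply: connected_n_comp => //; exact: (@rt_connected (cut h) _ _ injs invC rtU).
by have [] := euler_cut injs inva hN (ex_euler exQ) conn.
Qed.

(** Cutting merges the faces on both sides of the edge. The separate tours are recovered from the
    merged one by [fcycle_glue], since gluing the two legs again gives back [Q]. *)
Lemma uncut_orbit : exists a b, [/\ orbit (@face_next uncut) h = h :: a ++ s :: b,
  orbit (@face_next Q) h = h :: b & orbit (@face_next Q) s = s :: a].
Proof.
have invC := cut_funK h inva; have injU : injective (@face_next uncut).
  exact: inj_comp injs (inv_inj invC).
have [o oE] := orbit_cons (@face_next uncut) h.
have : s \in orbit (@face_next uncut) h by rewrite -fconnect_orbit; case: eulerU.
rewrite oE inE eq_sym (negPf hs) /= => /splitPr ho; case: ho oE => a b oE.
exists a, b; have legh : @is_leg uncut h by rewrite uncut_leg eqxx orbT.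
have legs : @is_leg uncut s by rewrite uncut_leg eqxx !orbT.
have cyc := cycle_orbit injU h; have us := orbit_uniq (@face_next uncut) h.
rewrite oE in cyc us; have [c1 c2] := fcycle_glue (M := uncut) legh legs hs cyc us.
have u1 : uniq (h :: b).
  move: us; rewrite /= mem_cat inE !negb_or cat_uniq /= => /andP[/and3P[_ _ ->]].
  by case/and3P=> _ _ /andP[].
have u2 : uniq (s :: a).
  by move: us; rewrite /= cat_uniq /= negb_or => /andP[_ /and3P[-> /andP[-> _]]].
have giE x : orbit (@face_next Q) x = orbit (@face_next (glue (h : uncut) s)) x.
  by have := gi_orbit glue_uncut x; rewrite map_id.
by split=> //; rewrite giE; apply: orbit_cycle.
Qed.

Hypothesis th_face : fconnect (@face_next Q) t h || fconnect (@face_next Q) t s.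

Lemma explored_uncut : explored i (A : rel uncut).
Proof.
have [leg_root leg_t tr] := ex_legs exQ; have invC := cut_funK h inva.
have hr : ~~ A h root.
  by apply: contra headN; apply: trA th.
split.
- exact: injs.
- exact: invC.
- by case: eulerU.
- exact: ex_cubic exQ.
- exact: rtU.
- move=> x; rewrite uncut_leg !negb_or => /and3P[xN xh xs].
  by rewrite alphaU //; apply: (ex_mono exQ).
- have hroot : h != root by apply: contraNneq hN => ->.
  by rewrite !uncut_leg leg_root eqxx orbT.
- have [a [b [oU oh os]]] := uncut_orbit.
  move=> x; rewrite uncut_leg => /or3P[xL|/eqP->|/eqP->].
  + have [tx xt] := ex_face exQ xL; split; last exact: trA xt th.
    rewrite fconnect_orbit oU; have symf := fconnect_sym injf.
    have face_x y : fconnect (@face_next Q) t y -> x \in orbit (@face_next Q) y.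
      by rewrite -fconnect_orbit symf => yt; apply: connect_trans yt tx.
    case/orP: th_face => /face_x; rewrite ?oh ?os !(inE, mem_cat).
      by case/predU1P=> [->|->]; rewrite ?eqxx ?orbT.
    by case/predU1P=> [->|->]; rewrite ?eqxx ?orbT.
  + by rewrite connect0 (rt_refl rtA).
  + by have [_ ->] := eulerU; split=> //; apply: trA st th.
- move=> p pT; have pE : @alpha uncut p = @alpha Q p.
    apply: alphaU; first by apply: contraNneq hT => <-.
    by apply: contraNneq hT => ps; have [_] := rt_edge rtA pT; rewrite ps /s inva.
  rewrite pE => app apr ph.
  (* An ancestor of [s] is one of [t], and an ancestor of [t] is one of [h]; so the edge [e] found
     for the head [t] is not the cut edge read from either half. *)
  have pt : ~~ A p t by apply: contra ph => pt; apply: trA pt th.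
  have [e [eN pe eap ape]] := ex_back exQ pT app apr pt.
  have eh : e != h by apply: contraNneq ph => eh; move: pe; rewrite eh.
  have es : e != s by apply: contraNneq pt => es; apply: trA st; rewrite -es.
  by exists e; rewrite uncut_leg (negPf eN) (negPf eh) (negPf es) alphaU.
- exact: ex_root_tree exQ.
- right; case: (ex_next exQ) => // tE.
  by case/negP: headN; rewrite tE (rt_sigmal rtA) (rt_refl rtA).
- by move=> hroot; case/negP: hr.
Qed.

End CutEdge.
End Cut.

Lemma filter_nil (T : eqType) (a : pred T) b : {in b, forall x, ~~ a x} -> filter a b = [::].
Proof. by move=> /hasPn; rewrite has_filter negbK => /eqP. Qed.

(** * Undoing a step c *)

Section UndoC.
Variables (i : nat) (Q : growing) (A : rel Q).
Hypothesis exQ : explored i A.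
Hypothesis headN : ~~ A (head Q) root.
Let t := head Q.
Hypothesis noleg_t : forall x, is_leg x -> A t x -> x = t.
Let rtA := ex_tree exQ.
Let trA := rt_trans rtA.
Let inva := ex_alpha exQ.
Let injs := ex_sigma exQ.
Let injf : injective (@face_next Q). Proof. exact: inj_comp injs (inv_inj inva). Qed.
Let leg_t : is_leg t. Proof. by case: (ex_legs exQ). Qed.
Let tt : A t t. Proof. exact: rt_refl rtA t. Qed.

(** The root, a leg of the head-face outside the subtree, forces an exit. The dart [h] is below [t]
    because it lies at the vertex where the preceding step of the tour arrives. *)
Lemma exit_split : exists z h u, [/\ orbit (@face_next Q) t = t :: z ++ h :: u,
  h = tour_exit A, {in z, forall y, A t (alpha y)}, A t h & ~~ A t (alpha h)].
Proof.
have [leg_root _ _] := ex_legs exQ.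
have : has (fun y => ~~ A t (alpha y)) (orbit (@face_next Q) t).
  apply/hasP; exists root; last by rewrite (eqP leg_root) headN.
  by rewrite -fconnect_orbit; case: (ex_face exQ leg_root).
move=> /split_first[pre [h [u [oE hP /hasPn preN]]]].
have [o otE] := orbit_cons (@face_next Q) t.
case: pre preN oE => [|t0 z] preN oE.
  by move: oE hP; rewrite otE => -[<- _]; rewrite (eqP leg_t) tt.
have t0E : t0 = t by move: oE; rewrite otE => -[].
rewrite {t0}t0E in oE preN.
have zP y : y \in t :: z -> A t (alpha y) by move/preN; rewrite negbK.
exists z, h, u; split=> //.
- by rewrite /tour_exit oE filter_cat (filter_nil preN) /= hP.
- by move=> y yz; apply: zP; rewrite inE yz orbT.
have cyc : fpath face_next t (rcons (z ++ h :: u) t).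
  by have := cycle_orbit injf t; rewrite oE.
move: cyc; rewrite rcons_cat cat_path /= => /and3P[_ /eqP <- _].
by rewrite /face_next (rt_sigmar rtA) zP ?mem_last.
Qed.

Lemma entry_split : exists u s z, [/\ orbit (@face_next Q) t = t :: u ++ s :: z,
  s = tour_entry A, {in z, forall y, A t y}, A t (alpha s) & ~~ A t s].
Proof.
have [leg_root _ _] := ex_legs exQ.
have : has (fun y => ~~ A t y) (orbit (@face_next Q) t).
  apply/hasP; exists root; last exact: headN.
  by rewrite -fconnect_orbit; case: (ex_face exQ leg_root).
move=> /split_last[pre [s [z [oE sP zN]]]].
have [o otE] := orbit_cons (@face_next Q) t.
case: pre oE => [|t0 u] oE.
  by move: oE sP; rewrite otE => -[<- _]; rewrite tt.
have t0E : t0 = t by move: oE; rewrite otE => -[].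
rewrite {t0}t0E in oE.
have zP y : y \in z -> A t y by move/(hasPn zN); rewrite negbK.
exists u, s, z; split=> //.
  rewrite /tour_entry oE -cat_rcons filter_cat filter_rcons sP.
  by rewrite (filter_nil (b := z)) ?cats0 ?last_rcons //; apply/hasPn.
have cyc : fpath face_next t (rcons (u ++ s :: z) t).
  by have := cycle_orbit injf t; rewrite oE.
move: cyc; rewrite rcons_cat cat_path /= => /and3P[_ _ pz].
rewrite -(rt_sigmar rtA) -/(face_next s).
case: z zP pz {oE zN} => [|y z] zP /= /andP[/eqP-> _] //.
by apply: zP; rewrite mem_head.
Qed.

(** Otherwise both would be halves of the parent edge [p], the only tree edge out of the subtree.
    The third dart [d] at the head-vertex, adjacent to both [t] and [p], would then have [d] and
    [alpha d] in the head-face, against [head_edge_two_faces]. *)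
Lemma exit_or_entry_external : (tour_exit A \notin gtree Q) || (tour_entry A \notin gtree Q).
Proof.
have [p [pT [pt tp] app tap pE]] := head_parent exQ headN.
have [orb3 sig3] := head_orbit3 exQ headN.
have us : uniq [:: t; sigma t; sigma (sigma t)] by rewrite -orb3 orbit_uniq.
have parent_exit y : y \in gtree Q -> A t y -> ~~ A t (alpha y) -> y = p.
  move=> yT ty tay; have /andP[yt ayy] := rt_exit rtA yT ty tay.
  by apply: (rt_uniq rtA) => //; [apply: trA yt tp | apply: trA pt ty].
have nonleg d : d != t -> A t d -> ~~ is_leg d.
  by move=> dt td; apply: contra dt => dL; apply/eqP; apply: noleg_t.
have two_faces d : d != t -> d != p -> A t d -> A d t ->
    ~~ fconnect face_next d (alpha d).
  move=> dt dp td dt'; apply: (head_edge_two_faces exQ headN) => //; first exact: nonleg.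
  apply: contra dp => /andP[dT add]; apply/eqP; apply: (rt_uniq rtA) => //.
    exact: trA dt' tp.
  exact: trA pt td.
have symf := fconnect_sym injf.
apply: contraT; rewrite negb_or !negbK => /andP[exT enT].
case/orP: pE => /eqP pE.
  have [u [s [z [oE sE zP tas ts]]]] := entry_split.
  rewrite -sE in enT; have [_ asT] := rt_edge rtA enT.
  have asE : alpha s = p by apply: parent_exit; rewrite ?inva.
  pose d := sigma p; have sd : sigma d = t by rewrite /d pE.
  have td : A t d by rewrite /d (rt_sigmar rtA).
  have dt : A d t by rewrite /d (rt_sigmal rtA).
  have d_t : d != t.
    by apply: contraTneq us => dE; rewrite -pE -/d dE /= !inE eqxx !orbT.
  have dp : d != p.
    apply: contraTneq us => dE; rewrite -pE -/d dE /= !inE eqxx.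
    by rewrite andbF.
  case/negP: (two_faces d d_t dp td dt).
  have ts_f : fconnect face_next t s by rewrite fconnect_orbit oE !(inE, mem_cat) eqxx !orbT.
  have td_f : fconnect face_next t d.
    by apply: connect_trans ts_f _; rewrite /d -asE; apply: fconnect1.
  rewrite symf; apply: connect_trans td_f.
  have -> : t = face_next (alpha d) by rewrite /face_next inva.
  exact: fconnect1.
have [z [h [u [oE hE zP th tah]]]] := exit_split.
rewrite -hE in exT; have hp : h = p by apply: parent_exit.
pose d := sigma t; have sd : sigma d = p by rewrite /d pE.
have td : A t d by rewrite /d (rt_sigmar rtA).
have dt : A d t by rewrite /d (rt_sigmal rtA).
have d_t : d != t.
  by apply: contraTneq us => dE; rewrite -/d dE /= !inE eqxx.
have dp : d != p.
  apply: contraTneq us => dE; rewrite -pE -/d dE /= !inE eqxx.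
  by rewrite andbF.
case/negP: (two_faces d d_t dp td dt).
have th_f : fconnect face_next t h by rewrite fconnect_orbit oE !(inE, mem_cat) eqxx !orbT.
have td_f : fconnect face_next t d by rewrite /d -(head_leg_face exQ); apply: fconnect1.
apply: connect_trans (_ : fconnect face_next d t) _; first by rewrite symf.
apply: connect_trans th_f _; rewrite symf hp.
have -> : p = face_next (alpha d) by rewrite /face_next inva.
exact: fconnect1.
Qed.

Section UndoAt.
Variable h : Q.
Let s := alpha h.
Hypotheses (hT : h \notin gtree Q) (th : A t h) (ts : ~~ A t s).

Lemma cut_nonleg : ~~ is_leg h.
Proof. by apply: contra ts => /eqP hE; rewrite /s hE. Qed.

(** An edge from the subtree of [t] to the outside joins comparable vertices, so it can only lead to
    a strict ancestor of [t]. *)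
Lemma cut_below : A s t.
Proof.
have := ex_mono exQ cut_nonleg; rewrite -/s.
have [hs|_] /= := boolP (A h s); first by case/negP: ts; apply: trA th hs.
by move=> sh; have := rt_chain rtA sh th; rewrite (negPf ts) orbF.
Qed.

Let hN := cut_nonleg.
Let st := cut_below.

Lemma cut_legN x : x != h -> x != s -> ~~ @is_leg Q x -> ~~ @is_leg (uncut h) x.
Proof. by move=> xh xs xN; rewrite uncut_leg !negb_or xN xh xs. Qed.

Lemma phi_c_uncut m : fconnect (@face_next Q) t h || fconnect (@face_next Q) t s ->
    tour_legs (uncut h) = s :: rcons m t \/ tour_legs (uncut h) = t :: rcons m s ->
  exists (P : growing) (B : rel P) (Q' : growing) (f : Q' -> Q),
    [/\ explored i B, phi_c P = Some Q', giso f, nonlegs P < nonlegs Q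
      & exists x m y, [/\ tour_legs P = x :: rcons m y, x != root & y != root]].
Proof.
move=> th_face tE; have exP := explored_uncut exQ headN hN hT th st th_face.
have [leg_root _ troot] := ex_legs exQ.
have sroot : s != root.
  apply: contraNneq hN => sE.
  by rewrite (_ : h = root) // -(inva h) -/s sE (eqP leg_root).
exists (uncut h), A, (@glue_head (uncut h) s t), id; split=> //.
- have rtP := ex_tree exP; have invP := ex_alpha exP.
  have ancE x y : `[< @ancestor (uncut h) (gtree Q) x y >] = A x y.
    by apply/asboolP/idP => /(ancestorE invP rtP).
  rewrite /phi_c; case: tE => ->; rewrite last_rcons (rt_vertex_eq rtP) !ancE.
    by rewrite (negPf ts) andbF st.
  by rewrite (negPf ts) st.
- exact: glue_uncut exQ h.
- by rewrite [X in _ < X](card_cut_fun inva hN) -[nonlegs _]/#|_| addn2.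
- by case: tE => ->; [exists s, m, t | exists t, m, s].
Qed.

End UndoAt.

(* The last part ensures that the legs consumed by [phi_c] are a left one and a
   right one. *)
Lemma undo_c : exists (P : growing) (B : rel P) (Q' : growing) (f : Q' -> Q),
  [/\ explored i B, phi_c P = Some Q', giso f, nonlegs P < nonlegs Q
    & exists x m y, [/\ tour_legs P = x :: rcons m y, x != root & y != root]].
Proof.
have faceL x : is_leg x -> x \in orbit (@face_next Q) t.
  by move=> xL; rewrite -fconnect_orbit; case: (ex_face exQ xL).
have legt_U h : @is_leg (uncut h) t by rewrite uncut_leg leg_t.
case/orP: exit_or_entry_external.
  have [z [h [u [oE <- zP th ts]]]] := exit_split => hT.
  have hN := cut_nonleg th ts; have st := cut_below th ts.
  have [a [b [oU oh os]]] := uncut_orbit exQ hN hT.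
  have bE : b = u ++ t :: z by have := orbit_rot injf oE; rewrite oh => -[].
  have := orbit_uniq (@face_next (uncut h)) h; rewrite oU => us.
  have uts := orbit_uniq (@face_next Q) t; rewrite oE in uts.
  (* All legs of [Q] are in its head-face, made up of [h] and [b]; the other face, of [s] and [a],
     has none. *)
  have aN : {in a, forall x, ~~ @is_leg (uncut h) x}.
    move=> x xa; move: us; rewrite /= mem_cat negb_or cat_uniq /= negb_or.
    case/andP=> /andP[ha hb] /and3P[_ /andP[sa /hasPn ab] _].
    apply: cut_legN; [by apply: contraNneq ha => <- | by apply: contraNneq sa => <- |].
    apply/negP => /faceL; rewrite oE => xo.
    have : x \in h :: b.
      rewrite bE; move: xo; rewrite !(inE, mem_cat).
      by case: (x == h); case: (x \in u); case: (x == t); case: (x \in z).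
    rewrite inE => /predU1P[xh|/ab]; last by rewrite /= xa.
    by rewrite xh (negPf ha) in xa.
  (* A leg in [z] would be below [t], hence equal to [t] by [noleg_t]. *)
  have zN : {in z, forall x, ~~ @is_leg (uncut h) x}.
    move=> x xz; have xb : x \in b by rewrite bE mem_cat inE xz !orbT.
    move: us; rewrite /= mem_cat inE !negb_or cat_uniq /= => /andP[/and3P[_ _ hb] /and4P[_ _ sb _]].
    apply: cut_legN; [by apply: contraNneq hb => <- | by apply: contraNneq sb => <- |].
    apply/negP => xL; have xt : x = t by apply: noleg_t => //; have := zP x xz; rewrite (eqP xL).
    by move: uts; rewrite /= mem_cat -xt xz.
  apply: (phi_c_uncut hT th ts (m := [seq x <- u | @is_leg (uncut h) x])).
    by rewrite fconnect_orbit oE !(inE, mem_cat) eqxx !orbT.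
  left; rewrite /tour_legs oU /= bE filter_cat (filter_nil aN) /= uncut_leg eqxx !orbT.
  by rewrite filter_cat /= legt_U (filter_nil zN) cats1.
have [u [s [z [oE <- zP th ts]]]] := entry_split => sT.
have hT : alpha s \notin gtree Q.
  by apply: contra sT => /(rt_edge rtA)[_]; rewrite inva.
move: (alpha s) (inva s) th hT => h sE th hT; rewrite -{s}sE in oE zP ts sT.
have hN := cut_nonleg th ts; have st := cut_below th ts.
have [a [b [oU oh os]]] := uncut_orbit exQ hN hT.
have aE : a = z ++ t :: u by have := orbit_rot injf oE; rewrite os => -[].
have := orbit_uniq (@face_next (uncut h)) h; rewrite oU => us.
have uts := orbit_uniq (@face_next Q) t; rewrite oE in uts.
move: us; rewrite /= mem_cat inE !negb_or cat_uniq /= negb_or.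
case/andP=> /and3P[ha hs hb] /and3P[_ /andP[sa /hasPn ab] /andP[sb _]].
have bN : {in b, forall x, ~~ @is_leg (uncut h) x}.
  move=> x xb; apply: cut_legN; [by apply: contraNneq hb => <- | by apply: contraNneq sb => <- |].
  apply/negP => /faceL; rewrite oE => xo.
  have : x \in alpha h :: a.
    rewrite aE; move: xo; rewrite !(inE, mem_cat).
    by case: (x == alpha h); case: (x \in u); case: (x == t); case: (x \in z).
  rewrite inE => /predU1P[xs|xa]; last by have := ab x xb; rewrite /= xa.
  by rewrite xs (negPf sb) in xb.
have zN : {in z, forall x, ~~ @is_leg (uncut h) x}.
  move=> x xz; have xa : x \in a by rewrite aE mem_cat xz.
  apply: cut_legN; [by apply: contraNneq ha => <- | by apply: contraNneq sa => <- |].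
  apply/negP => xL; have xt : x = t by apply: noleg_t => //; apply: zP.
  by move: uts; rewrite /= mem_cat inE -xt xz !orbT.
apply: (phi_c_uncut hT th ts (m := [seq x <- u | @is_leg (uncut h) x])).
  by rewrite [X in _ || X]fconnect_orbit oE !(inE, mem_cat) eqxx !orbT.
right; rewrite /tour_legs oU /= filter_cat aE filter_cat (filter_nil zN) /=.
by rewrite legt_U uncut_leg eqxx !orbT (filter_nil bN) cats1.
Qed.

End UndoC.

Section GIsoCount.
Variables (P Q : growing) (f : P -> Q).
Hypothesis isof : giso f.

Lemma gi_nonlegs : nonlegs P = nonlegs Q.
Proof.
rewrite /nonlegs -(card_image (gi_inj isof)); apply: eq_card => y.
have [g fg gf] := gi_bij isof; rewrite inE; apply/imageP/idP => [[x xN ->]|yN].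
  by rewrite (gi_leg isof).
by exists (g y); rewrite ?gf // inE -(gi_leg isof) gf.
Qed.

Lemma gi_euler : euler P <-> euler Q.
Proof.
rewrite /euler gi_nonlegs (norb_iso (gi_bij isof) (gi_sigma isof)).
by rewrite (norb_iso (gi_bij isof) (gi_face isof)).
Qed.

Lemma gi_vertex x : vertex (f x) = f @: vertex x.
Proof. exact: (orbit_set_morph (gi_inj isof) (gi_sigma isof)). Qed.

Lemma gi_near_cubic k : near_cubic P k <-> near_cubic Q k.
Proof.
have degE x : degree (f x) = degree x.
  by rewrite /degree gi_vertex (card_imset _ (gi_inj isof)).
have vertE x : (vertex (f x) == vertex (root : Q)) = (vertex x == vertex root).
  by rewrite -(gi_root isof) !gi_vertex (inj_eq (imset_inj (gi_inj isof))).
have [g fg gf] := gi_bij isof.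
split=> -[kr k3]; split.
- by rewrite -(gi_root isof) degE.
- by move=> d; rewrite -[d]gf vertE degE; apply: k3.
- by rewrite -degE (gi_root isof).
- by move=> d; rewrite -vertE -degE; apply: k3.
Qed.

End GIsoCount.

(** * Undoing a step a or b *)

Section UndoGrow.
Variables (i : nat) (Q : growing) (A : rel Q).
Hypothesis exQ : explored i A.
Hypothesis headN : ~~ A (head Q) root.
Let t := head Q.
Variables l p : Q.
Hypotheses (leg_l : is_leg l) (tl : A t l) (lt : l != t).
Hypotheses (pT : p \in gtree Q) (pt : A p t) (tp : A t p) (app : A (alpha p) p).
Hypothesis vertexE : (p == sigma t) || (p == sigma (sigma t)).
Let rtA := ex_tree exQ.
Let trA := rt_trans rtA.
Let inva := ex_alpha exQ.
Let injs := ex_sigma exQ.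
Let leg_t : is_leg t. Proof. by case: (ex_legs exQ). Qed.
Let pN : ~~ is_leg p. Proof. by case: (rt_edge rtA pT). Qed.
Let lp : l != p. Proof. by apply: contraNneq pN => <-. Qed.
Let ptN : p != t. Proof. by apply: contraNneq pN => ->. Qed.

Definition undo_left := l == sigma t.

Let vertex_t : if undo_left then [/\ sigma t = l, sigma l = p & sigma p = t]
  else [/\ sigma t = p, sigma p = l & sigma l = t].
Proof.
have [orb3 sig3] := head_orbit3 exQ headN.
have : fconnect sigma t l by rewrite (rt_vertex rtA) tl; case: (ex_face exQ leg_l).
rewrite fconnect_orbit orb3 !inE (negPf lt) /= /undo_left => lE.
have [l1|l1] := boolP (l == sigma t).
  have pE : p = sigma (sigma t).
    by case/orP: vertexE => /eqP // pE; case/eqP: lp; rewrite pE; apply/eqP.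
  by rewrite pE (eqP l1) sig3.
rewrite (negPf l1) /= in lE; have pE : p = sigma t.
  by case/orP: vertexE => /eqP // pE; case/eqP: lp; rewrite pE; apply/eqP.
by rewrite pE (eqP lE) sig3.
Qed.

Let at_t x : fconnect sigma t x = [|| x == t, x == l | x == p].
Proof.
have [orb3 _] := head_orbit3 exQ headN.
rewrite fconnect_orbit orb3 !inE; move: vertex_t.
by case: ifP => _ [-> ->] // _; rewrite ![(x == p) || _]orbC.
Qed.

Definition sub_dart : finType := {x : Q | ~~ fconnect (@sigma Q) t x}.

Definition sub_sigma (d : sub_dart) : sub_dart := insubd d (sigma (val d)).
(** The default of [insubd] matters: the partner [p] of [alpha p] is removed, so [alpha p] is sent
    to itself and becomes a leg, the head before the step. *)
Definition sub_alpha (d : sub_dart) : sub_dart := insubd d (alpha (val d)).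

Let subP (d : sub_dart) : ~~ fconnect (@sigma Q) t (val d) := valP d.

Let root_sub : ~~ fconnect (@sigma Q) t root.
Proof. by rewrite (rt_vertex rtA) (negPf headN). Qed.

Let pap : ~~ A p (alpha p).
Proof. by have := rt_mono rtA pT; rewrite app addbT. Qed.

Let head_sub : ~~ fconnect (@sigma Q) t (alpha p).
Proof.
rewrite (rt_vertex rtA) negb_and; apply/orP; left; apply: contra pap; exact: trA.
Qed.

Definition sub_head : sub_dart := Sub (alpha p) head_sub.

Definition ungrown : growing :=
  @Growing (@RMap sub_dart sub_sigma sub_alpha (Sub root root_sub)) sub_head
    [set d : sub_dart | (val d \in gtree Q) && (d != sub_head)].

Let val_sigma (d : ungrown) : val (sigma d) = sigma (val d) :> Q.
Proof.
rewrite /= val_insubd ifT // -(same_fconnect1_r injs); exact: (subP d).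
Qed.

Let val_alpha (d : ungrown) : d != sub_head -> val (alpha d) = alpha (val d) :> Q.
Proof.
move=> dh; rewrite /= val_insubd ifT // at_t !(inv_eq inva) (eqP leg_t) (eqP leg_l).
have := subP d; rewrite at_t !negb_or => /and3P[-> -> _] /=.
by rewrite -(inj_eq val_inj) in dh.
Qed.

Let alpha_head : alpha (head ungrown) = head ungrown.
Proof.
by apply: val_inj; rewrite /= val_insubd /= inva at_t eqxx !orbT.
Qed.

Definition regrow (x : grow undo_left ungrown) : Q :=
  match x with
  | Some (inl d) => val (d : sub_dart)
  | Some (inr true) => t
  | Some (inr false) => l
  | None => p
  end.

Lemma giso_regrow : giso regrow.
Proof.
pose g (x : Q) : grow undo_left ungrown :=
  if insub x is Some d then @old_dart ungrown d
  else if x == t then new_head ungrown else if x == l then new_leg ungrown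
  else back_dart ungrown.
have insubN x : fconnect (@sigma Q) t x ->
    @insub Q (fun x => ~~ fconnect (@sigma Q) t x) sub_dart x = None.
  by move=> tx; rewrite insubN // negbK.
split.
- exists g.
    move=> [[d|[]]|] /=; rewrite /g.
    + by rewrite valK.
    + by rewrite insubN ?eqxx.
    + by rewrite insubN ?(negPf lt) ?eqxx // at_t eqxx orbT.
    + by rewrite insubN ?(negPf ptN) 1?eq_sym ?(negPf lp) // at_t eqxx !orbT.
  move=> x; rewrite /g; case: insubP => [d _ //|].
  rewrite negbK at_t; case: eqVneq => [->//|_].
  by case: eqVneq => [->//|_] /= /eqP->.
- move: vertex_t => vt [[d|[]]|]; first exact: val_sigma.
  + rewrite -[Some _]/(new_head ungrown) grow_sigma_head; move: vt.
    by case: (undo_left) => -[].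
  + rewrite -[Some _]/(new_leg ungrown) grow_sigma_leg; move: vt.
    by case: (undo_left) => -[].
  + rewrite -[None]/(back_dart ungrown) grow_sigma_back; move: vt.
    by case: (undo_left) => -[].
- move=> [[d|[]]|] /=; rewrite ?(eqP leg_t) ?(eqP leg_l) //.
  have [->|dh] := eqVneq d sub_head; first by rewrite /= inva.
  exact: val_alpha.
- by [].
- by [].
- move=> [[d|b]|]; rewrite ?grow_tree_new ?grow_tree_back //=.
  + rewrite (grow_tree_old undo_left (d : ungrown)) inE.
    have [->|dh] := eqVneq (d : ungrown) sub_head; last by rewrite orbF andbT.
    by rewrite orbT /=; case: (rt_edge rtA pT).
  + by apply/negbTE/negP => /(rt_edge rtA)[]; case: b; rewrite ?leg_t ?leg_l.
Qed.

Let A' : rel ungrown := fun x y => A (val x) (val y).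

(** Of the darts at the head-vertex, [t] and [l] are legs and [p] goes up, so no tree edge goes down
    from it. *)
Let leaf : forall x, A t x -> fconnect (@sigma Q) t x.
Proof.
elim/(rt_ind rtA) => [x xr|x q xN qT xq qx aqq qaq qP IH] tx.
  by case/negP: headN; apply: trA tx xr.
rewrite (rt_vertex rtA) tx; have := qP _ tx; case/orP=> [//|/IH].
have [qN aqT] := rt_edge rtA qT; have [aqN _] := rt_edge rtA aqT.
rewrite at_t => /or3P[/eqP E|/eqP E|/eqP E].
- by rewrite E leg_t in aqN.
- by rewrite E leg_l in aqN.
by case/negP: pap; rewrite -E inva aqq.
Qed.

Let subA (d : ungrown) : ~~ A t (val d).
Proof. by apply: contra (subP d); apply: leaf. Qed.

Let legU (d : ungrown) : is_leg d = is_leg (val d) || (d == sub_head).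
Proof.
rewrite /is_leg; have [->|dh] := eqVneq d sub_head; first by rewrite alpha_head eqxx orbT.
by rewrite orbF -(inj_eq val_inj) val_alpha.
Qed.

Let treeU (d : ungrown) : d \in gtree ungrown -> [/\ val d \in gtree Q, d != sub_head &
  val (alpha d) = alpha (val d) :> Q].
Proof. by rewrite inE => /andP[dT dh]; split=> //; apply: val_alpha. Qed.

Let sub_of (x : Q) : ~~ A t x -> exists d : ungrown, val d = x.
Proof.
move=> tx; have xP : ~~ fconnect (@sigma Q) t x by rewrite (rt_vertex rtA) (negPf tx).
by exists (Sub x xP).
Qed.

Let injsU : injective (@sigma ungrown).
Proof. by move=> x y /(congr1 val); rewrite !val_sigma => /injs/val_inj. Qed.

Let invaU : involutive (@alpha ungrown).
Proof.
move=> d; have [->|dh] := eqVneq d sub_head; first by rewrite !alpha_head.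
apply: val_inj; have adh : alpha d != sub_head.
  rewrite -(inj_eq val_inj) val_alpha // (inj_eq (inv_inj inva)).
  by apply: contraNneq (subP d) => ->; rewrite at_t eqxx !orbT.
by rewrite !val_alpha.
Qed.

Let leg_headU : is_leg (head ungrown). Proof. by rewrite legU eqxx orbT. Qed.

Let p_below x : A x t -> ~~ fconnect (@sigma Q) t x -> A x (alpha p).
Proof.
move=> xt; rewrite (rt_vertex rtA) xt andbT => tx.
have := rt_parentE rtA pT app pt tp xt.
by rewrite (negPf tx).
Qed.

Let rtU : rooted_tree (gtree ungrown) A'.
Proof.
split.
- move=> x y; rewrite -(rt_vertex rtA).
  by rewrite (fconnect_morph val_inj val_sigma).
- by move=> y x z; apply: trA.
- by move=> x; apply: (rt_root rtA).
- move=> x xT; have [vT vh vE] := treeU xT; have [vN avT] := rt_edge rtA vT.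
  rewrite legU negb_or vN vh inE vE avT; split=> //=.
  rewrite -(inj_eq val_inj) vE /= (inj_eq (inv_inj inva)).
  by apply: contraNneq (subP x) => xE; rewrite at_t; apply/or3P/Or33/eqP.
- by move=> x xT; have [vT vh vE] := treeU xT; rewrite /A' vE; apply: (rt_mono rtA).
- move=> x xr; have [q [qT [xq qx] aqq qP]] := rt_parent rtA xr.
  have [d dE] := sub_of (x := q) ltac:(by apply: contra (subA x) => tq; apply: trA tq qx).
  have dh : d != sub_head.
    rewrite -(inj_eq val_inj) dE /=; apply: contraNneq pap => qE.
    by move: aqq; rewrite qE inva.
  exists d; rewrite inE dE qT dh /A' dE val_alpha // dE; split=> // z.
  exact: qP.
- move=> q r /treeU[qT qh qE] /treeU[rT rh rE] qr rq; rewrite /A' qE rE => aqq arr.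
  by apply: val_inj; apply: (rt_uniq rtA).
Qed.

Lemma explored_ungrown : explored i A'.
Proof.
have [leg_root _ _] := ex_legs exQ; split.
- exact: injsU.
- exact: invaU.
(* [regrow] identifies the regrown map with [Q]; Euler's formula then passes to the smaller map by
   [grow_euler]. *)
- apply/(grow_euler undo_left injsU invaU leg_headU)/(gi_euler giso_regrow).
  exact: ex_euler exQ.
- apply/(grow_near_cubic undo_left injsU)/(gi_near_cubic giso_regrow).
  exact: ex_cubic exQ.
- exact: rtU.
- move=> x; rewrite legU negb_or => /andP[xN xh].
  by rewrite /A' val_alpha //; apply: (ex_mono exQ).
- rewrite !legU eqxx orbT /= leg_root; split=> //.
  rewrite -(inj_eq val_inj) /=; apply: contraNneq pN => E.
  have pr : p = root by rewrite -(inva p) E; apply/eqP.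
  by rewrite pr.
- move=> x xL; split.
    have [o oE] := orbit_cons (@face_next ungrown) (head ungrown).
    have xL' := xL; rewrite legU in xL'; case/orP: xL' => [vL|/eqP->]; last exact: connect0.
    have [xh|xh] := eqVneq x (head ungrown); first by rewrite xh connect0.
    have [+ _] := ex_face exQ vL.
    rewrite fconnect_orbit -(gi_head giso_regrow) (gi_orbit giso_regrow).
    rewrite (orbit_grow undo_left injsU invaU leg_headU oE).
    have -> : val x = regrow (@old_dart ungrown x) by [].
    rewrite (mem_map (gi_inj giso_regrow)) /grow_tour.
    have memo : (@old_dart ungrown x \in
        rcons (map (@old_dart ungrown) o) (@old_dart ungrown (head ungrown))) = (x \in o).
      rewrite mem_rcons inE (mem_map (@old_inj true ungrown)) (inj_eq (@old_inj true ungrown)).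
      by rewrite (negPf xh).
    rewrite fconnect_orbit oE inE; move: (rcons _ _) memo => b memo.
    by case: (undo_left); rewrite !(inE, mem_rcons) /= memo => ->; rewrite orbT.
  rewrite legU in xL; case/orP: xL => [vL|/eqP->]; last exact: rt_refl rtA _.
  by apply: p_below (subP x); case: (ex_face exQ vL).
- move=> q /treeU[qT qh qE]; rewrite /A' qE => aqq aqr qhead.
  have qt : ~~ A (val q) t.
    by apply: contra qhead => qt; apply: p_below qt (subP q).
  have [e [eN qe eaq aqe]] := ex_back exQ qT aqq aqr qt.
  (* The dart [e] is kept: at the removed vertex it would make [q] an ancestor of the head. *)
  have te : ~~ A t e.
    apply: contra qt => /leaf; rewrite (rt_vertex rtA) => /andP[_ et].
    exact: trA qe et.
  have [d dE] := sub_of te.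
  have dh : d != sub_head.
    rewrite -(inj_eq val_inj) dE /=; apply: contraNneq qhead => eE.
    by rewrite /= -eE.
  by exists d; rewrite legU negb_or dE eN dh val_alpha // dE.
- move=> x /treeU[xT _ _] xr; apply: val_inj; rewrite val_sigma.
  exact: ex_root_tree exQ _ xT xr.
- case: (ex_next exQ) => [tE|sT].
    by case/negP: headN; rewrite tE (rt_sigmal rtA) (rt_refl rtA).
  (* If the tree edge following the root is the one removed, its remaining half is the new head. *)
  have [E|neq] := eqVneq (sigma (root : ungrown)) sub_head; first by left.
  by right; rewrite inE neq val_sigma sT.
- rewrite /A' /= => apr; apply: val_inj; rewrite val_sigma /=.
  by apply: (ex_root_tree exQ) => //; case: (rt_edge rtA pT).
Qed.

Lemma undo_grow_at : exists (b : bool) (P : growing) (B : rel P) (f : grow b P -> Q),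
  [/\ explored i B, giso f & nonlegs P < nonlegs Q].
Proof.
exists undo_left, ungrown, A', regrow; split.
- exact: explored_ungrown.
- exact: giso_regrow.
- by rewrite -(gi_nonlegs giso_regrow) (grow_nonlegs undo_left leg_headU) addn2.
Qed.

End UndoGrow.

(** The dart following the root is the head, a leg, and no other dart at the root-vertex can be in
    the tree. So every dart is at the root-vertex, and by [ex_mono] all are legs. *)
Lemma explored_base (i : nat) (Q : growing) (A : rel Q) :
  explored i A -> A (head Q) root -> exists f : initial_map i -> Q, giso f.
Proof.
move=> exQ hroot; have rtA := ex_tree exQ; have trA := rt_trans rtA.
have injs := ex_sigma exQ; have hE := ex_head_root exQ hroot.
have [leg_root leg_head hr] := ex_legs exQ.
have hT : head Q \notin gtree Q.
  by apply/negP => /(rt_edge rtA)[]; rewrite leg_head.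
have allroot : forall x, A x root.
  elim/(rt_ind rtA) => // x p xN pT xp px app pap pP IH.
  have [_ apT] := rt_edge rtA pT.
  by case/negP: hT; rewrite hE -(ex_root_tree exQ apT IH).
have allA x y : A x y by apply: trA (allroot x) (rt_root rtA y).
have legs (x : Q) : is_leg x.
  by apply: contraT => xN; have := ex_mono exQ xN; rewrite !allA.
have orderE : fingraph.order (@sigma Q) (head Q) = i.+2.
  have [<- _] : degree (root : Q) = i.+2 /\ True.
    by have [-> _] := ex_cubic exQ; rewrite addn2.
  by apply: eq_card => x; rewrite [RHS]inE [LHS](rt_vertex rtA) (rt_vertex rtA) !allA.
(* The root immediately precedes the head around the vertex, so it is the iterate of order [i + 1],
   as in [initial_map]. *)
pose f (k : initial_map i) : Q := iter (k : 'I_i.+2) sigma (head Q).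
have injf : injective f.
  move=> j k jk; apply: ord_inj.
  by rewrite -(findex_iter (f := @sigma Q) (x := head Q) (i := j)) ?orderE //
             -/(f j) jk findex_iter ?orderE.
have iter_i2 : iter i.+2 sigma (head Q) = head Q by rewrite -orderE iter_order.
exists f; split.
- apply: inj_card_bij => //; rewrite card_ord -orderE /fingraph.order.
  apply: subset_leq_card; apply/subsetP => x _.
  by rewrite inE [X in is_true X](rt_vertex rtA) !allA.
- move=> k; rewrite /f -iterS /=.
  have [lt|ge] := ltnP k.+1 i.+2; first by rewrite modn_small.
  have kE : k.+1 = i.+2 by apply/eqP; rewrite eqn_leq ge ltn_ord.
  by rewrite kE modnn -iterS kE iter_i2.
- by move=> k; rewrite (eqP (legs (f k))).
- by apply: injs; rewrite -hE -iter_i2.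
- by [].
- move=> x; rewrite inE; apply/negbTE/negP => /(rt_edge rtA)[].
  by rewrite legs.
Qed.

Lemma giso_glue (P Q : growing) (f : P -> Q) (s t : P) :
  giso f -> giso (f : glue_head s t -> glue_head (f s) (f t)).
Proof.
move=> isof; split=> //.
- exact: gi_bij isof.
- exact: gi_sigma isof.
- move=> x; rewrite /= /glue_alpha -(gi_head isof) !(inj_eq (gi_inj isof)).
  by case: ifP => // _; case: ifP => // _; apply: gi_alpha.
- exact: gi_root isof.
- exact: gi_tree isof.
Qed.

Lemma gi_tour_legs (P Q : growing) (f : P -> Q) :
  giso f -> tour_legs Q = map f (tour_legs P).
Proof.
move=> isof; rewrite /tour_legs -(gi_head isof) (gi_orbit isof) behead_map filter_map.
by congr map; apply: eq_filter => x; rewrite /= (gi_leg isof).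
Qed.

Lemma giso_phi_c (i : nat) (P Q P1 : growing) (A : rel P) (B : rel Q) (f : P -> Q) :
    explored i A -> explored i B -> giso f -> phi_c P = Some P1 ->
  exists (Q1 : growing) (g : P1 -> Q1), phi_c Q = Some Q1 /\ giso g.
Proof.
move=> exP exQ isof; have rtP := ex_tree exP; have rtQ := ex_tree exQ.
have fA := gi_anc isof (ex_alpha exP) rtP rtQ.
have ancP x y : `[< ancestor (gtree P) x y >] = A x y.
  by apply/asboolP/idP => /(ancestorE (ex_alpha exP) rtP).
have ancQ x y : `[< ancestor (gtree Q) x y >] = B x y.
  by apply/asboolP/idP => /(ancestorE (ex_alpha exQ) rtQ).
rewrite /phi_c (gi_tour_legs isof); case: tour_legs => //= x ls.
rewrite last_map (rt_vertex_eq rtP) (rt_vertex_eq rtQ) !ancP !ancQ !fA.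
case: ifP => // _; case: ifP => _.
  by case=> <-; exists (glue_head (f x) (f (last x ls))), f; split=> //; apply: giso_glue.
case: ifP => // _ [<-]; exists (glue_head (f (last x ls)) (f x)), f.
by split=> //; apply: giso_glue.
Qed.

(** Induction on [nonlegs]: a step is undone, the smaller map is isomorphic to one built from a
    word, and the step is replayed on that model. *)
Lemma reach_all (i n : nat) (Q : growing) (A : rel Q) :
    explored i A -> nonlegs Q = n ->
  exists (w : seq letter) (P : growing) (B : rel P) (s1 s2 : seq P) (f : P -> Q),
    [/\ walk_ok i w, reach i w B s1 s2 & giso f].
Proof.
elim/ltn_ind: n => n IHn in Q A * => exQ nE.
have [hroot|hN] := boolP (A (head Q) root).
  have [f isof] := explored_base exQ hroot; have [s1 r] := reach_nil i.
  by exists [::], (initial_map i), (fun _ _ => true), s1, [::], f.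
(* The stack heights recorded by [reach] are natural numbers, which gives the two bounds of
   [walk_ok]. *)
have ok_cons x w (P : growing) (B : rel P) s1 s2 :
    walk_ok i w -> reach i (x :: w) B s1 s2 -> walk_ok i (x :: w).
  move=> ok r; rewrite /walk_ok -/walk_ok ok /=.
  by have /= := rc_left r; have /= := rc_right r; move=> e1 e2; apply/andP; split; lia.
(* A second leg at or below the head-vertex reveals a step a or b; otherwise a step c is undone. *)
case: (pickP [pred l | [&& is_leg l, A (head Q) l & l != head Q]]) => [l /and3P[lL tl lt]|noleg].
  have [p [pT [pt tp] app _ pE]] := head_parent exQ hN.
  have [b [P [B [f [exP isof lt_n]]]]] := undo_grow_at exQ hN lL tl lt pT pt tp app pE.
  rewrite nE in lt_n; have [w [P0 [B0 [s1 [s2 [g [ok r isog]]]]]]] := IHn _ lt_n P B exP erefl.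
  have [g' isog'] := giso_grow b isog; have r' := reach_grow b r.
  exists ((if b then La else Lb) :: w), (grow b P0), (grow_anc B0), (grow_left b s1),
    (grow_right b s2), (f \o g'); split=> //; first exact: ok_cons ok r'.
  exact: giso_comp isog' isof.
have noleg' x : is_leg x -> A (head Q) x -> x = head Q.
  by move=> xL tx; apply/eqP; have := noleg x; rewrite /= xL tx /= => /negbFE.
have [P [B [Q' [f [exP phiE isof lt_n [x [m [y [tE xr yr]]]]]]]]] := undo_c exQ hN noleg'.
rewrite nE in lt_n; have [w [P0 [B0 [s1 [s2 [g [ok r isog]]]]]]] := IHn _ lt_n P B exP erefl.
have ex0 := rc_explored r; have ord0 := rc_ordered r.
have tE0 : tour_legs P0 = filter (@is_leg P0) s1 ++ root :: filter (@is_leg P0) s2.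
  rewrite /tour_legs (or_tour ord0) /= filter_cat /=.
  by have [-> _ _] := ex_legs ex0.
have mE := gi_tour_legs isog; rewrite tE tE0 map_cat /= (gi_root isog) in mE.
(* With an empty left stack the root would come first among the legs of the tour. *)
have h1 : has (@is_leg P0) s1.
  by rewrite has_filter; apply: contraNneq xr => s0; move: mE; rewrite s0 /= => -[->].
have h2 : has (@is_leg P0) s2.
  rewrite has_filter; apply: contraNneq yr => s0; move: mE; rewrite s0 /= cats1.
  by rewrite -rcons_cons => /rcons_inj[_ ->].
have [s [t [s1' [s2' [phi0 st sL tL stA]]]]] := phi_c_step ex0 ord0 h1 h2.
have r' := reach_c r phi0 st sL tL stA.
have [Q1 [g' [phi1 isog']]] := giso_phi_c ex0 exP isog phi0.
move: phi1; rewrite phiE => -[E]; subst Q1.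
exists (Lc :: w), (glue_head s t), B0, s1', s2', (f \o g'); split=> //.
  exact: ok_cons ok r'.
exact: giso_comp isog' isof.
Qed.

(** Non-separability in the form used below: the edges satisfying [B] and the others may not meet at
    the vertex of [c] alone. *)
Lemma separates (M : rmap) (B : pred M) (c x y : M) :
    injective (@sigma M) -> involutive (@alpha M) -> (forall d : M, ~~ is_leg d) ->
    nonseparable M -> (forall d, B (alpha d) = B d) ->
    B x -> ~~ B y -> fconnect sigma c x -> fconnect sigma c y ->
    (forall u v, B u -> ~~ B v -> fconnect sigma u v -> fconnect sigma c u) ->
  False.
Proof.
move=> injs inva noleg nonsep B_a Bx By cx cy shared.
have symf := fconnect_sym injs.
have e1 : edge_set [set d | B d] by move=> d; rewrite !inE B_a.
have e2 : edge_set [set d | ~~ B d] by move=> d; rewrite !inE B_a.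
have n1 : [set d | B d] != set0 by apply/set0Pn; exists x; rewrite inE.
have n2 : [set d | ~~ B d] != set0 by apply/set0Pn; exists y; rewrite inE.
have dis : [disjoint [set d | B d] & [set d | ~~ B d]].
  by apply/pred0P => d; rewrite /= !inE andbN.
have cov : [set d | B d] :|: [set d | ~~ B d] = [set d | ~~ is_leg d].
  by apply/setP=> d; rewrite !inE noleg orbN.
case/negP: (nonsep _ _ e1 e2 n1 n2 dis cov).
apply/cards1P; exists (vertex c); apply/setP=> V; rewrite !inE; apply/idP/eqP.
  case/and3P=> /imsetP[d _ ->] /set0Pn[u] /[!inE]/andP[du Bu] /set0Pn[v] /[!inE]/andP[dv Bv].
  apply/(vertexP injs); have cu := shared u v Bu Bv.
  rewrite symf; apply: (connect_trans (y := u)); last by rewrite symf.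
  by apply: cu; apply: connect_trans dv; rewrite symf.
move=> ->; rewrite imset_f //=; apply/andP; split; apply/set0Pn.
  by exists x; rewrite !inE cx.
by exists y; rewrite !inE cy.
Qed.

(** * Opening a map along its root-edge *)

Section Open.
Variables (i n : nat) (N : marked_map) (A : rel N).
Hypothesis target : near_cubic_depth_map i n N.
Hypothesis rtA : rooted_tree (mtree N) A.
Let trA := rt_trans rtA.
Let T := mtree N.

Let planar : planar_map N. Proof. by case: target. Qed.
Let injs : injective (@sigma N). Proof. by case: planar. Qed.
Let inva : involutive (@alpha N). Proof. by case: planar. Qed.
Let noleg (d : N) : ~~ is_leg d. Proof. by case: planar. Qed.
Let nonsep : nonseparable N. Proof. by case: target. Qed.
Let rootT : (root : N) \notin T. Proof. by case: target => _ _ _ _ [[]]. Qed.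
Let arootT : alpha (root : N) \notin T.
Proof. by apply: contra rootT => /(rt_edge rtA)[_]; rewrite inva. Qed.

Let cmp (d : N) : A d (alpha d) || A (alpha d) d.
Proof.
have [dT|dT] := boolP (d \in T).
  by have := rt_mono rtA dT; case: (A d _).
case: target => _ _ _ _ [[_ ext _] _].
by case: (ext d (noleg d) dT) => /(ancestorE inva rtA) ->; rewrite ?orbT.
Qed.

Let eulerN : euler N.
Proof. by apply/(eulerP inva); case: planar. Qed.

Let root_sigma : sigma (root : N) != root.
Proof.
apply/eqP => rE; have [_ _ [[deg _] _] _ _] := target.
have : degree (root : N) <= 1.
  rewrite /degree -(cards1 (root : N)); apply: subset_leq_card; apply/subsetP => x.
  rewrite !inE => /iter_findex <-; elim: findex => //= k /eqP ->; exact/eqP.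
by rewrite deg addn2.
Qed.

(** By connectivity any further edge would make some other dart appear at the vertex of the loop,
    which would then separate the loop from the rest. *)
Let loop_all d : A d (alpha d) -> A (alpha d) d -> forall x, (x == d) || (x == alpha d).
Proof.
move=> dad add x; apply: contraT => xN; exfalso.
pose B : pred N := fun y => (y == d) || (y == alpha d).
have B_a y : B (alpha y) = B y.
  by rewrite /B (inv_eq inva) (inj_eq (inv_inj inva)) orbC.
have dv : fconnect sigma d (alpha d) by rewrite (rt_vertex rtA) dad.
have symf := fconnect_sym injs.
have [y /andP[dy yN]] : exists y, fconnect sigma d y && ~~ B y.
  apply/existsP; apply: contraT; rewrite negb_exists => /forallP all_B.
  have closedB u v : connect (link (@sigma N) (@alpha N)) u v -> B u -> B v.
    case/connectP=> q + ->; elim: q u => //= v' q IH u /andP[uv qp] Bu.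
    apply: IH qp _; case/orP: uv => /eqP->; last by rewrite B_a.
    have du : fconnect sigma d u by case/orP: Bu => /eqP->.
    have := all_B (sigma u); rewrite (connect_trans du (fconnect1 _ u)) /=.
    by rewrite negbK.
  have [_ _ _ conn _] := planar.
  by case/negP: xN; apply: (closedB d x); [exact: conn | rewrite /B eqxx].
apply: (@separates N B d d y injs inva noleg nonsep B_a) => //; first by rewrite /B eqxx.
by move=> u v /orP[]/eqP->.
Qed.

(** Otherwise the edges with an end in the subtree under [p] would meet the rest, which contains the
    edge of [z], only at the vertex of [alpha p]. *)
Let subtree_separates p z : p \in T -> A (alpha p) p -> A z (alpha p) -> A (alpha p) z ->
    ~~ A p (alpha z) ->
  exists e, [/\ A p e, A (alpha e) (alpha p) & ~~ A (alpha p) (alpha e)].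
Proof.
move=> pT app zap apz pz; apply: contrapT => nb.
have pap : ~~ A p (alpha p) by have := rt_mono rtA pT; rewrite app addbT.
have back e : A p e -> A (alpha e) (alpha p) -> A (alpha p) (alpha e).
  by move=> pe eap; apply: contraT => N1; case: nb; exists e.
pose B : pred N := fun y => A p y || A p (alpha y).
have B_a y : B (alpha y) = B y by rewrite /B inva orbC.
have fA x y : fconnect sigma x y = A x y && A y x := rt_vertex rtA x y.
apply: (@separates N B (alpha p) (alpha p) z injs inva noleg nonsep B_a).
- by rewrite /B inva (rt_refl rtA) orbT.
- by rewrite /B negb_or pz andbT; apply: contra pap => pz'; apply: trA pz' zap.
- exact: connect0.
- by rewrite fA zap apz.
move=> u v Bu; rewrite /B negb_or => /andP[pv pav]; rewrite fA => /andP[uv vu].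
have pu : ~~ A p u by apply: contra pv => pu; apply: trA pu uv.
rewrite /B (negPf pu) /= in Bu.
(* Here [u] is outside the subtree and [alpha u] inside. A tree edge must be the parent edge; an
   external one leads to an ancestor of [alpha p], which [back] forces to be at the same vertex. *)
have [uT|uT] := boolP (u \in T).
  have [_ auT] := rt_edge rtA uT.
  have := rt_exit rtA auT Bu; rewrite inva => /(_ pu)/andP[aup uau].
  have -> : p = alpha u by apply: (rt_uniq rtA) => //; rewrite inva.
  by rewrite inva connect0.
have uau : A u (alpha u).
  by case/orP: (cmp u) => // au; case/negP: pu; apply: trA Bu au.
have up : A u p by have := rt_chain rtA uau Bu; rewrite (negPf pu) orbF.
have uap : A u (alpha p).
  have := rt_parentE rtA pT app (rt_refl rtA p) (rt_refl rtA p) up.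
  by rewrite (negPf pu).
rewrite fA uap andbT; have := back (alpha u) Bu; rewrite inva; exact.
Qed.

Definition opened : growing :=
  @Growing (@cut N root) (alpha (root : N)) (mtree N).

Let alphaO (x : N) : x != root -> x != alpha root -> @alpha opened x = alpha x.
Proof. by move=> xr xa; rewrite /= /cut_fun (negPf xr) (negPf xa). Qed.

Let legO (x : N) : @is_leg opened x = (x == root) || (x == alpha root).
Proof.
rewrite /is_leg /= /cut_fun; case: ifP => [_|_]; first by rewrite eqxx.
exact/negbTE/noleg.
Qed.

Let rtO : @rooted_tree opened (mtree N) A.
Proof. exact: cut_rooted_tree. Qed.

Let injsO : injective (@sigma opened) := injs.
Let invaO : involutive (@alpha opened) := cut_funK root inva.

Lemma giso_close_opened : iso (close_map opened) N.
Proof.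
exists (id : close_map opened -> N); split=> //.
- by exists id.
- move=> x; rewrite /= /glue_alpha.
  have [->|xa] := eqVneq (x : N) (alpha (root : N)); first exact: (esym (inva root)).
  by have [->//|xr] := eqVneq (x : N) root; apply: alphaO.
case: target => _ _ _ -> _; rewrite !imset_id; split=> //.
by rewrite /edge setUC.
Qed.

Lemma explored_opened : explored i (A : rel opened).
Proof.
have connO : n_comp (@joined opened) opened = 1.
  by apply: connected_n_comp => //; apply: (rt_connected injsO invaO rtO).
have [eO _ fO] := euler_cut injs inva (noleg root) eulerN connO.
have mono (x : N) : x != root -> x != alpha root -> A x (alpha x) (+) A (alpha x) x.
  move=> xr xa; have := cmp x.
  have [xax|] /= := boolP (A x (alpha x)); last by move=> _ ->.
  have [axx|//] := boolP (A (alpha x) x).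
  have := loop_all xax axx root; rewrite eq_sym (negPf xr) /= => /eqP rE.
  by case/eqP: xa; rewrite rE inva.
have loop_root : A (alpha root) root -> alpha (root : N) = sigma root.
  move=> ar; have := loop_all (rt_root rtA (alpha root)) ar (sigma root).
  by rewrite (negPf root_sigma) => /eqP->.
have next : alpha (root : N) = sigma root \/ sigma (root : N) \in T.
  have [E|neq] := eqVneq (edge (sigma (root : N))) (edge (root : N)); last first.
    by right; case: target => _ _ _ _ [_ /(_ neq)].
  left; have : sigma (root : N) \in edge (root : N) by rewrite -E set21.
  by rewrite !inE (negPf root_sigma) => /eqP->.
split.
- exact: injs.
- exact: invaO.
- exact: eO.
- by case: target => _ _ [].
- exact: rtO.
- move=> x; rewrite legO negb_or => /andP[xr xa].
  by rewrite alphaO //; apply: mono.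
- by rewrite !legO !eqxx orbT; split=> //; apply: (noleg root).
- move=> x; rewrite legO => /orP[]/eqP->; last by rewrite connect0 (rt_refl rtA).
  split; last exact: rt_root rtA _.
  by rewrite fconnect_sym //; apply: inj_comp injs (inv_inj invaO).
- move=> p pT; have [pr pa] : p != (root : N) /\ p != alpha (root : N).
    by split; apply: contraTneq pT => ->; [exact: rootT | exact: arootT].
  (* The role of [z] is played by the parent dart [q] at the vertex of [alpha p]: its other end is
     strictly higher, hence not under [p]. *)
  rewrite alphaO // => app apr ph; have [q [qT [apq qap] aqq qP]] := rt_parent rtA apr.
  have paq : ~~ A p (alpha q).
    have := rt_mono rtA pT; rewrite app addbT; apply: contra => paq.
    by apply: trA (trA paq aqq) qap.
  have [e [pe eap ape]] := subtree_separates pT app qap apq paq.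
  have er : e != (root : N) by apply: contraTneq pe => ->; exact: (rt_parent_nonroot rtA pT app).
  have ea : e != alpha (root : N) by apply: contraNneq ph => eE; move: pe; rewrite eE.
  by exists e; rewrite legO negb_or er ea alphaO.
(* If the root-edge follows itself, it is a loop and the whole map. Otherwise a second tree edge at
   the root-vertex would yield, by [subtree_separates], an edge to a strict ancestor of the root. *)
- move=> x xT xr; case: next => [aE|sT].
    have all2 := loop_all (rt_root rtA (alpha root)).
    have ar : A (alpha root) root by rewrite aE (rt_sigmal rtA) (rt_refl rtA).
    have := all2 ar x; case/orP=> /eqP xE.
      by rewrite xE (negPf rootT) in xT.
    by rewrite xE (negPf arootT) in xT.
  apply: contrapT => /eqP neq.
  pose z : N := sigma root; pose p : N := @alpha N x.
  have zr : A z root by rewrite /z (rt_sigmal rtA) (rt_refl rtA).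
  have down y : y \in T -> A y root -> A y (alpha y).
    move=> yT yr; have := rt_mono rtA yT.
    by have -> : A y (alpha y) = true by apply: trA yr (rt_root rtA _).
  have [_ pT] := rt_edge rtA xT; have [_ azT] := rt_edge rtA sT.
  have app : A (alpha p) p by rewrite /p inva; apply: down.
  have pN := rt_parent_nonroot rtA pT app.
  have apx : alpha p = x by rewrite /p inva.
  have zap : A z (alpha p) by rewrite apx; apply: trA zr (rt_root rtA x).
  have apz : A (alpha p) z by rewrite apx; apply: trA xr (rt_root rtA z).
  have pz : ~~ A p (alpha z).
    apply/negP => paz; have zaz := down _ sT zr.
    have := rt_parentE rtA azT _ (rt_refl rtA _) (rt_refl rtA _) paz.
    rewrite inva => /(_ zaz)/orP[azp|pz]; last by case/negP: pN; apply: trA pz zr.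
    have pE : p = alpha z by apply: (rt_uniq rtA) => //; rewrite inva.
    by case/eqP: neq; rewrite -apx pE inva.
  have [e [pe eap ape]] := subtree_separates pT app zap apz pz.
  by case/negP: ape; rewrite apx; apply: trA xr (rt_root rtA _).
- exact: next.
- exact: loop_root.
Qed.

End Open.

Lemma iso_trans (M N R : marked_map) : iso M N -> iso N R -> iso M R.
Proof.
move=> [f [bf fs fa fr [fm ft]]] [g [bg gs ga gr [gm gt]]]; exists (g \o f); split.
- exact: bij_comp.
- by move=> d; rewrite /= fs gs.
- by move=> d; rewrite /= fa ga.
- by rewrite /= fr gr.
- by rewrite -gm -fm -gt -ft; split; apply: (imset_comp g f).
Qed.

Lemma giso_close (P Q : growing) (f : P -> Q) :
  giso f -> iso (close_map P) (close_map Q).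
Proof.
move=> isof; have injf := gi_inj isof; have [g fg gf] := gi_bij isof.
exists f; split.
- exact: gi_bij isof.
- exact: gi_sigma isof.
- move=> x; rewrite /= /glue_alpha -(gi_head isof) -(gi_root isof) !(inj_eq injf).
  by case: ifP => // _; case: ifP => // _; apply: gi_alpha.
- exact: gi_root isof.
- split; first by rewrite imsetU1 imset_set1 (gi_head isof) (gi_root isof).
  apply/setP=> y; apply/imsetP/idP => [[x xT ->]|yT]; first by rewrite (gi_tree isof).
  by exists (g y); rewrite ?gf // -(gi_tree isof) gf.
Qed.

(** The opened map has no legs but the head and the root, so the word obtained leaves both stacks
    empty; this gives the totals of a Kreweras walk. Its length comes from the number of edges. *)
Lemma Phi_surj (i n : nat) (N : marked_map) : near_cubic_depth_map i n N ->
  exists (w : seq letter) (M : marked_map),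
    [/\ kreweras i w, size w = 3 * n + 2 * i, Phi i w = Some M & iso M N].
Proof.
move=> target; have [[injs inva noleg _ _] _ [_ sizeN] _ [[spT _ _] _]] := target.
have [A rtA] := spanning_rooted injs inva spT.
have exO := explored_opened target rtA.
have [w [P [B [s1 [s2 [f [ok r isof]]]]]]] := reach_all exO erefl.
have ordP := rc_ordered r.
have legs (x : P) : is_leg x -> (x == head P) || (x == root).
  rewrite -(gi_leg isof) -2!(inj_eq (gi_inj isof)) (gi_head isof) (gi_root isof).
  rewrite /is_leg /= /cut_fun; case: ifP => [|_ /eqP E]; first by rewrite orbC.
  by have := noleg (f x); rewrite /is_leg E eqxx.
have c1 : count (@is_leg P) s1 = 0.
  apply/eqP; rewrite -leqn0 leqNgt -has_count; apply/hasPn => x xs.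
  by apply/negP => /legs; have [/negPf-> /negPf-> _] := tour_mem1 ordP xs.
have c2 : count (@is_leg P) s2 = 0.
  apply/eqP; rewrite -leqn0 leqNgt -has_count; apply/hasPn => x xs.
  by apply/negP => /legs; have [/negPf-> /negPf-> _] := tour_mem2 ordP xs.
have kw : kreweras i w.
  by apply: kreweras_ok => //; have := rc_left r; have := rc_right r; lia.
have wn : size w = 3 * n + 2 * i.
  have := rc_edges r; rewrite (gi_nonlegs isof) => wE.
  have nE : nonlegs N = nonlegs (opened N) + 2 := card_cut_fun inva (noleg root).
  have := card_edges inva; rewrite nE wE; move: sizeN; rewrite /near_cubic_size -muln2.
  by lia.
have [P' [_ [wE PhiE _ _]]] := Phi_defined kw wn.
have PP : P' = P by move: wE; rewrite (rc_word r) => -[].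
exists w, (close_map P); rewrite PhiE PP; split=> //.
exact: iso_trans (giso_close isof) (giso_close_opened target).
Qed.

(* Phi i is a bijection from walks to maps up to isomorphism: it is defined with
   values in the target set, injective, and surjective. *)
Theorem mainTheorem16 (i n : nat) :
  [/\ (forall w : seq letter, kreweras i w -> size w = 3 * n + 2 * i ->
         exists2 M : marked_map, Phi i w = Some M & near_cubic_depth_map i n M),
      (forall (w1 w2 : seq letter) (M1 M2 : marked_map),
         kreweras i w1 -> size w1 = 3 * n + 2 * i ->
         kreweras i w2 -> size w2 = 3 * n + 2 * i ->
         Phi i w1 = Some M1 -> Phi i w2 = Some M2 -> iso M1 M2 -> w1 = w2)
    & (forall N : marked_map, near_cubic_depth_map i n N ->
         exists (w : seq letter) (M : marked_map),
           [/\ kreweras i w, size w = 3 * n + 2 * i, Phi i w = Some M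
             & iso M N])].
Proof.
split.
- move=> w kw wn; have [P [A [_ PhiE _ target]]] := Phi_defined kw wn.
  by exists (close_map P).
- exact: Phi_inj.
- exact: Phi_surj.
Qed.
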